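(* Let $\gamma>1$ and let $(M^n, g)$ be a compact Riemannian manifold with $r^{\gamma}$-horn singularities. The continuous embedding $$W^{1, 2}_{\gamma-\frac{n\gamma}{2}, \gamma}(M, g) \hookrightarrow L^{2}(M, g)$$ is compact.
   Context: Definition. Let $\gamma>1$. $(M^{n},g)$ is a compact Riemannian manifold with $r^\gamma$-horn singularities if: (1) $M^{n}$ is a compact $n$-dimensional manifold with boundary $\partial M$, and $g$ is a smooth Riemannian metric on the interior $\mathring M=M\setminus\partial M$; (2) $\partial M$, endowed with a Riemannian metric $g_{\partial M}$, is the total space of a Riemannian submersion $\pi:(\partial M,g_{\partial M})\to(B^{b},\check g)$ onto a closed $b$-dimensional Riemannian manifold, with an $f$-dimensional closed manifold $F^{f}$ as typical fibre, $b+f=n-1$, and $g_{\partial M}=\hat g+\pi^{*}\check g$, where $\hat g$ denotes the metrics on the fibres induced by $g_{\partial M}$; (3) there is a collar neighborhood $U=(0,1)\times\partial M$ of $\partial M$ in $M$ with radial coordinate $r$ ($r=0$ corresponds to $\partial M$) on which $g=g_\gamma+h$, where $g_{\gamma}=dr^{2}+r^{2\gamma}\hat g+\pi^{*}\check g$ and $h$ satisfies $|r^{\gamma k}\nabla^{k}_{g_\gamma}h|_{g_\gamma}=O(r^{\alpha})$ as $r\to0$ for some $\alpha>0$ and all integers $k\ge0$. $\gamma$-weighted Sobolev spaces: for $p\ge1$, $k$ a nonnegative integer, $\delta\in\mathbb R$, $W^{k,p}_{\delta,\gamma}(M)$ is the completion of $C_0^\infty(\mathring M)$ in the norm $\|u\|_{W^{k,p}_{\delta,\gamma}(M)}=\big(\int_M\sum_{i=0}^k\chi^{p(\delta-\gamma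 i)+n\gamma}|\nabla^iu|_g^p\,d\mathrm{vol}_g\big)^{1/p}$, where $\chi\in C^\infty(\mathring M)$ is positive, $\chi=1$ on $M\setminus U$, $\chi=1/r$ where $r<1/10$, and $0<\chi^{-1}\le1$. *)

(* Defs.v *)
(* MathComp-Analysis has no manifolds, so the differential geometry below is
   set up in coordinates: a manifold is a topological space
   with an atlas, and a tensor field is the family of its components in the
   charts of that atlas, subject to the transformation law. *)
From HB Require Import structures.
From mathcomp Require Import all_boot all_order all_algebra.
From mathcomp Require Import all_classical all_reals all_analysis.

Set Implicit Arguments.
Unset Strict Implicit.
Unset Printing Implicit Defensive.

Import Order.TTheory GRing.Theory Num.Theory.
Import numFieldNormedType.Exports.

Local Open Scope classical_set_scope.
Local Open Scope ring_scope.

Section Euclidean.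
Variable R : realType.

Definition pderiv n (i : 'I_n) (f : 'rV[R]_n -> R) : 'rV[R]_n -> R :=
  'D_(delta_mx 0 i) (f : 'rV[R]_n -> R^o).

Definition iter_pderiv n (s : seq 'I_n) (f : 'rV[R]_n -> R) : 'rV[R]_n -> R :=
  foldr (@pderiv n) f s.

Definition smooth_open n (O : set 'rV[R]_n) (f : 'rV[R]_n -> R) : Prop :=
  forall (s : seq 'I_n) x, O x ->
    {for x, continuous (iter_pderiv s f)} /\
    forall i, derivable (iter_pderiv s f : _ -> R^o) x (delta_mx 0 i).

(* Smoothness on an arbitrary set, i.e. existence of local smooth extensions;
   needed at the boundary points of the half-space. *)
Definition smooth_on n (A : set 'rV[R]_n) (f : 'rV[R]_n -> R) : Prop :=
  forall x, A x -> exists O g,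
    [/\ open O, O x, smooth_open O g & forall y, (A `&` O) y -> g y = f y].

Definition smooth_map_on n m (A : set 'rV[R]_n) (f : 'rV[R]_n -> 'rV[R]_m)
  : Prop := forall j, smooth_on A (fun x => f x 0 j).

(* Tangent vectors are row vectors, and the differential is v |-> v *m jac f x. *)
Definition jac n m (f : 'rV[R]_n -> 'rV[R]_m) (x : 'rV[R]_n) : 'M[R]_(n, m) :=
  \matrix_(k, l) pderiv k (fun z => f z 0 l) x.

Definition half_space n : set 'rV[R]_n.+1 := [set x | 0 <= x 0 ord0].

(* Integral over R^n of a nonnegative Borel function, as an iterated integral
   (Tonelli). *)
Fixpoint rVintegral n : ('rV[R]_n -> \bar R) -> \bar R :=
  if n is m.+1 then fun f =>
    (\int[@lebesgue_measure R]_t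
        rVintegral (fun y : 'rV[R]_m => f (row_mx t%:M y)))%E
  else fun f => f 0.

End Euclidean.

Arguments half_space R n : clear implicits.

Section Manifolds.
Variable R : realType.

(* The values of cmap i outside dom i are irrelevant. *)
Record atlas (T : topologicalType) (n : nat) := Atlas {
  idx : Type;
  dom : idx -> set T;
  cmap : idx -> T -> 'rV[R]_n }.

Definition chart_image T n (A : @atlas T n) (i : idx A) : set 'rV[R]_n :=
  cmap i @` dom i.

Definition line_atlas : @atlas R 1 :=
  @Atlas R 1 unit (fun _ => setT) (fun _ t => t%:M).

Definition prod_atlas T1 T2 n1 n2 (A1 : @atlas T1 n1) (A2 : @atlas T2 n2) :
    @atlas (T1 * T2)%type (n1 + n2) :=
  @Atlas (T1 * T2)%type (n1 + n2) (idx A1 * idx A2)%type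
    (fun i => dom i.1 `*` dom i.2)
    (fun i p => row_mx (cmap i.1 p.1) (cmap i.2 p.2)).

(* A partial map is given by its graph r, which makes it possible to speak of
   partial inverses; chart_expr r i j is the expression of r in the charts i
   and j. *)
Section chart_expr.
Variables (T1 T2 : topologicalType) (n1 n2 : nat).
Variables (A1 : @atlas T1 n1) (A2 : @atlas T2 n2) (r : T1 -> T2 -> Prop).

Definition chart_dom (i : idx A1) (j : idx A2) : set 'rV[R]_n1 :=
  [set x | exists p q, [/\ r p q, dom i p, dom j q & cmap i p = x]].

Definition chart_expr (i : idx A1) (j : idx A2) (x : 'rV[R]_n1) : 'rV[R]_n2 :=
  xget 0 [set y | exists p q,
    [/\ r p q, dom i p, dom j q, cmap i p = x & cmap j q = y]].

Definition smooth_rel : Prop :=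
  forall i j, smooth_map_on (chart_dom i j) (chart_expr i j).

End chart_expr.

Arguments chart_dom {T1 T2 n1 n2} A1 A2 r i j.
Arguments chart_expr {T1 T2 n1 n2} A1 A2 r i j.

Definition graph_on T1 T2 (D : set T1) (f : T1 -> T2) (p : T1) (q : T2) : Prop :=
  D p /\ q = f p.

Definition converse T1 T2 (r : T1 -> T2 -> Prop) (q : T2) (p : T1) := r p q.

(* H is the model space: [set: 'rV_n], or the half-space for manifolds with
   boundary. *)
Record is_manifold T n (H : set 'rV[R]_n) (A : @atlas T n) : Prop := IsManifold {
  mf_hausdorff : hausdorff_space T;
  mf_second_countable : @second_countable T;
  mf_cover : forall p, exists i : idx A, dom i p;
  mf_open : forall i : idx A, open (dom i);
  mf_inj : forall i : idx A, set_inj (dom i) (cmap i);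
  mf_continuous : forall (i : idx A) p, dom i p -> {for p, continuous (cmap i)};
  mf_open_map : forall (i : idx A) (V : set T), open V -> V `<=` dom i ->
    exists2 O, open O & cmap i @` V = O `&` H;
  mf_smooth : smooth_rel A A (fun p q => p = q) }.

Definition closed_manifold T n (A : @atlas T n) : Prop :=
  is_manifold setT A /\ compact [set: T].

Record diffeo_onto T1 T2 n1 n2 (A1 : @atlas T1 n1) (A2 : @atlas T2 n2)
    (D : set T1) (f : T1 -> T2) (E : set T2) : Prop := DiffeoOnto {
  df_inj : set_inj D f;
  df_image : f @` D = E;
  df_continuous : {within D, continuous f};
  df_open_map : forall O, open O ->
    exists2 O', open O' & f @` (O `&` D) = O' `&` E;
  df_smooth : smooth_rel A1 A2 (graph_on D f);
  df_smooth_inv : smooth_rel A2 A1 (converse (graph_on D f)) }.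

Section boundary.
Variables (T : topologicalType) (n : nat) (A : @atlas T n.+1).

Definition boundary : set T :=
  [set p | exists i : idx A, dom i p /\ cmap i p 0 ord0 = 0].

Definition interior_atlas : @atlas T n.+1 :=
  @Atlas T n.+1 (idx A) (fun i => dom i `&` ~` boundary) (fun i => cmap i).

Definition boundary_atlas : @atlas boundary n :=
  @Atlas boundary n (idx A) (fun i => [set q | dom i (val q)])
    (fun i q => \row_k cmap i (val q) 0 (lift ord0 k)).

End boundary.

(* (0,2)-tensor fields: g i x is the matrix of components in the chart i at
   the point of coordinates x.  Only used for atlases modelled on R^n. *)
Definition field2 T n (A : @atlas T n) := idx A -> 'rV[R]_n -> 'M[R]_n.

Record is_metric T n (A : @atlas T n) (g : field2 A) : Prop := IsMetric {
  mt_smooth : forall i k l, smooth_on (chart_image i) (fun x => g i x k l);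
  mt_tensor : forall i j x, chart_dom A A (fun p q => p = q) i j x ->
    let phi := chart_expr A A (fun p q => p = q) i j in
    g i x = jac phi x *m g j (phi x) *m (jac phi x)^T;
  mt_sym : forall i x, chart_image i x -> (g i x)^T = g i x;
  mt_pos : forall i x, chart_image i x ->
    forall v : 'rV[R]_n, v != 0 -> 0 < (v *m g i x *m v^T) 0 0 }.

(* r^* g; the value does not depend on the chart j of the target. *)
Definition pullback T1 T2 n1 n2 (A1 : @atlas T1 n1) (A2 : @atlas T2 n2)
    (r : T1 -> T2 -> Prop) (g : field2 A2) : field2 A1 := fun i x =>
  xget 0 [set S | exists2 j, chart_dom A1 A2 r i j x &
    let phi := chart_expr A1 A2 r i j in
    S = jac phi x *m g j (phi x) *m (jac phi x)^T].

Arguments pullback {T1 T2 n1 n2} A1 A2 r g.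

Section covariant_derivative.
Variables (n : nat) (G : 'rV[R]_n -> 'M[R]_n).

Definition christoffel (l j k : 'I_n) (x : 'rV[R]_n) : R :=
  2^-1 * \sum_(m < n) invmx (G x) l m *
    (pderiv j (fun z => G z m k) x + pderiv k (fun z => G z m j) x
     - pderiv m (fun z => G z j k) x).

(* Components of a covariant tensor field of rank k are indexed by the
   sequences of length k. *)
Definition tensor := 'rV[R]_n -> seq 'I_n -> R.

(* (nabla T)_(j, s_0, .., s_k) = nabla_j T_(s_0, .., s_k) *)
Definition nabla (T : tensor) : tensor := fun x js =>
  if js is j :: s then
    pderiv j (fun z => T z s) x
    - \sum_(a < size s) \sum_(l < n)
        christoffel l j (nth j s a) x * T x (set_nth j s a l)
  else 0.

Definition tensor_norm (k : nat) (T : tensor) (x : 'rV[R]_n) : R :=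
  Num.sqrt (\sum_(s : k.-tuple 'I_n) \sum_(t : k.-tuple 'I_n)
    (\prod_(a < k) invmx (G x) (tnth s a) (tnth t a)) * T x s * T x t).

Definition tensor2 (h : 'rV[R]_n -> 'M[R]_n) : tensor := fun x s =>
  if s is [:: k; l] then h x k l else 0.

End covariant_derivative.

(* |nabla^k u|_g at p; the value does not depend on the chart i. *)
Definition nabla_norm T n (A : @atlas T n) (g : field2 A) (k : nat) (u : T -> R)
    (p : T) : R :=
  xget 0 [set z | exists2 i : idx A, dom i p &
    let u_i : tensor n := fun x _ =>
      chart_expr A line_atlas (graph_on setT u) i tt x 0 0 in
    z = tensor_norm (g i) k (iter k (nabla (g i)) u_i) (cmap i p)].

Section submersion.
Variables (N B : topologicalType) (m b : nat).
Variables (AN : @atlas N m) (AB : @atlas B b) (proj : N -> B).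
Variables (gN : field2 AN) (gB : field2 AB).

Let D i j x := chart_dom AN AB (graph_on setT proj) i j x.
Let dproj i j x := jac (chart_expr AN AB (graph_on setT proj) i j) x.

Definition vertical i j (x v : 'rV[R]_m) : Prop := v *m dproj i j x = 0.

Definition horizontal i j (x v : 'rV[R]_m) : Prop :=
  forall w, vertical i j x w -> v *m gN i x *m w^T = 0.

Record riemannian_submersion : Prop := RiemannianSubmersion {
  rs_continuous : continuous proj;
  rs_smooth : smooth_rel AN AB (graph_on setT proj);
  rs_surj : proj @` setT = setT;
  rs_submersion : forall i j x, D i j x -> row_full (dproj i j x);
  rs_isometry : forall i j x, D i j x ->
    forall v w : 'rV[R]_m, horizontal i j x v -> horizontal i j x w ->
    let y := chart_expr AN AB (graph_on setT proj) i j x in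
    (v *m dproj i j x) *m gB j y *m (w *m dproj i j x)^T = v *m gN i x *m w^T }.

(* The metrics induced by gN on the fibres, seen as a symmetric 2-tensor on N
   which vanishes on horizontal vectors. *)
Record is_fibre_metric (gF : field2 AN) : Prop := IsFibreMetric {
  fm_sym : forall i x, chart_image i x -> (gF i x)^T = gF i x;
  fm_vertical : forall i j x, D i j x -> forall v w : 'rV[R]_m,
    vertical i j x v -> vertical i j x w ->
    v *m gF i x *m w^T = v *m gN i x *m w^T;
  fm_horizontal : forall i j x, D i j x -> forall v w : 'rV[R]_m,
    horizontal i j x v -> v *m gF i x *m w^T = 0 }.

Definition typical_fibre (F : topologicalType) (f : nat) (AF : @atlas F f)
  : Prop :=
  forall x : B, exists V (Phi : B * F -> N),
    [/\ open V, V x,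
        diffeo_onto (prod_atlas AB AF) AN (V `*` setT) Phi (proj @^-1` V) &
        forall y z, V y -> proj (Phi (y, z)) = y].

End submersion.

Section horn.
Variables (gamma : R) (b f : nat).

(* dr^2 + r^(2 gamma) gF + gP in the coordinates (r, y) of R x N *)
Definition horn_model (N : topologicalType) (m : nat) (AN : @atlas N m)
    (gF gP : field2 AN) : field2 (prod_atlas line_atlas AN) := fun i x =>
  let r : R := lsubmx x 0 0 in let y := rsubmx x in
  block_mx 1%:M 0 0 (r `^ (2 * gamma) *: gF i.2 y + gP i.2 y).

Record horn_manifold := HornManifold {
  hM :> ptopologicalType;
  hA : @atlas hM (b + f).+1;
  hg : field2 (interior_atlas hA);
  hbdry_metric : field2 (boundary_atlas hA);
  hB : topologicalType;
  hAB : @atlas hB b;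
  hgB : field2 hAB;
  hF : topologicalType;
  hAF : @atlas hF f;
  hproj : boundary hA -> hB;
  hgF : field2 (boundary_atlas hA);
  hcollar : R * boundary hA -> hM;
  hA_manifold : is_manifold (half_space R (b + f)) hA;
  hM_compact : compact [set: hM];
  hg_metric : is_metric hg;
  hbdry_metric_metric : is_metric hbdry_metric;
  hB_closed : closed_manifold hAB;
  hgB_metric : is_metric hgB;
  hF_closed : closed_manifold hAF;
  hproj_submersion : riemannian_submersion hproj hbdry_metric hgB;
  hproj_fibre : typical_fibre (boundary_atlas hA) hAB hproj hAF;
  hgF_fibre : is_fibre_metric hAB hproj hbdry_metric hgF;
  hbdry_metricE : forall i x, chart_image i x ->
        hbdry_metric i x =
        hgF i x + pullback (boundary_atlas hA) hAB (graph_on setT hproj) hgB i x;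
  hcollar_open : open (hcollar @` [set z | 0 <= z.1 < 1]);
  hcollar_diffeo : diffeo_onto (prod_atlas line_atlas (boundary_atlas hA)) hA
        [set z | 0 <= z.1 < 1] hcollar (hcollar @` [set z | 0 <= z.1 < 1]);
  hcollar0 : forall q, hcollar (0, q) = val q;
  hdecay : let P := prod_atlas line_atlas (boundary_atlas hA) in
      let U := [set z : R * boundary hA | 0 < z.1 < 1] in
      let g_gamma :=
        horn_model hgF (pullback (boundary_atlas hA) hAB (graph_on setT hproj) hgB) in
      let h : field2 P := fun i x =>
        pullback P (interior_atlas hA) (graph_on U hcollar) hg i x - g_gamma i x in
      exists2 alpha : R, 0 < alpha & forall k : nat,
      exists C eps : R, 0 < eps < 1 /\
      forall (i : idx P) z, dom i z -> 0 < z.1 < eps ->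
        z.1 `^ (gamma * k%:R) *
          tensor_norm (g_gamma i) (k + 2)
            (iter k (nabla (g_gamma i)) (tensor2 (h i))) (cmap i z)
        <= C * z.1 `^ alpha }.

End horn.

Section sobolev.
Variables (gamma : R) (b f : nat) (X : horn_manifold gamma b f).

Let dM : measure_display := sigma_display (@open X).

Definition borel : measurableType dM := g_sigma_algebraType (@open X).

(* The Riemannian volume measure; g lives on the interior, so the boundary has
   measure zero. *)
Definition is_volume (mu : {measure set borel -> \bar R}) : Prop :=
  mu (boundary (hA X) : set borel) = 0%E /\
  forall (i : idx (interior_atlas (hA X))) (S : set borel),
    measurable S -> S `<=` dom i ->
    mu S = rVintegral (fun x =>
      (Num.sqrt (\det (hg i x)) * \1_(cmap i @` S) x)%:E).

(* chi, extended arbitrarily to the boundary *)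
Record is_weight (chi : X -> R) : Prop := IsWeight {
  wt_smooth : smooth_rel (interior_atlas (hA X)) line_atlas (graph_on setT chi);
  wt_pos : forall p, (~` boundary (hA X)) p -> 0 < chi p;
  wt_inv_pos : forall p, (~` boundary (hA X)) p -> 0 < (chi p)^-1 <= 1;
  wt_out : forall p, (~` boundary (hA X)) p ->
    ~ (@hcollar _ _ _ X @` [set z | 0 < z.1 < 1]) p -> chi p = 1;
  wt_in : forall (r : R) q, 0 < r < 10^-1 -> chi (hcollar (r, q)) = r^-1 }.

Definition test_function (u : X -> R) : Prop :=
  smooth_rel (interior_atlas (hA X)) line_atlas (graph_on setT u) /\
  exists K : set X, [/\ compact K, K `<=` ~` boundary (hA X) &
                        forall p, ~ K p -> u p = 0].

Variables (mu : {measure set borel -> \bar R}) (chi : X -> R).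

Definition sobolev_norm (k : nat) (p delta : R) (u : X -> R) : \bar R :=
  ((\int[mu]_(x in (~` boundary (hA X) : set borel))
      (\sum_(i < k.+1)
         chi x `^ (p * (delta - gamma * i%:R) + (b + f).+1%:R * gamma)
         * nabla_norm (@hg _ _ _ X) i u x `^ p)%:E) `^ p^-1)%E.

(* W with j is the completion of the test functions; only the values of j on
   test functions matter. *)
Record is_sobolev_space (k : nat) (p delta : R) (W : completeNormedModType R)
    (j : (X -> R) -> W) : Prop := IsSobolevSpace {
  sb_linear : forall (a : R) u v, test_function u -> test_function v ->
    j (fun x => a * u x + v x) = a *: j u + j v;
  sb_norm : forall u, test_function u -> `|j u|%:E = sobolev_norm k p delta u;
  sb_dense : closure (j @` test_function) = setT }.

(* The library puts no vector space structure on LspaceType, hence the a.e.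
   formulations. *)
Record is_compact_L2_embedding (W : completeNormedModType R)
    (j : (X -> R) -> W) (iota : W -> LspaceType2 mu) : Prop := {
  ce_linear : forall (a : R) v w,
    {ae mu, forall x, iota (a *: v + w) x = a * iota v x + iota w x};
  ce_extends : forall u, test_function u -> {ae mu, forall x, iota (j u) x = u x};
  ce_injective : injective iota;
  ce_continuous : exists C : R, forall w,
    ('N[mu]_2[(fun x => (iota w x)%:E)] <= (C * `|w|)%:E)%E;
  ce_compact : forall w_ : nat -> W, (exists C : R, forall m, `|w_ m| <= C) ->
    exists (s : nat -> nat) (v : LspaceType2 mu),
      {homo s : m1 m2 / (m1 < m2)%N} /\
      ('N[mu]_2[(fun x => (iota (w_ (s m)) x - v x)%:E)] @[m --> \oo] --> 0)%E }.

End sobolev.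
End Manifolds.

(* Main.v *)
(* A bounded sequence of test functions u_m is shown to be Cauchy in L^2 along
   any ultrafilter.  A compact subset of the interior is covered by finitely many
   cubes in charts, in which the metric is comparable to the Euclidean one; on
   each cube this is Rellich's lemma, obtained from the Poincare inequality on
   the cells of a fine subdivision, since the finitely many averages converge
   along the ultrafilter.  In the end r < eps <= 1/10 of the horn the weight
   chi^(2 gamma) = r^(- 2 gamma) of u^2 is at least 1 / eps, so the mass of u^2
   there is at most eps times the squared Sobolev norm.

   The embedding iota w is the L^2 limit of test functions approximating w.  Its
   injectivity says that a Sobolev-Cauchy sequence u_m which tends to 0 in L^2
   tends to 0 in the Sobolev norm.  Off the support of a fixed u_k the energy
   density of u_m is that of u_m - u_k, which is small; on that compact support
   chi is bounded, and the gradient of u_m tends to 0 by integration by parts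
   against a cutoff. *)
Require Import Defs.
From HB Require Import structures.
From mathcomp Require Import all_boot all_order all_algebra.
From mathcomp Require Import all_classical all_reals all_analysis measurable_realfun.
From mathcomp Require Import ring lra.

Set Implicit Arguments.
Unset Strict Implicit.
Unset Printing Implicit Defensive.

Import Order.TTheory GRing.Theory Num.Theory.
Import numFieldNormedType.Exports.

Local Open Scope classical_set_scope.
Local Open Scope ring_scope.

(** * Calculus in several variables *)

(** The completion [W] is abstract: its elements are not functions, so two of them with the same L^2
    image need an argument to be identified. This is why closability of the gradient stands beside
    Rellich's lemma, both being proved on cubes and transported by the same charts. The choice delta
    = gamma - n gamma / 2 makes the exponent of [chi] equal to 2 gamma on u^2 and 0 on the squared
    gradient. As chi >= 1, the squared Sobolev norm dominates both the L^2 mass and the Dirichlet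
    energy, and the gain in the horn comes from the zeroth order term alone. An ultrafilter is used
    because its sets can be intersected: the Cauchy conditions for finitely many cells, and then for
    finitely many charts, hold on one common set, with no successive subsequences. A subsequence is
    drawn from it once, at the end. On cubes all integrands are bounded and measurable, which keeps
    integrability out of the computations. *)

Section Calculus.
Variable R : realType.

(** The two difference quotients are equal as functions, so derivability and the value of the
    derivative transfer together. *)
Lemma line_growth (V W : normedModType R) (f : V -> W) (x v : V) (t : R) :
  (fun h : R => h^-1 *: (((fun s : R => f (x + s *: v)) \o shift t) (h *: 1) -
      f (x + t *: v))) =
  (fun h : R => h^-1 *: ((f \o shift (x + t *: v)) (h *: v) - f (x + t *: v))).
Proof.
apply/funext => h /=; congr (_ *: (f _ - _)).
by rewrite (_ : h *: 1 = h); [rewrite scalerDl addrCA | exact: mulr1].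
Qed.

Lemma derivable_line (V W : normedModType R) (f : V -> W) (x v : V) (t : R) :
  derivable (fun s : R => f (x + s *: v)) t 1 = derivable f (x + t *: v) v.
Proof. by rewrite /derivable line_growth. Qed.

Lemma derive_line (V W : normedModType R) (f : V -> W) (x v : V) (t : R) :
  'D_1 (fun s : R => f (x + s *: v)) t = 'D_v f (x + t *: v).
Proof. by rewrite /derive line_growth. Qed.

Lemma is_derive_line (V W : normedModType R) (f : V -> W) (x v : V) (t : R) :
  derivable f (x + t *: v) v ->
  is_derive t 1 (fun s : R => f (x + s *: v)) ('D_v f (x + t *: v)).
Proof. by move=> df; split; rewrite ?derivable_line ?derive_line. Qed.

Lemma rVnorm_coord n (v : 'rV[R]_n) i : `|v 0 i| <= `|v|.
Proof.
rewrite [leRHS]/Num.norm/= mx_normrE.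
by apply: (le_bigmax _ (fun ij : 'I_1 * 'I_n => `|v ij.1 ij.2|) (0, i)).
Qed.

Lemma rVnorm_le n (v : 'rV[R]_n) e :
  0 <= e -> (forall i, `|v 0 i| <= e) -> `|v| <= e.
Proof.
move=> e0 ve; rewrite [leLHS]/Num.norm/= mx_normrE.
by apply/bigmax_leP; split => // -[i j] _ /=; rewrite ord1.
Qed.

(** Vertices of a staircase from 0 to h whose k-th leg is parallel to the k-th axis. *)
Definition trunc n (h : 'rV[R]_n) (k : nat) : 'rV[R]_n :=
  \row_i (if (i < k)%N then h 0 i else 0).

Lemma trunc_step n (h : 'rV[R]_n) (k : 'I_n) :
  trunc h k.+1 = trunc h k + h 0 k *: delta_mx 0 k.
Proof.
apply/rowP => i; rewrite !mxE ltnS leq_eqVlt eqxx/=.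
have [->|ik] := eqVneq i k.
  by rewrite eqxx ltnn mulr1 add0r.
by rewrite -val_eqE/= in ik; rewrite (negbTE ik) /= mulr0 addr0.
Qed.

Lemma trunc0 n (h : 'rV[R]_n) : trunc h 0 = 0.
Proof. by apply/rowP => i; rewrite !mxE. Qed.

Lemma trunc_size n (h : 'rV[R]_n) : trunc h n = h.
Proof. by apply/rowP => i; rewrite !mxE ltn_ord. Qed.

(** The norm is the sup norm, so the legs of the staircase stay in the ball of radius |h|. *)
Lemma norm_trunc_add n (h : 'rV[R]_n) (k : 'I_n) t :
  `|t| <= `|h 0 k| -> `|trunc h k + t *: delta_mx 0 k| <= `|h|.
Proof.
move=> th; apply: rVnorm_le => // i; rewrite !mxE eqxx/=.
have [->|ik] := eqVneq i k.
  by rewrite ltnn add0r mulr1 (le_trans th)// rVnorm_coord.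
rewrite mulr0 addr0; case: ifP => _; first exact: rVnorm_coord.
by rewrite normr0.
Qed.

Lemma MVT_line (V : normedModType R) (f : V -> R) (y v : V) (s : R) :
  (forall t : R, `|t| <= `|s| -> derivable f (y + t *: v) v) ->
  exists2 t : R, `|t| <= `|s| & f (y + s *: v) - f y = s * 'D_v f (y + t *: v).
Proof.
move=> df.
(* Parametrizing by r in [0, 1] treats both signs of s at once. *)
pose g (r : R) := f (y + (r * s) *: v).
have gd (r : R) : r \in `[0, 1]%R -> is_derive r 1 g (s * 'D_v f (y + (r * s) *: v)).
  rewrite in_itv/= => /andP[r0 r1].
  have rs : `|r * s| <= `|s| by rewrite normrM ler_piMl// ger0_norm.
  have H := @is_derive_line _ R^o f _ _ _ (df _ rs).
  have E : g = (fun u : R => f (y + u *: v)) \o (fun r : R => r * s) by [].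
  have D : is_derive r 1 (fun r : R => r * s) s.
    have H' := is_deriveM (is_derive_id r (1:R)) (is_derive_cst s r (1:R)).
    apply: (is_derive_eq H').
    by rewrite scaler0 add0r; exact: mulr1.
  rewrite E mulrC; exact: is_derive1_comp.
have [c c01 Ec] := @MVT R g (fun r => s * 'D_v f (y + (r * s) *: v)) 0 1 ltr01
   (fun r rI => gd r (subset_itv_oo_cc rI)) (derivable_within_continuous (fun r rI => @ex_derive _ _ _ _ _ _ _ (gd r rI))).
exists (c * s).
  by rewrite normrM ler_piMl// ger0_norm (itvP c01).
by move: Ec; rewrite /g mul1r mul0r scale0r addr0 subr0 mulr1.
Qed.

Lemma cvg_sumr (T : Type) (F : set_system T) (I : Type) (r : seq I) (P : pred I)
    (f : I -> T -> R) (l : I -> R) : Filter F ->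
  (forall i, P i -> f i x @[x --> F] --> l i) ->
  (\sum_(i <- r | P i) f i x) @[x --> F] --> \sum_(i <- r | P i) l i.
Proof. by move=> FF fl; apply: cvg_big => //; exact: add_continuous. Qed.

Lemma cvg_prodr (T : Type) (F : set_system T) (I : Type) (r : seq I) (P : pred I)
    (f : I -> T -> R) (l : I -> R) : Filter F ->
  (forall i, P i -> f i x @[x --> F] --> l i) ->
  (\prod_(i <- r | P i) f i x) @[x --> F] --> \prod_(i <- r | P i) l i.
Proof. by move=> FF fl; apply: cvg_big => //; exact: mul_continuous. Qed.

Definition grad_form n (a : 'I_n -> R) (v : 'rV[R]_n) : R := \sum_k v 0 k * a k.

Lemma grad_form_linear n (a : 'I_n -> R) : linear (grad_form a : _ -> R^o).
Proof.
move=> l u v; rewrite /grad_form scaler_sumr -big_split/=.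
by apply: eq_bigr => k _; rewrite !mxE mulrDl -mulrA.
Qed.

HB.instance Definition _ n (a : 'I_n -> R) :=
  GRing.isLinear.Build R 'rV[R]_n R^o _ (grad_form a) (grad_form_linear a).

Lemma grad_form_continuous n (a : 'I_n -> R) : continuous (grad_form a).
Proof.
move=> v; apply: (@cvg_sumr _ (nbhs v)) => k _.
by apply: cvgM; [exact: coord_continuous|exact: cvg_cst].
Qed.

(** The increment telescopes along the staircase [trunc]; on each leg the mean value theorem gives a
    partial derivative at a point near x, and continuity compares it with the one at x. *)
Lemma C1_expansion n (f : 'rV[R]_n -> R) (x : 'rV[R]_n) :
  (\forall y \near x, forall k, derivable (f : _ -> R^o) y (delta_mx 0 k)) ->
  (forall k, {for x, continuous (pderiv k f)}) ->
  (f : _ -> R^o) \o shift x = cst (f x) + grad_form (fun k => pderiv k f x) +o_ (nbhs (0:'rV[R]_n)) id.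
Proof.
move=> df cf; apply/eqaddoP => _/posnumP[e].
(* The successor keeps the divisor nonzero in dimension 0. *)
pose N := (n.+1)%:R : R.
have N0 : 0 < N by rewrite ltr0n.
have eN : 0 < e%:num / N by rewrite divr_gt0.
have /nbhs_ballP[d /= d0 dP] : \forall y \near x,
    (forall k, derivable (f : _ -> R^o) y (delta_mx 0 k)) /\
    (forall k, `|pderiv k f x - pderiv k f y| <= e%:num / N).
  apply: filterI => //.
  apply: (@filter_forall _ _ (fun k y => `|pderiv k f x - pderiv k f y| <= e%:num / N) (nbhs x)) => k.
  by have /cvgrPdist_le := cf k; apply.
near=> h.
have hd : `|h| < d.
  by near: h; apply/nbhs_ballP; exists d => //= y; rewrite -ball_normE/= sub0r normrN.
have step (k : 'I_n) : `|f (x + trunc h k.+1) - f (x + trunc h k) - h 0 k * pderiv k f x|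
    <= e%:num / N * `|h|.
  have dk (t : R) : `|t| <= `|h 0 k| -> ball x d (x + trunc h k + t *: delta_mx 0 k).
    move=> th; rewrite -ball_normE/= -addrA opprD addNKr normrN.
    by rewrite (le_lt_trans _ hd)// norm_trunc_add.
  have [t th] := @MVT_line _ f (x + trunc h k) (delta_mx 0 k) (h 0 k)
    (fun t th => (dP _ (dk t th)).1 k).
  rewrite -addrA -trunc_step => ->; rewrite -mulrBr normrM mulrC.
  rewrite ler_pM ?rVnorm_coord// distrC.
  by have [_ /(_ k)] := dP _ (dk t th).
have -> : ((f : _ -> R^o) \o shift x - (cst (f x) + grad_form (fun k => pderiv k f x))) h =
   \sum_(k < n) (f (x + trunc h k.+1) - f (x + trunc h k) - h 0 k * pderiv k f x).
  rewrite sumrB.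
  have -> : \sum_(k < n) (f (x + trunc h k.+1) - f (x + trunc h k)) = f (x + h) - f x.
    rewrite -(big_mkord xpredT (fun k => f (x + trunc h k.+1) - f (x + trunc h k))).
    by rewrite telescope_sumr// trunc0 addr0 trunc_size.
  rewrite -[LHS]/(f (h + x) - (f x + grad_form (fun k => pderiv k f x) h)).
  by rewrite opprD addrA [h + x]addrC.
apply: (le_trans (ler_norm_sum _ _ _)).
apply: (@le_trans _ _ (\sum_(k < n) e%:num / N * `|h|)); first exact: ler_sum.
rewrite sumr_const card_ord -mulr_natl mulrA ler_wpM2r// mulrCA ger_pMr//.
by rewrite ler_pdivrMr// mul1r ler_nat.
Unshelve. all: by end_near. Qed.

Lemma C1_differentiable n (f : 'rV[R]_n -> R) (x : 'rV[R]_n) :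
  (\forall y \near x, forall k, derivable (f : _ -> R^o) y (delta_mx 0 k)) ->
  (forall k, {for x, continuous (pderiv k f)}) ->
  differentiable (f : _ -> R^o) x.
Proof.
move=> df cf; have E := C1_expansion df cf.
have D := diff_unique (@grad_form_continuous n _) E.
apply/diff_locallyP; rewrite D; split => //.
exact: grad_form_continuous.
Qed.

(** Along the line through x in direction k, phi is a function of one real variable, where
    derivability is differentiability; so the chain rule asks only directional derivatives of
    phi. *)
Lemma pderiv_comp n m (phi : 'rV[R]_n -> 'rV[R]_m) (g : 'rV[R]_m -> R) x k :
  (forall l, derivable ((fun z => phi z 0 l) : _ -> R^o) x (delta_mx 0 k)) ->
  differentiable (g : _ -> R^o) (phi x) ->
  derivable ((g \o phi) : _ -> R^o) x (delta_mx 0 k) /\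
  pderiv k (g \o phi) x =
    \sum_l pderiv k (fun z => phi z 0 l) x * pderiv l g (phi x).
Proof.
move=> dphi dg; set e := delta_mx 0 k.
have x0 : x = x + 0 *: e by rewrite scale0r addr0.
have dphiv : derivable phi x e by apply/derivable_mxP => i j; rewrite ord1.
have dl : differentiable (fun t : R => phi (x + t *: e)) 0.
  by apply/derivable1_diffP; rewrite derivable_line -x0.
have dgl : differentiable (g : _ -> R^o) ((fun t : R => phi (x + t *: e)) 0).
  by rewrite /= -x0.
have dc := differentiable_comp dl dgl.
split.
  rewrite x0 -(@derivable_line _ R^o (g \o phi) x e).
  exact/derivable1_diffP.
rewrite /pderiv -/e {1}x0 -(@derive_line _ R^o (g \o phi) x e).
rewrite deriveE//.
rewrite (@diff_comp _ _ _ _ (fun t : R => phi (x + t *: e)) (g : _ -> R^o) 0 dl dgl) /=.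
rewrite -(deriveE _ dl) derive_line -x0 derive_mx//.
set w := \matrix_(i, j) _.
rewrite (_ : w = \sum_l w 0 l *: delta_mx 0 l); last by rewrite -row_sum_delta.
rewrite linear_sum/=; apply: eq_bigr => l _.
by rewrite linearZ/= -deriveE// /w !mxE.
Qed.

End Calculus.

Section Smooth.
Variable R : realType.
Implicit Type n : nat.

Lemma iter_pderiv_rcons n (s : seq 'I_n) i (f : 'rV[R]_n -> R) :
  iter_pderiv (rcons s i) f = iter_pderiv s (pderiv i f).
Proof. by rewrite /iter_pderiv foldr_rcons. Qed.

Lemma smooth_open_pderiv n (O : set 'rV[R]_n) f i :
  smooth_open O f -> smooth_open O (pderiv i f).
Proof. by move=> fO s x Ox; rewrite -iter_pderiv_rcons; exact: fO. Qed.

Lemma smooth_open_continuous n (O : set 'rV[R]_n) f x :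
  smooth_open O f -> O x -> {for x, continuous f}.
Proof. by move=> fO Ox; have [] := fO [::] x Ox. Qed.

Lemma smooth_open_derivable n (O : set 'rV[R]_n) f x i :
  smooth_open O f -> O x -> derivable (f : _ -> R^o) x (delta_mx 0 i).
Proof. by move=> fO Ox; have [_] := fO [::] x Ox. Qed.

Lemma smooth_open_differentiable n (O : set 'rV[R]_n) f x :
  open O -> smooth_open O f -> O x -> differentiable (f : _ -> R^o) x.
Proof.
move=> oO fO Ox; apply: C1_differentiable => [|k].
  have : \forall y \near x, O y by exact: open_nbhs_nbhs.
  by apply: filterS => y Oy k; exact: smooth_open_derivable fO Oy.
exact: smooth_open_continuous (smooth_open_pderiv k fO) Ox.
Qed.

Lemma near_eq_iter_pderiv n (s : seq 'I_n) (f g : 'rV[R]_n -> R) (x : 'rV[R]_n) :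
  (\forall y \near x, f y = g y) ->
  \forall y \near x, iter_pderiv s f y = iter_pderiv s g y.
Proof.
move=> fg; elim: s => [//|i s IH] /=.
(* Equality near x is equality near every y close to x, hence survives one more derivative. *)
have := near_join IH; apply: filterS => y yfg.
exact: near_eq_derive.
Qed.

(** Iterated derivatives at x depend only on the germ of f. This turns the local extensions of
    [smooth_on] into smoothness of f itself. *)
Lemma smooth_open_near n (O : set 'rV[R]_n) (f : 'rV[R]_n -> R) :
  (forall x, O x -> exists2 g, smooth_open [set x] g & \forall y \near x, g y = f y) ->
  smooth_open O f.
Proof.
move=> fO s x Ox; have [g gs gf] := fO x Ox.
have [cg dg] := gs s x erefl.
have E := near_eq_iter_pderiv s gf; split.
  rewrite /prop_for /continuous_at -(nbhs_singleton E).
  apply: cvg_trans cg; exact: (@near_eq_cvg _ _ (nbhs x) _ (iter_pderiv s g) (iter_pderiv s f)).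
move=> i; exact: near_eq_derivable (dg i).
Qed.

Lemma smooth_open_sub n (O O' : set 'rV[R]_n) f :
  O' `<=` O -> smooth_open O f -> smooth_open O' f.
Proof. by move=> OO' fO s x /OO'; exact: fO. Qed.

Lemma smooth_on_open n (O : set 'rV[R]_n) f :
  open O -> smooth_on O f -> smooth_open O f.
Proof.
move=> oO fO; apply: smooth_open_near => x Ox.
have [V [g [oO' O'x gO' gf]]] := fO x Ox; exists g.
  by apply: smooth_open_sub gO' => _ ->.
have : \forall y \near x, (O `&` V) y.
  by apply: open_nbhs_nbhs; split=> //; apply: openI.
by apply: filterS => y /gf.
Qed.

Lemma iter_pderivD n (O : set 'rV[R]_n) a f g s : open O ->
  smooth_open O f -> smooth_open O g ->
  forall x, O x -> iter_pderiv s (fun x => a * f x + g x) x =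
     a * iter_pderiv s f x + iter_pderiv s g x.
Proof.
move=> oO fO gO; elim: s => [//|i s IH] x Ox /=.
rewrite {1}/pderiv (_ : 'D__ _ x = 'D_(delta_mx 0 i) ((a *: (iter_pderiv s f : _ -> R^o)) + (iter_pderiv s g : _ -> R^o)) x).
  have [_ /(_ i) df] := fO s x Ox; have [_ /(_ i) dg] := gO s x Ox.
  by rewrite deriveD//; [rewrite deriveZ|exact: derivableZ].
apply: near_eq_derive.
have : \forall y \near x, O y by exact: open_nbhs_nbhs.
by apply: filterS => y /IH.
Qed.

Lemma smooth_openD n (O : set 'rV[R]_n) a f g : open O ->
  smooth_open O f -> smooth_open O g -> smooth_open O (fun x => a * f x + g x).
Proof.
move=> oO fO gO s x Ox.
have E : \forall y \near x, a * iter_pderiv s f y + iter_pderiv s g y =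
     iter_pderiv s (fun x => a * f x + g x) y.
  have : \forall y \near x, O y by exact: open_nbhs_nbhs.
  by apply: filterS => y Oy; rewrite (iter_pderivD _ _ oO fO gO).
have [cf df] := fO s x Ox; have [cg dg] := gO s x Ox; split.
  rewrite /prop_for /continuous_at -(nbhs_singleton E).
  apply: cvg_trans (near_eq_cvg E) _.
  by apply: cvgD => //; apply: cvgM => //; exact: cvg_cst.
move=> i; apply: near_eq_derivable E _.
by apply: (@derivableD _ _ R^o) => //; exact: (@derivableZ _ _ R^o).
Qed.

End Smooth.

(** * Borel sets and Lebesgue measure on R^n *)

Lemma nbhs_open (T : topologicalType) (A : set T) :
  (forall x, A x -> nbhs x A) -> open A.
Proof. by move=> nA; rewrite openE => x /nA. Qed.

Section BorelTop.
Variable R : realType.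
Variable T : ptopologicalType.
(** Stated for any pointed space, so that the same lemmas serve R^n and the manifold, where it
    unfolds to [borel]. *)
Definition Bor : measurableType (sigma_display (@open T)) := g_sigma_algebraType (@open T).

Lemma Bor_open (A : set T) : open A -> measurable (A : set Bor).
Proof. by move=> oA; exact: sub_sigma_algebra. Qed.

Lemma Bor_closed (A : set T) : closed A -> measurable (A : set Bor).
Proof.
move=> cA; rewrite -(setCK A); apply: measurableC; apply: Bor_open.
exact: closed_openC.
Qed.

(** On [D] the preimage of an open interval coincides with the interior of that preimage, which is
    Borel. *)
Lemma Bor_continuous_fun (D : set T) (f : T -> R) : measurable (D : set Bor) ->
  (forall x, D x -> {for x, continuous f}) ->
  measurable_fun (D : set Bor) f.
Proof.
move=> mD cf; apply: (measurability _ (RGenOpens.measurableE R)).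
move=> _ [_ [a [b ->]] <-].
rewrite (_ : _ `&` _ = (D : set Bor) `&` (interior (f @^-1` `]a, b[%classic) : set Bor)).
  by apply: measurableI => //; apply: Bor_open; exact: open_interior.
apply/seteqP; split => x [Dx fx]; split => //.
  by apply: (cf _ Dx); apply: open_nbhs_nbhs; split => //; exact: interval_open.
exact: interior_subset fx.
Qed.

Lemma Bor_continuous (f : T -> R) : continuous f ->
  measurable_fun [set: Bor] f.
Proof. by move=> cf; apply: Bor_continuous_fun; [exact: measurableT|move=> x _; exact: cf]. Qed.

End BorelTop.

Section Lam.
Variable R : realType.
Definition BrV n : measurableType (sigma_display (@open 'rV[R]_n)) :=
  g_sigma_algebraType (@open 'rV[R]_n).
Notation leb := (@lebesgue_measure R).

Lemma measurable_coord n i : measurable_fun [set: BrV n] (fun x : BrV n => x 0 i : R).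
Proof. by apply: Bor_continuous; exact: coord_continuous. Qed.

(** An open set of R^n is a countable union of boxes with rational centre and radius, and a box is a
    finite conjunction of conditions on coordinates. *)
Lemma measurable_rV d (S : measurableType d) n (f : S -> BrV n) :
  (forall i, measurable_fun setT (fun x => f x 0 i : R)) ->
  measurable_fun setT f.
Proof.
move=> mf; apply: (measurability (@open _ : set (set (BrV n)))) => //.
move=> _ [U oU <-]; rewrite setTI.
pose I := ({ffun 'I_n -> rat} * rat)%type.
pose bx (q : I) : set 'rV[R]_n := [set x | forall i, `|x 0 i - ratr (q.1 i)| < ratr q.2].
pose P := [set q : I | bx q `<=` U].
have -> : f @^-1` U = \bigcup_(q in P) \bigcap_(i in [set: 'I_n])
     [set x | `|f x 0 i - ratr (q.1 i)| < ratr q.2].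
  apply/seteqP; split => [x /= Ux|x [q Pq qx]]; last first.
    by apply: Pq => i; exact: qx.
  have /nbhs_ballP[e /= e0 eU] : nbhs (f x) U by exact: open_nbhs_nbhs.
  (* Two points of a box of radius less than e / 2 are at distance less than e. *)
  have [q2 q20 q2e] : exists2 q2 : rat, 0 < ratr q2 :> R & ratr q2 < e / 2 :> R.
    have : 0 < e / 2 by rewrite divr_gt0.
    by move/rat_in_itvoo => [q]; rewrite in_itv/= => /andP[]; exists q.
  have Hq i : exists q : rat, `|f x 0 i - ratr q| < ratr q2 :> R.
    have : f x 0 i - ratr q2 < f x 0 i + ratr q2 by lra.
    move/rat_in_itvoo => [q]; rewrite in_itv/= => /andP[q1' q2']; exists q.
    by rewrite ltr_norml; apply/andP; split; lra.
  pose q1 : {ffun 'I_n -> rat} := [ffun i => xchoose (Hq i)].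
  exists (q1, q2) => /=.
    move=> y yq; apply: eU; rewrite -ball_normE/=.
    apply: (@le_lt_trans _ _ (e / 2 + ratr q2)); last by lra.
    apply: rVnorm_le; first by lra.
    move=> i; rewrite !mxE.
    have := yq i; have := xchooseP (Hq i); rewrite /= ffunE => h1 h2.
    rewrite (_ : _ - _ = (f x 0 i - ratr (xchoose (Hq i))) - (y 0 i - ratr (xchoose (Hq i)))); last by ring.
    rewrite (le_trans (ler_normB _ _))//; lra.
  by move=> i _ /=; rewrite ffunE; exact: (xchooseP (Hq i)).
rewrite bigcup_mkcond.
apply: countable_bigcupT_measurable; first exact: countableP.
move=> q; case: ifP => // _.
apply: fin_bigcap_measurable => // i _.
rewrite (_ : mkset _ = setT `&` (fun x => f x 0 i) @^-1` [set t | `|t - ratr (q.1 i)| < ratr q.2]); last by rewrite setTI.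
apply: mf => //.
have -> : [set t : R | `|t - ratr (q.1 i)| < ratr q.2] =
    `](ratr (q.1 i) - ratr q.2), (ratr (q.1 i) + ratr q.2)[%classic.
  by apply/seteqP; split => t /=; rewrite in_itv/= ltr_distl.
exact: measurable_itv.
Qed.

Definition row_cons n (p : measurableTypeR R * BrV n) : BrV n.+1 := row_mx p.1%:M p.2.

Lemma row_cons0 n p : @row_cons n p 0 0 = p.1.
Proof.
transitivity ((row_mx (p.1%:M : 'M[R]_1) p.2 : 'M[R]_(1, 1 + n)) 0 (lshift n ord0)).
  by congr (row_mx _ _ _ _); exact: val_inj.
by rewrite row_mxEl mxE eqxx.
Qed.

Lemma row_consS n p k : @row_cons n p 0 (lift 0 k) = p.2 0 k.
Proof.
transitivity ((row_mx (p.1%:M : 'M[R]_1) p.2 : 'M[R]_(1, 1 + n)) 0 (rshift 1 k)).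
  by congr (row_mx _ _ _ _); exact: val_inj.
by rewrite row_mxEr.
Qed.

Lemma measurable_row_cons n : measurable_fun setT (@row_cons n).
Proof.
apply: measurable_rV => i; case: (unliftP 0 i) => [k ->|->].
  under eq_fun do rewrite row_consS.
  by apply: (measurableT_comp (@measurable_coord n k)).
under eq_fun do rewrite row_cons0.
exact: measurable_fst.
Qed.

Lemma norm_row_cons n p : `|@row_cons n p : 'rV[R]_n.+1| = Num.max `|p.1| `|p.2 : 'rV[R]_n|.
Proof.
apply/eqP; rewrite eq_le; apply/andP; split.
  apply: rVnorm_le; first by rewrite le_max normr_ge0.
  move=> i; case: (unliftP 0 i) => [k ->|->].
    by rewrite row_consS le_max rVnorm_coord orbT.
  by rewrite row_cons0 le_max lexx.
rewrite ge_max; apply/andP; split.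
  by rewrite -{1}(row_cons0 p) rVnorm_coord.
apply: rVnorm_le => // i; rewrite -(row_consS p); exact: rVnorm_coord.
Qed.

Definition closed_cube n (r : R) : set (BrV n) := [set x | `|x : 'rV[R]_n| <= r].

Lemma closed_cube_row_cons n p r :
  closed_cube r (@row_cons n p) <-> `|p.1| <= r /\ closed_cube r p.2.
Proof.
have E := norm_row_cons p; rewrite /closed_cube /=; split.
  by move=> H; apply/andP; rewrite -ge_max -E.
by move=> /andP; rewrite -ge_max -E.
Qed.

Lemma measurable_closed_cube n (r : R) : measurable (@closed_cube n r).
Proof.
apply: Bor_closed; rewrite (_ : closed_cube _ = (fun x : 'rV[R]_n => `|x|) @^-1` [set t : R | t <= r]) //.
apply: (@closed_comp _ _ _ [set t : R | t <= r]); last exact: closed_le.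
by move=> x _; exact: norm_continuous.
Qed.

(** Lebesgue measure is built by pushing the product with the line forward along [row_cons], so that
    Tonelli identifies its integral with [rVintegral], the integral that [is_volume] speaks of.
    Finiteness on cubes is carried along because it yields the sigma-finiteness needed for the next
    product. *)
Lemma lam_exists n : exists m : {sigma_finite_measure set (BrV n) -> \bar R},
  (forall r : R, (m (@closed_cube n r) < +oo)%E) /\
  (forall f : BrV n -> \bar R, measurable_fun setT f -> (forall x, (0 <= f x)%E) ->
     \int[m]_x f x = rVintegral f)%E.
Proof.
elim: n => [|n [m [mb mI]]].
  (* In dimension 0, [rVintegral] is evaluation at 0. *)
  exists (@dirac _ (BrV 0) 0 R); split.
    by move=> r; rewrite /= diracE; case: (_ \in _) => //=; rewrite ltry.
  by move=> f mf f0; rewrite integral_dirac// diracT mul1e.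
have [mu muE] : exists mu : {measure set (BrV n.+1) -> \bar R},
    (mu : set (BrV n.+1) -> \bar R) = pushforward (leb \x m)%E (@row_cons n).
  by exists (measure_function_pushforward__canonical__measure_function_Measure
    (leb \x m)%E (@measurable_row_cons n)).
have fb (r : R) : (mu (@closed_cube n.+1 r) < +oo)%E.
  rewrite muE /pushforward.
  rewrite (_ : _ @^-1` _ = `[- r, r]%classic `*` @closed_cube n r).
    rewrite product_measure1E//; last exact: measurable_closed_cube.
    have lf : leb `[- r, r]%classic \is a fin_num.
      by rewrite lebesgue_measure_itv; case: ifP => _ //; rewrite -EFinD.
    exact: lte_mul_pinfty (measure_ge0 _ _) lf (mb r).
  apply/seteqP; split => -[t y] /=; rewrite /= in_itv/= -ler_norml.
    by move=> /closed_cube_row_cons.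
  by move=> ?; apply/closed_cube_row_cons.
have sf : sigma_finite setT mu.
  exists (fun k => @closed_cube n.+1 k%:R).
    apply/esym/seteqP; split => // x _.
    by exists (Num.truncn `|x|).+1 => //=; apply/ltW; exact: truncnS_gt.
  by move=> k; split; [exact: measurable_closed_cube|exact: fb].
pose SF := @isSFinite.Build _ _ _ mu (sfinite_measure_sigma_finite sf).
pose SG := @isSigmaFinite.Build _ _ _ mu sf.
pose mm : {sigma_finite_measure set (BrV n.+1) -> \bar R} :=
  HB.pack (Measure.sort mu) SF SG.
exists mm; split => //= f mf f0.
pose P : {measure set (BrV n.+1) -> \bar R} :=
  measure_function_pushforward__canonical__measure_function_Measure
    (leb \x m)%E (@measurable_row_cons n).
rewrite (@eq_measure_integral _ _ _ _ P); last by move=> A mA _; rewrite muE.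
have -> := @ge0_integral_pushforward _ _ _ _ _ _ (@measurable_row_cons n)
   (leb \x m)%E setT f measurableT mf (fun x _ => f0 x).
rewrite preimage_setT fubini_tonelli1//=; last first.
  exact: (measurableT_comp mf (@measurable_row_cons n)).
apply: eq_integral => t _; rewrite /fubini_F -mI//=.
apply: (measurableT_comp mf).
exact: (measurable_fun_pair2 t (@measurable_row_cons n)).
Qed.

End Lam.

Section Integrals.
Context d (T : measurableType d) (R : realType).
Implicit Types mu : {measure set T -> \bar R}.
Local Open Scope ereal_scope.

(** The measures are comparable only inside [D], so both are first restricted to [D]. *)
Lemma le_measure_integral (m1 m2 : {measure set T -> \bar R}) (c : R) (D : set T) (f : T -> \bar R) :
  (0 <= c)%R -> measurable D -> measurable_fun D f -> (forall x, D x -> 0 <= f x) ->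
  (forall A, measurable A -> A `<=` D -> m1 A <= c%:E * m2 A) ->
  \int[m1]_(x in D) f x <= c%:E * \int[m2]_(x in D) f x.
Proof.
move=> c0 mD mf f0 m12.
pose k : {nonneg R} := NngNum c0.
have rE (m : {measure set T -> \bar R}) :
    \int[m]_(x in D) f x = \int[mrestr m mD]_(x in D) (f \_ D) x.
  rewrite (@eq_measure_integral _ _ _ _ (mrestr m mD)); last first.
    by move=> A mA AD; rewrite /= /mrestr setIidl.
  by apply: eq_integral => x xD; rewrite patchE xD.
have mfD : measurable_fun setT (f \_ D) by apply/(measurable_restrictT _ mD).1.
have fD0 x : 0 <= (f \_ D) x.
  by rewrite patchE; case: ifPn => // /set_mem; exact: f0.
rewrite !rE -[c]/(k%:num)%R -ge0_integral_mscale//; last exact: measurable_funTS.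
apply: ge0_le_measure_integral => // A mA.
rewrite /mscale /= /mrestr; apply: m12; first exact: measurableI.
exact: subIsetr.
Qed.

End Integrals.

(** * Bounded measurable functions on a set of finite measure *)

Section BoundedMeasurable.
Context d (T : measurableType d) (R : realType) (mu : {measure set T -> \bar R}).
Variables (D : set T) (mD : measurable D) (fD : (mu D < +oo)%E).
Implicit Types f g : T -> R.

(** On a set of finite measure these functions are integrable and form an algebra, so products and
    squares can be integrated without further conditions. *)
Definition bmeas f := measurable_fun D f /\ exists M : R, forall x, D x -> `|f x| <= M.

Lemma bmeas_integrable f : bmeas f -> mu.-integrable D (EFin \o f).
Proof.
move=> [mf [M fM]]; apply: measurable_bounded_integrable => //.
exists M; split; first exact: num_real.
by move=> x Mx y Dy /=; apply: (le_trans (fM _ Dy)); exact: ltW.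
Qed.

Lemma bmeas_cst c : bmeas (fun=> c).
Proof. by split => //; exists `|c|. Qed.

Lemma bmeasD f g : bmeas f -> bmeas g -> bmeas (fun x => f x + g x).
Proof.
move=> [mf [M fM]] [mg [N gN]]; split; first exact: measurable_funD.
exists (M + N) => x Dx; rewrite (le_trans (ler_normD _ _))//.
by rewrite lerD ?fM ?gN.
Qed.

Lemma bmeasM f g : bmeas f -> bmeas g -> bmeas (fun x => f x * g x).
Proof.
move=> [mf [M fM]] [mg [N gN]]; split; first exact: measurable_funM.
by exists (M * N) => x Dx; rewrite normrM ler_pM ?fM ?gN.
Qed.

Lemma bmeasZ c f : bmeas f -> bmeas (fun x => c * f x).
Proof. by move=> bf; apply: bmeasM => //; exact: bmeas_cst. Qed.

Lemma bmeasB f g : bmeas f -> bmeas g -> bmeas (fun x => f x - g x).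
Proof.
move=> bf bg; have := bmeasD bf (bmeasZ (-1) bg).
by under eq_fun do rewrite mulN1r.
Qed.

Lemma bmeas_sqr f : bmeas f -> bmeas (fun x => f x ^+ 2).
Proof. by move=> bf; exact: bmeasM. Qed.

Lemma bmeas_abs f : bmeas f -> bmeas (fun x => `|f x|).
Proof.
move=> [mf [M fM]]; split; first exact: measurableT_comp.
by exists M => x Dx; rewrite normr_id fM.
Qed.

Lemma bmeas_sum (I : Type) (r : seq I) (F : I -> T -> R) :
  (forall i, bmeas (F i)) -> bmeas (fun x => \sum_(i <- r) F i x).
Proof.
move=> bF; elim: r => [|i r IH].
  by under eq_fun do rewrite big_nil; exact: bmeas_cst.
by under eq_fun do rewrite big_cons; exact: bmeasD.
Qed.

Lemma Rint_D f g : bmeas f -> bmeas g ->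
  \int[mu]_(x in D) (f x + g x) = \int[mu]_(x in D) f x + \int[mu]_(x in D) g x.
Proof. by move=> bf bg; rewrite RintegralD//; exact: bmeas_integrable. Qed.

Lemma Rint_B f g : bmeas f -> bmeas g ->
  \int[mu]_(x in D) (f x - g x) = \int[mu]_(x in D) f x - \int[mu]_(x in D) g x.
Proof. by move=> bf bg; rewrite RintegralB//; exact: bmeas_integrable. Qed.

Lemma Rint_Z c f : bmeas f ->
  \int[mu]_(x in D) (c * f x) = c * \int[mu]_(x in D) f x.
Proof. by move=> bf; rewrite RintegralZl//; exact: bmeas_integrable. Qed.

Lemma Rint_sum (I : Type) (r : seq I) (F : I -> T -> R) :
  (forall i, bmeas (F i)) ->
  \int[mu]_(x in D) (\sum_(i <- r) F i x) = \sum_(i <- r) \int[mu]_(x in D) F i x.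
Proof.
move=> bF; elim: r => [|i r IH].
  by under eq_Rintegral do rewrite big_nil; rewrite Rintegral_cst// mul0r big_nil.
under eq_Rintegral do rewrite big_cons.
rewrite big_cons Rint_D// ?IH//; exact: bmeas_sum.
Qed.

Lemma Rint_le f g : bmeas f -> bmeas g -> (forall x, D x -> f x <= g x) ->
  \int[mu]_(x in D) f x <= \int[mu]_(x in D) g x.
Proof. by move=> bf bg fg; apply: le_Rintegral => //; exact: bmeas_integrable. Qed.

Lemma Rint_abs f : bmeas f ->
  `|\int[mu]_(x in D) f x| <= \int[mu]_(x in D) `|f x|.
Proof. by move=> bf; apply: le_normr_Rintegral => //; exact: bmeas_integrable. Qed.

Lemma Rint_EFin f : bmeas f ->
  (\int[mu]_(x in D) (f x)%:E = (\int[mu]_(x in D) f x)%:E)%E.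
Proof.
by move=> bf; rewrite /Rintegral fineK//; apply: integrable_fin_num => //; exact: bmeas_integrable.
Qed.

(** With V the measure of [D] and J the integral of f, the integral of (V f - J)^2 equals V times (V
    * integral of f^2 - J^2) and is nonnegative. If V = 0 then J = 0 as well. *)
Lemma Rint_CS f : bmeas f ->
  (\int[mu]_(x in D) f x) ^+ 2 <= fine (mu D) * \int[mu]_(x in D) (f x ^+ 2).
Proof.
move=> bf; set V := fine (mu D); set J := \int[mu]_(x in D) f x.
have V0 : 0 <= V by rewrite fine_ge0.
have : 0 <= \int[mu]_(x in D) ((V * f x - J) ^+ 2) by apply: Rintegral_ge0 => x _; exact: sqr_ge0.
have -> : \int[mu]_(x in D) ((V * f x - J) ^+ 2) =
  V ^+ 2 * \int[mu]_(x in D) (f x ^+ 2) - V * J ^+ 2.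
  transitivity (\int[mu]_(x in D) ((V ^+ 2 * f x ^+ 2 - (2 * V * J) * f x) + J ^+ 2)).
    by apply: eq_Rintegral => x _; ring.
  have b2 := bmeas_sqr bf.
  rewrite Rint_D ?Rintegral_cst ?Rint_B ?Rint_Z// -/J -/V; first by ring.
  - exact: bmeasZ.
  - exact: bmeasZ.
  - by apply: bmeasB; exact: bmeasZ.
  - exact: bmeas_cst.
have [V00|Vn0] := eqVneq V 0; last first.
  have Vp : 0 < V by rewrite lt_neqAle eq_sym Vn0.
  by rewrite expr2 -mulrA -mulrBr pmulr_rge0// subr_ge0.
move=> _; rewrite V00 mul0r.
suff -> : J = 0 by rewrite expr0n.
have D0 : mu D = 0%E.
  by apply/eqP; rewrite -[mu D]fineK -/V ?V00// ge0_fin_numE.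
rewrite /J /Rintegral; have -> // : (\int[mu]_(x in D) (f x)%:E = 0)%E.
apply: null_set_integral => //; apply/measurable_EFinP; exact: bf.1.
Qed.

End BoundedMeasurable.

Section BoundedFubini.
Context d1 d2 (T1 : measurableType d1) (T2 : measurableType d2) (R : realType).
Variable m1 : {sigma_finite_measure set T1 -> \bar R}.
Variable m2 : {sigma_finite_measure set T2 -> \bar R}.
Variables (D1 : set T1) (D2 : set T2) (mD1 : measurable D1) (mD2 : measurable D2).
Hypotheses (fD1 : (m1 D1 < +oo)%E) (fD2 : (m2 D2 < +oo)%E).
Variable f : T1 * T2 -> R.
Hypothesis bf : bmeas (D1 `*` D2) f.

Let D := D1 `*` D2.
Let mD : measurable D. Proof. exact: measurableX. Qed.
Let fD : ((m1 \x m2)%E D < +oo)%E.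
Proof.
rewrite product_measure1E// lte_mul_pinfty//.
by rewrite ge0_fin_numE.
Qed.

(** Extension by zero, since Fubini's theorem is applied on the whole product. *)
Let g : T1 * T2 -> \bar R := (EFin \o f) \_ D.

Let ig : (m1 \x m2)%E.-integrable setT g.
Proof. by apply/(integrable_mkcond _ mD).1; apply: bmeas_integrable. Qed.

Let slice1 x : D1 x -> bmeas D2 (fun y => f (x, y)).
Proof.
move=> Dx; case: bf => mf [M fM]; split; last by exists M => y Dy; exact: fM.
move=> _ Y mY; have /measurable_xsection := mf mD Y mY.
move=> /(_ x); congr measurable; apply/seteqP; split => y; rewrite /xsection/= inE.
  by move=> [[_ Dy] Yf].
by move=> [Dy Yf]; split.
Qed.

Let slice2 y : D2 y -> bmeas D1 (fun x => f (x, y)).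
Proof.
move=> Dy; case: bf => mf [M fM]; split; last by exists M => x Dx; exact: fM.
move=> _ Y mY; have /measurable_ysection := mf mD Y mY.
move=> /(_ y); congr measurable; apply/seteqP; split => x; rewrite /ysection/= inE.
  by move=> [[Dx _] Yf].
by move=> [Dx Yf]; split.
Qed.

Let FE x : D1 x -> fubini_F m2 g x = (\int[m2]_(y in D2) f (x, y))%:E.
Proof.
move=> Dx; rewrite /fubini_F -Rint_EFin//; last exact: slice1.
rewrite [RHS]integral_mkcond; apply: eq_integral => y _.
rewrite /g !patchE; congr (if _ then _ else _).
by apply/idP/idP; rewrite !inE /D /=; [case|].
Qed.

Let GE y : D2 y -> fubini_G m1 g y = (\int[m1]_(x in D1) f (x, y))%:E.
Proof.
move=> Dy; rewrite /fubini_G -Rint_EFin//; last exact: slice2.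
rewrite [RHS]integral_mkcond; apply: eq_integral => x _.
rewrite /g !patchE; congr (if _ then _ else _).
by apply/idP/idP; rewrite !inE /D /=; [case|].
Qed.

Lemma bmeas_slice1 x : D1 x -> bmeas D2 (fun y => f (x, y)).
Proof. exact: slice1. Qed.

Lemma bmeas_slice2 y : D2 y -> bmeas D1 (fun x => f (x, y)).
Proof. exact: slice2. Qed.

Lemma bmeas_int1 : bmeas D1 (fun x => \int[m2]_(y in D2) f (x, y)).
Proof.
split.
  have mF : measurable_fun D1 (fubini_F m2 g).
    by apply: measurable_funTS; exact: (measurable_fubini_F ig).
  apply/measurable_EFinP; apply: eq_measurable_fun mF => x /set_mem Dx.
  exact: FE.
case: (bf) => _ [M fM]; exists (`|M| * fine (m2 D2)) => x Dx.
have bs := slice1 Dx.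
apply: le_trans (le_normr_Rintegral _ (bmeas_integrable _ _ bs)) _ => //.
rewrite -Rintegral_cst//; apply: Rint_le => //; [exact: bmeas_abs|exact: bmeas_cst|].
by move=> y Dy; rewrite (le_trans (fM (x, y) _))// ler_norm.
Qed.

Lemma bmeas_int2 : bmeas D2 (fun y => \int[m1]_(x in D1) f (x, y)).
Proof.
split.
  have mG : measurable_fun D2 (fubini_G m1 g).
    by apply: measurable_funTS; exact: (measurable_fubini_G ig).
  apply/measurable_EFinP; apply: eq_measurable_fun mG => x /set_mem Dx.
  exact: GE.
case: (bf) => _ [M fM]; exists (`|M| * fine (m1 D1)) => y Dy.
have bs := slice2 Dy.
apply: le_trans (le_normr_Rintegral _ (bmeas_integrable _ _ bs)) _ => //.
rewrite -Rintegral_cst//; apply: Rint_le => //; [exact: bmeas_abs|exact: bmeas_cst|].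
by move=> x Dx; rewrite (le_trans (fM (x, y) _))// ler_norm.
Qed.

Lemma Rfubini1 : \int[(m1 \x m2)%E]_(z in D1 `*` D2) f z =
  \int[m1]_(x in D1) \int[m2]_(y in D2) f (x, y).
Proof.
rewrite {1}/Rintegral integral_mkcond -/g -(integral12_prod_meas1 ig).
rewrite {1}/Rintegral [in RHS]integral_mkcond; congr fine.
apply: eq_integral => x _; rewrite patchE; case: ifPn => [/set_mem Dx|/negP Dx].
  exact: FE.
rewrite /fubini_F; under eq_integral => y _.
  rewrite /g patchE; have -> : ((x, y) \in D) = false by apply/negP => /set_mem[/mem_set/Dx].
  over.
exact: integral0.
Qed.

Lemma Rfubini2 : \int[(m1 \x m2)%E]_(z in D1 `*` D2) f z =
  \int[m2]_(y in D2) \int[m1]_(x in D1) f (x, y).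
Proof.
rewrite {1}/Rintegral integral_mkcond -/g -(integral21_prod_meas1 ig).
rewrite {1}/Rintegral [in RHS]integral_mkcond; congr fine.
apply: eq_integral => y _; rewrite patchE; case: ifPn => [/set_mem Dx|/negP Dx].
  exact: GE.
rewrite /fubini_G; under eq_integral => x _.
  rewrite /g patchE; have -> : ((x, y) \in D) = false by apply/negP => /set_mem[_ /mem_set/Dx].
  over.
exact: integral0.
Qed.

End BoundedFubini.

(** * Lebesgue measure on cubes *)

Section Cubes.
Variable R : realType.
Notation leb := (@lebesgue_measure R).

Definition lam n : {sigma_finite_measure set (BrV R n) -> \bar R} :=
  projT1 (cid (lam_exists R n)).

Lemma lamE n (f : BrV R n -> \bar R) : measurable_fun setT f ->
  (forall x, (0 <= f x)%E) -> (\int[lam n]_x f x = rVintegral f)%E.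
Proof. by rewrite /lam; case: cid => m [_ H] /=; exact: H. Qed.

(** Of [lam] only the integral formula is known for all sets, so the product structure is recovered
    by integrating indicators. *)
Lemma lamS n (A : set (BrV R n.+1)) : measurable A ->
  lam n.+1 A = (leb \x lam n)%E (@row_cons R n @^-1` A).
Proof.
move=> mA; have mr := @measurable_row_cons R n.
have mrA : measurable (@row_cons R n @^-1` A) by rewrite -[_ @^-1` _]setTI; exact: (@measurable_row_cons R n).
have <- : (\int[lam n.+1]_x (\1_A x)%:E = lam n.+1 A)%E by rewrite integral_indic// setIT.
have <- : (\int[leb \x lam n]_x (\1_(@row_cons R n @^-1` A) x)%:E =
  (leb \x lam n) (@row_cons R n @^-1` A))%E by rewrite integral_indic// setIT.
have mi : measurable_fun setT (fun x : BrV R n.+1 => (\1_A x : R)%:E).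
  by apply/measurable_EFinP; exact: measurable_indic.
rewrite lamE//.
rewrite fubini_tonelli1//=; last first.
  by apply/measurable_EFinP; exact: measurable_indic.
apply: eq_integral => t _; rewrite /fubini_F -lamE//.
exact: (measurableT_comp mi (measurable_fun_pair2 t mr)).
Qed.

Lemma lam_Rint n (D : set (BrV R n.+1)) (f : BrV R n.+1 -> R) :
  measurable D -> (lam n.+1 D < +oo)%E -> bmeas D f ->
  \int[lam n.+1]_(x in D) f x =
  \int[(leb \x lam n)%E]_(z in @row_cons R n @^-1` D) f (row_cons z).
Proof.
move=> mD fD bf; have mr := @measurable_row_cons R n.
pose P : {measure set (BrV R n.+1) -> \bar R} :=
  measure_function_pushforward__canonical__measure_function_Measure
    (leb \x lam n)%E mr.
have mrD : measurable (@row_cons R n @^-1` D) by rewrite -[_ @^-1` _]setTI; exact: (@measurable_row_cons R n).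
have frD : ((leb \x lam n)%E (@row_cons R n @^-1` D) < +oo)%E by rewrite -lamS.
rewrite /Rintegral; congr fine.
rewrite integral_mkcond [RHS]integral_mkcond.
rewrite (@eq_measure_integral _ _ _ _ P); last by move=> A mA _; exact: lamS.
have mg : measurable_fun setT ((EFin \o f) \_ D).
  have /measurable_EFinP := bf.1; exact: (measurable_restrictT _ mD).1.
have E : ((EFin \o f) \_ D) \o (@row_cons R n) =
    (EFin \o (f \o @row_cons R n)) \_ (@row_cons R n @^-1` D).
  apply/funext => z; rewrite /= !patchE; congr (if _ then _ else _).
have bfr : bmeas (@row_cons R n @^-1` D) (f \o @row_cons R n).
  split; last by case: bf => _ [M fM]; exists M => z; exact: fM.
  apply: (@measurable_comp _ _ _ _ _ _ D _ _ _ mD); [by move=> _ [z Dz <-]|exact: bf.1|].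
  exact: measurable_funTS.
have := @integral_pushforward _ _ _ _ _ _ mr (leb \x lam n)%E setT _ mg.
rewrite preimage_setT => H; rewrite -[RHS]/(integral _ setT ((EFin \o (f \o @row_cons R n)) \_ (@row_cons R n @^-1` D))) -E; apply: H => //.
rewrite E; apply/(integrable_mkcond _ mrD).1; exact: bmeas_integrable.
Qed.

(** Half-open, so that the cells of a subdivision partition the cube exactly; the closed [ccube]
    serves for compactness and for values on faces. *)
Definition cube n (c : 'rV[R]_n) (h : R) : set (BrV R n) :=
  [set x | forall i, c 0 i <= x 0 i < c 0 i + h].

Definition ccube n (c : 'rV[R]_n) (h : R) : set 'rV[R]_n :=
  [set x | forall i, c 0 i <= x 0 i <= c 0 i + h].

Definition rV_tail n (c : 'rV[R]_n.+1) : 'rV[R]_n := \row_k c 0 (lift 0 k).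

Lemma cube_ccube n (c : 'rV[R]_n) (h : R) : cube c h `<=` ccube c h.
Proof. by move=> x cx i; have /andP[-> /ltW] := cx i. Qed.

Lemma measurable_cube n (c : 'rV[R]_n) (h : R) : measurable (cube c h).
Proof.
have -> : cube c h = \bigcap_(i in [set: 'I_n])
    (setT `&` (fun x : BrV R n => x 0 i) @^-1` `[c 0 i, c 0 i + h[%classic).
  apply/seteqP; split => x cx.
    by move=> i _; split => //=; rewrite in_itv/=; exact: cx.
  by move=> i; have [_ /=] := cx i I; rewrite in_itv.
apply: fin_bigcap_measurable => // i _.
exact: (@measurable_coord R n i).
Qed.

Lemma cube_row_cons n (c : 'rV[R]_n.+1) (h : R) :
  @row_cons R n @^-1` (cube c h) = `[c 0 0, c 0 0 + h[%classic `*` cube (rV_tail c) h.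
Proof.
apply/seteqP; split => -[t y] /=.
  move=> cx; split.
    by have := cx 0; rewrite row_cons0 in_itv.
  by move=> k; have := cx (lift 0 k); rewrite row_consS mxE.
rewrite in_itv/= => -[ct cy] i; case: (unliftP 0 i) => [k ->|->].
  by have := cy k; rewrite row_consS mxE.
by rewrite row_cons0.
Qed.

Lemma leb_itv_co (a h : R) : 0 <= h -> leb `[a, a + h[%classic = h%:E.
Proof.
move=> h0; rewrite lebesgue_measure_itv/= lte_fin ltrDl.
case: ltP => [_|h0']; first by rewrite -EFinB addrC addKr.
by congr EFin; apply/eqP; rewrite eq_le h0 h0'.
Qed.

Lemma lam_cube n (c : 'rV[R]_n) (h : R) : 0 <= h -> lam n (cube c h) = (h ^+ n)%:E.
Proof.
move=> h0; elim: n c => [|n IH] c.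
  have -> : cube c h = setT by apply/seteqP; split => // x _ [].
  have <- : (\int[lam 0]_x (cst 1%:E) x = lam 0 setT)%E.
    by rewrite integral_cst// mul1e.
  by rewrite lamE//= => *; rewrite ?lee_fin.
rewrite lamS; last exact: measurable_cube.
rewrite cube_row_cons product_measure1E//; last exact: measurable_cube.
by rewrite IH exprS EFinM; congr (_ * _)%E; exact: leb_itv_co.
Qed.

Lemma lam_cube_fin n (c : 'rV[R]_n) (h : R) : 0 <= h -> (lam n (cube c h) < +oo)%E.
Proof. by move=> h0; rewrite lam_cube// ltry. Qed.

Lemma cube_fubini n (c : 'rV[R]_n.+1) (h : R) (f : BrV R n.+1 -> R) : 0 <= h ->
  bmeas (cube c h) f ->
  [/\ bmeas (`[c 0 0, c 0 0 + h[%classic `*` cube (rV_tail c) h) (f \o @row_cons R n),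
   \int[lam n.+1]_(x in cube c h) f x =
   \int[leb]_(t in `[c 0 0, c 0 0 + h[%classic)
     \int[lam n]_(y in cube (rV_tail c) h) f (row_cons (t, y)) &
   \int[lam n.+1]_(x in cube c h) f x =
   \int[lam n]_(y in cube (rV_tail c) h)
     \int[leb]_(t in `[c 0 0, c 0 0 + h[%classic) f (row_cons (t, y))].
Proof.
move=> h0 bf.
have mr := @measurable_row_cons R n.
have mc := @measurable_cube n (rV_tail c) h.
have bfr : bmeas (`[c 0 0, c 0 0 + h[%classic `*` cube (rV_tail c) h) (f \o @row_cons R n).
  rewrite -cube_row_cons.
  split; last by case: bf => _ [M fM]; exists M => z; exact: fM.
  apply: (@measurable_comp _ _ _ _ _ _ _ _ _ _ (measurable_cube c h)); [by move=> _ [z Dz <-]|exact: bf.1|].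
  exact: measurable_funTS.
have f1 : (leb `[c 0%R 0%R, (c 0 0 + h)%R[%classic < +oo)%E by rewrite leb_itv_co// ltry.
have f2 := lam_cube_fin (rV_tail c) h0.
split => //; rewrite lam_Rint//; try exact: measurable_cube; try exact: lam_cube_fin; rewrite cube_row_cons.
  exact: (Rfubini1 _ mc f1 f2 bfr).
exact: (Rfubini2 _ mc f1 f2 bfr).
Qed.

End Cubes.

(** * Poincare, Rellich and closability on cubes *)

Section C1Cube.
Variable R : realType.
Notation leb := (@lebesgue_measure R).
Implicit Types (n : nat) (h : R).

(** Derivatives and limits are those of the ambient space, so a closed cube needs no one-sided
    notions on its faces. *)
Definition C1on n (Q : set 'rV[R]_n) (u : 'rV[R]_n -> R) : Prop :=
  forall x, Q x -> {for x, continuous u} /\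
    forall k, derivable (u : _ -> R^o) x (delta_mx 0 k) /\
      {for x, continuous (pderiv k u)}.

Lemma compact_ccube n (c : 'rV[R]_n) h : compact (ccube c h).
Proof.
have -> : ccube c h = [set x : 'rV[R]_n | forall i, `[c 0 i, c 0 i + h]%classic (x ord0 i)].
  by apply/seteqP; split => x cx i; have := cx i; rewrite /= in_itv.
apply: (@rV_compact R n (fun i => `[c 0 i, c 0 i + h]%classic)) => i.
exact: segment_compact.
Qed.

Lemma compact_bound (T : topologicalType) (K : set T) (f : T -> R) : compact K ->
  (forall x, K x -> {for x, continuous f}) -> exists M, forall x, K x -> `|f x| <= M.
Proof.
move=> cK cf.
have : {within K, continuous f} by apply: continuous_in_subspaceT => x /set_mem; exact: cf.
move=> /continuous_compact /(_ cK) /compact_bounded [M [_ HM]].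
exists (M + 1) => x Kx; apply: (HM (M + 1)); first by rewrite ltrDl.
by exists x.
Qed.

Lemma continuous_bmeas n (c : 'rV[R]_n) h (f : 'rV[R]_n -> R) :
  (forall x, ccube c h x -> {for x, continuous f}) -> bmeas (cube c h) f.
Proof.
move=> cf; split; last first.
  have [M HM] := compact_bound (@compact_ccube n c h) cf.
  by exists M => x /cube_ccube; exact: HM.
apply: Bor_continuous_fun; first exact: measurable_cube.
by move=> x /cube_ccube; exact: cf.
Qed.

Definition rc n (t : R) (y : 'rV[R]_n) : 'rV[R]_n.+1 := row_cons (t, y).

Lemma rc0 n t (y : 'rV[R]_n) : rc t y 0 0 = t. Proof. exact: row_cons0. Qed.
Lemma rcS n t (y : 'rV[R]_n) k : rc t y 0 (lift 0 k) = y 0 k. Proof. exact: row_consS. Qed.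

(* [mxE] would unfold [rc], hence these entrywise rules. *)
Lemma rvD n (x y : 'rV[R]_n) i : (x + y) 0 i = x 0 i + y 0 i. Proof. by rewrite mxE. Qed.
Lemma rvN n (x : 'rV[R]_n) i : (- x) 0 i = - x 0 i. Proof. by rewrite mxE. Qed.
Lemma rvZ n s (x : 'rV[R]_n) i : (s *: x) 0 i = s * x 0 i. Proof. by rewrite mxE. Qed.
Lemma rv_delta n (k i : 'I_n) : (delta_mx 0 k : 'rV[R]_n) 0 i = (i == k)%:R.
Proof. by rewrite mxE eqxx. Qed.
Definition rvE := (rvD, rvN, rvZ, rv_delta).

Lemma rV_eqS n (x y : 'rV[R]_n.+1) : x 0 0 = y 0 0 ->
  (forall k, x 0 (lift 0 k) = y 0 (lift 0 k)) -> x = y.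
Proof. by move=> xy0 xyS; apply/rowP => i; case: (unliftP 0 i) => [k ->|->]. Qed.

Lemma rc_delta0 n (t s : R) (y : 'rV[R]_n) : s *: delta_mx 0 0 + rc t y = rc (s + t) y.
Proof.
apply: rV_eqS => [|k]; rewrite !(rvE, rc0, rcS) /= ?mulr1 //.
by rewrite mulr0 add0r.
Qed.

Lemma rc_deltaS n (t s : R) (y : 'rV[R]_n) k :
  s *: delta_mx 0 (lift 0 k) + rc t y = rc t (s *: delta_mx 0 k + y).
Proof.
apply: rV_eqS => [|l]; rewrite !(rvE, rc0, rcS) /=; first by rewrite mulr0 add0r.
by rewrite (inj_eq lift_inj).
Qed.

Lemma rc_continuousr n (t : R) : continuous (@rc n t).
Proof.
move=> y; apply/(@cvgrPdist_lt _ _ _ (nbhs y)) => e e0.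
have : \forall z \near y, `|y - z| < e by have /cvgrPdist_lt := @cvg_id _ (nbhs y); apply.
apply: filterS => z yz.
have -> : rc t y - rc t z = rc 0 (y - z).
  by apply: rV_eqS => [|k]; rewrite !(rvE, rc0, rcS) // subrr // mxE.
by rewrite /rc norm_row_cons /= normr0 max_r.
Qed.

Lemma rc_continuousl n (y : 'rV[R]_n) : continuous (fun t => rc t y).
Proof.
move=> t; apply/cvgrPdist_lt => e e0.
have : \forall z \near t, `|t - z| < e by have /cvgrPdist_lt := @cvg_id _ (nbhs t); apply.
apply: filterS => z yz.
have -> : rc t y - rc z y = rc (t - z) 0.
  by apply: rV_eqS => [|k]; rewrite !(rvE, rc0, rcS) // subrr // mxE.
by rewrite /rc norm_row_cons /= normr0 max_l.
Qed.

Lemma growth_rcS n (u : 'rV[R]_n.+1 -> R) t (y : 'rV[R]_n) k :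
  (fun h : R => h^-1 *: (((u \o @rc n t) \o shift y) (h *: delta_mx 0 k) - (u \o @rc n t) y) : R^o) =
  (fun h : R => h^-1 *: ((u \o shift (rc t y)) (h *: delta_mx 0 (lift 0 k)) - u (rc t y)) : R^o).
Proof. by apply/funext => h /=; rewrite rc_deltaS. Qed.

Lemma derivable_rcS n (u : 'rV[R]_n.+1 -> R) t y k :
  derivable ((u \o @rc n t) : _ -> R^o) y (delta_mx 0 k) =
  derivable (u : _ -> R^o) (rc t y) (delta_mx 0 (lift 0 k)).
Proof. by rewrite /derivable growth_rcS. Qed.

Lemma pderiv_rcS n (u : 'rV[R]_n.+1 -> R) t k :
  pderiv k (u \o @rc n t) = (pderiv (lift 0 k) u) \o @rc n t.
Proof. by apply/funext => y; rewrite /pderiv /= /derive growth_rcS. Qed.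

Lemma growth_rc0 n (u : 'rV[R]_n.+1 -> R) t (y : 'rV[R]_n) :
  (fun h : R => h^-1 *: (((fun t : R => u (rc t y)) \o shift t) (h *: 1) - u (rc t y)) : R^o) =
  (fun h : R => h^-1 *: ((u \o shift (rc t y)) (h *: delta_mx 0 0) - u (rc t y)) : R^o).
Proof.
apply/funext => h /=; rewrite rc_delta0.
by rewrite (_ : h *: 1 = h) //; exact: mulr1.
Qed.

Lemma derivable_rc0 n (u : 'rV[R]_n.+1 -> R) t (y : 'rV[R]_n) :
  derivable ((fun t => u (rc t y)) : _ -> R^o) t 1 =
  derivable (u : _ -> R^o) (rc t y) (delta_mx 0 0).
Proof. by rewrite /derivable growth_rc0. Qed.

Lemma derive_rc0 n (u : 'rV[R]_n.+1 -> R) t (y : 'rV[R]_n) :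
  'D_1 ((fun t => u (rc t y)) : _ -> R^o) t = pderiv 0 u (rc t y).
Proof. by rewrite /pderiv /derive growth_rc0. Qed.

Lemma ccube_rc n (c : 'rV[R]_n.+1) h t y :
  c 0 0 <= t <= c 0 0 + h -> ccube (rV_tail c) h y -> ccube c h (rc t y).
Proof.
move=> ct cy i; case: (unliftP 0 i) => [k ->|->]; last by rewrite rc0.
by rewrite rcS; have := cy k; rewrite mxE.
Qed.

Lemma C1on_rc n (c : 'rV[R]_n.+1) h (u : 'rV[R]_n.+1 -> R) t :
  c 0 0 <= t <= c 0 0 + h -> C1on (ccube c h) u ->
  C1on (ccube (rV_tail c) h) (u \o @rc n t).
Proof.
move=> ct uC y cy; have [cu du] := uC _ (ccube_rc ct cy).
split; first by apply: continuous_comp => //; exact: rc_continuousr.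
move=> k; have [dk ck] := du (lift 0 k).
rewrite derivable_rcS pderiv_rcS; split => //.
by apply: continuous_comp => //; exact: rc_continuousr.
Qed.

Lemma C1on_FTC n (c : 'rV[R]_n.+1) h (u : 'rV[R]_n.+1 -> R) (y : 'rV[R]_n) a b :
  C1on (ccube c h) u -> ccube (rV_tail c) h y ->
  c 0 0 <= a -> a <= b -> b <= c 0 0 + h ->
  \int[leb]_(t in `[a, b]) pderiv 0 u (rc t y) = u (rc b y) - u (rc a y).
Proof.
move=> uC cy ca; rewrite le_eqVlt => /predU1P[<- _|ab bc].
  by rewrite subrr set_itv1 Rintegral_set1.
have It t : t \in `[a, b] -> c 0 0 <= t <= c 0 0 + h.
  by rewrite in_itv/= => /andP[at' tb]; rewrite (le_trans ca at') (le_trans tb bc).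
have dt t : t \in `[a, b] -> derivable ((fun t => u (rc t y)) : _ -> R^o) t 1.
  move=> /It ct; rewrite derivable_rc0.
  by have [_ /(_ 0)[]] := uC _ (ccube_rc ct cy).
have ct t : t \in `[a, b] -> {for t, continuous (fun t => u (rc t y))}.
  by move=> tab; apply/differentiable_continuous/derivable1_diffP; exact: dt.
rewrite /Rintegral (@continuous_FTC2 R _ (fun t => u (rc t y)))//.
- apply: continuous_in_subspaceT => t /set_mem /It ct'.
  apply: (@continuous_comp _ _ _ (fun t => rc t y)); first exact: rc_continuousl.
  by have [_ /(_ 0)[]] := uC _ (ccube_rc ct' cy).
- split.
  + by move=> t tab; apply: dt; exact: subset_itv_oo_cc tab.
  + by apply: cvg_at_right_filter; apply: ct; rewrite in_itv/= lexx ltW.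
  + by apply: cvg_at_left_filter; apply: ct; rewrite in_itv/= lexx ltW.
- by move=> t tab; rewrite derive1E derive_rc0.
Qed.

End C1Cube.

Section CubeInequalities.
Variable R : realType.
Notation leb := (@lebesgue_measure R).
Implicit Types (n : nat) (h : R).

Lemma subset_Rint_ge0 d (T : measurableType d) (mu : {measure set T -> \bar R})
  (A B : set T) (f : T -> R) : measurable A -> measurable B -> (mu B < +oo)%E ->
  A `<=` B -> bmeas B f -> (forall x, B x -> 0 <= f x) ->
  \int[mu]_(x in A) f x <= \int[mu]_(x in B) f x.
Proof.
move=> mA mB fB AB bf f0.
have fA : (mu A < +oo)%E by apply: le_lt_trans fB; apply: le_measure; rewrite ?inE.
have bA : bmeas A f.
  split; first exact: measurable_funS bf.1.
  by case: bf => _ [M HM]; exists M => x /AB; exact: HM.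
rewrite -lee_fin -!Rint_EFin//; apply: ge0_subset_integral => //.
by apply/measurable_EFinP; exact: bf.1.
Qed.

Lemma leb_itv_co_fin (a h : R) : 0 <= h -> (leb `[a, (a + h)%R[%classic < +oo)%E.
Proof. by move=> h0; rewrite leb_itv_co// ltry. Qed.

(** Writing A for the integral of v, h v(t) - A is the integral of v(t) - v(s) over s and is at most
    h M in absolute value, while (h v - A)^2 integrates to h^2 * integral of v^2 - h A^2. *)
Lemma Rint_variance (J : set (measurableTypeR R)) (v : measurableTypeR R -> R) h (M : R) : 0 < h ->
  measurable J -> leb J = h%:E -> bmeas J v ->
  (forall s t : measurableTypeR R, J s -> J t -> `|v s - v t| <= M) ->
  h * \int[leb]_(t in J) (v t ^+ 2) <= (\int[leb]_(t in J) v t) ^+ 2 + h ^+ 2 * M ^+ 2.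
Proof.
move=> h0 mJ lJ bv vM.
have fJ : (leb J < +oo)%E by rewrite lJ ltry.
have lJf : fine (leb J) = h by rewrite lJ.
set A := \int[leb]_(t in J) v t.
have key t : J t -> (h * v t - A) ^+ 2 <= (h * M) ^+ 2.
  move=> Jt; rewrite -ler_sqrt ?sqr_ge0// !sqrtr_sqr.
  have M0 : 0 <= M by have := vM t t Jt Jt; rewrite subrr normr0.
  rewrite [leRHS]ger0_norm; last by rewrite mulr_ge0// ltW.
  have -> : h * v t - A = \int[leb]_(s in J) (v t - v s).
    by rewrite Rint_B// ?Rintegral_cst// ?lJf 1?mulrC//; exact: bmeas_cst.
  have bd : bmeas J (fun s => v t - v s) by apply: bmeasB => //; exact: bmeas_cst.
  apply: (le_trans (Rint_abs mJ fJ bd)).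
  rewrite mulrC -[X in M * X]lJf -(@Rintegral_cst _ _ _ leb)//.
  apply: Rint_le => //; [exact: bmeas_abs|exact: bmeas_cst|].
  by move=> s Js; exact: vM.
have bk : bmeas J (fun t => (h * v t - A) ^+ 2).
  by apply: bmeas_sqr; apply: bmeasB; [exact: bmeasZ|exact: bmeas_cst].
have : \int[leb]_(t in J) ((h * v t - A) ^+ 2) <= \int[leb]_(t in J) ((h * M) ^+ 2).
  by apply: Rint_le => //; exact: bmeas_cst.
rewrite Rintegral_cst// lJf.
have -> : \int[leb]_(t in J) ((h * v t - A) ^+ 2) =
    h ^+ 2 * \int[leb]_(t in J) (v t ^+ 2) - h * A ^+ 2.
  transitivity (\int[leb]_(t in J) ((h ^+ 2 * v t ^+ 2 - (2 * h * A) * v t) + A ^+ 2)).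
    by apply: eq_Rintegral => t _; ring.
  have b2 := bmeas_sqr bv.
  rewrite Rint_D ?Rintegral_cst ?Rint_B ?Rint_Z// -/A ?lJf; first by ring.
  - exact: bmeasZ.
  - exact: bmeasZ.
  - by apply: bmeasB; exact: bmeasZ.
  - exact: bmeas_cst.
set I2 := \int[leb]_(t in J) (v t ^+ 2) => H.
rewrite -(ler_pM2l h0) mulrDr; move: H; rewrite lerBlDr => H.
by apply: le_trans (le_trans H _); [rewrite expr2 mulrA|rewrite addrC exprMn lerD2l mulrC].
Qed.

Lemma C1on_bmeas n (c : 'rV[R]_n) h (u : 'rV[R]_n -> R) :
  C1on (ccube c h) u -> bmeas (cube c h) u.
Proof. by move=> uC; apply: continuous_bmeas => x /uC[]. Qed.

Lemma C1on_bmeas_pderiv n (c : 'rV[R]_n) h (u : 'rV[R]_n -> R) k :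
  C1on (ccube c h) u -> bmeas (cube c h) (pderiv k u).
Proof. by move=> uC; apply: continuous_bmeas => x /uC[_ /(_ k)[]]. Qed.

(** In the first direction, integrate along the edge first: the fundamental theorem leaves values on
    two faces, where F vanishes. The other directions follow by induction on the slices at fixed
    first coordinate. *)
Lemma Rint_pderiv0 n (c : 'rV[R]_n) h (F : 'rV[R]_n -> R) k : 0 <= h ->
  C1on (ccube c h) F ->
  (forall x, ccube c h x -> (x 0 k = c 0 k \/ x 0 k = c 0 k + h) -> F x = 0) ->
  \int[lam R n]_(x in cube c h) pderiv k F x = 0.
Proof.
move=> h0; elim: n => [|n IH] in c F k *; first by case: k.
move=> FC F0; have bF := C1on_bmeas_pderiv k FC.
have [bfr E1 E2] := cube_fubini h0 bF.
have ch : c 0 0 <= c 0 0 + h by rewrite lerDl.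
case: (unliftP 0 k) => [l kl|k0].
  rewrite E1; under eq_Rintegral => t.
    rewrite inE/= in_itv/= => /andP[ct tc].
    have ctc : c 0 0 <= t <= c 0 0 + h by rewrite ct ltW.
    have := IH (rV_tail c) (F \o @rc R n t) l (C1on_rc ctc FC).
    rewrite pderiv_rcS -kl => ->; last first.
      move=> y cy yl; apply: F0; first exact: ccube_rc.
      by rewrite kl rcS; move: yl; rewrite !mxE.
    over.
  by rewrite Rintegral_cst//= mul0r.
rewrite k0 in F0 *; rewrite -k0 E2 k0.
under eq_Rintegral => y /set_mem yD.
  have cy := cube_ccube yD.
  rewrite Rintegral_itv_bndo_bndc; last first.
    apply: bmeas_integrable => //; first exact: leb_itv_co_fin.
    rewrite k0 in bfr; apply: (bmeas_slice2 _ _ bfr yD) => //; exact: measurable_cube.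
  rewrite (C1on_FTC FC cy (lexx _) ch (lexx _)) !F0 ?subrr; [over| | | |].
  - by apply: ccube_rc => //; rewrite lexx.
  - by rewrite rc0; left.
  - by apply: ccube_rc => //; rewrite lexx andbT.
  - by rewrite rc0; right.
by rewrite Rintegral_cst ?mul0r//; exact: measurable_cube.
Qed.

(** Integrating over the whole edge makes the bound independent of s and t, as the oscillation bound
    in [Rint_variance] requires. *)
Lemma FTC_bound n (c : 'rV[R]_n.+1) h (u : 'rV[R]_n.+1 -> R) (y : 'rV[R]_n) s t :
  C1on (ccube c h) u -> cube (rV_tail c) h y ->
  c 0 0 <= s < c 0 0 + h -> c 0 0 <= t < c 0 0 + h ->
  `|u (rc s y) - u (rc t y)| <=
  \int[leb]_(r in `[c 0 0, c 0 0 + h[%classic) `|pderiv 0 u (row_cons (r, y))|.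
Proof.
move=> uC yD; have cy := cube_ccube yD.
wlog st : s t / t <= s.
  by move=> H cs ct; case: (leP t s) => [/H|/ltW /H]; [exact|rewrite distrC; exact].
move=> /andP[cs sc] /andP[ct tc].
have h0 : 0 <= h by rewrite -(lerD2l (c 0 0)) addr0; exact: le_trans cs (ltW sc).
have bF := C1on_bmeas_pderiv 0 uC.
have [bfr _ _] := cube_fubini h0 bF.
have mc := @measurable_cube R n (rV_tail c) h.
pose J : set (measurableTypeR R) := `[c 0 0, c 0 0 + h[%classic.
have fJ : (leb J < +oo)%E by exact: leb_itv_co_fin.
pose I : set (measurableTypeR R) := `[t, s]%classic.
have IJ : I `<=` J.
  by move=> r; rewrite /I /J /= !in_itv/= => /andP[tr rs]; rewrite (le_trans ct tr) (le_lt_trans rs sc).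
have mI : measurable I by exact: measurable_itv.
have mJ : measurable J by exact: measurable_itv.
have bJ : bmeas J (fun r => pderiv 0 u (row_cons (r, y))) by exact: (bmeas_slice2 mJ mc bfr yD).
have fI : (leb I < +oo)%E by apply: le_lt_trans fJ; apply: le_measure; rewrite ?inE.
have bI : bmeas I (fun r => pderiv 0 u (row_cons (r, y))).
  split; first by apply: measurable_funS bJ.1.
  by case: bJ => _ [M HM]; exists M => r /IJ; exact: HM.
rewrite -(C1on_FTC uC cy ct st (ltW sc)).
apply: (le_trans (Rint_abs mI fI bI)).
by apply: (subset_Rint_ge0 mI mJ fJ IJ (bmeas_abs bJ)).
Qed.

Lemma Rint_pderiv_slice n (c : 'rV[R]_n) h (u : 'rV[R]_n.+1 -> R) t k :
  \int[lam R n]_(y in cube c h) (pderiv k (u \o @rc R n t) y ^+ 2) =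
  \int[lam R n]_(y in cube c h) (pderiv (lift 0 k) u (rc t y) ^+ 2).
Proof. by rewrite (pderiv_rcS u t k). Qed.

(** Induction on the dimension. On the slice at t the induction hypothesis bounds the integral of
    u^2 by v(t)^2, with v(t) the integral of u over the slice, plus the derivatives along the slice.
    The function v oscillates by at most the integral of |d_0 u|, so [Rint_variance] bounds the
    integral of v^2 and Cauchy-Schwarz brings in (d_0 u)^2. *)
Lemma poincare_cube n (c : 'rV[R]_n) h (u : 'rV[R]_n -> R) : 0 < h ->
  C1on (ccube c h) u ->
  h ^+ n * \int[lam R n]_(x in cube c h) (u x ^+ 2) <=
  (\int[lam R n]_(x in cube c h) u x) ^+ 2 +
  h ^+ 2 * h ^+ n * \sum_(k < n) \int[lam R n]_(x in cube c h) (pderiv k u x ^+ 2).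
Proof.
move=> h0; elim: n => [|n IH] in c u *.
  move=> uC; rewrite big_ord0 mulr0 addr0 expr0.
  have bu := C1on_bmeas uC; have mc := @measurable_cube R 0 c h.
  have fc := lam_cube_fin c (ltW h0).
  have lf : fine (lam R 0 (cube c h)) = 1 by rewrite lam_cube ?ltW.
  have x0 (x : BrV R 0) : u x = u 0 by congr u; exact: thinmx0.
  have -> : \int[lam R 0]_(x in cube c h) (u x ^+ 2) = u 0 ^+ 2.
    rewrite (@eq_Rintegral _ _ _ _ _ (fun=> u 0 ^+ 2)); last by move=> x _; rewrite x0.
    by rewrite Rintegral_cst// [X in _ * X]lf mulr1.
  have -> : \int[lam R 0]_(x in cube c h) (u x) = u 0.
    rewrite (@eq_Rintegral _ _ _ _ _ (fun=> u 0)); last by move=> x _; rewrite x0.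
    by rewrite Rintegral_cst// [X in _ * X]lf mulr1.
  by rewrite mul1r.
move=> uC; have h0' := ltW h0.
have bu := C1on_bmeas uC; have bu2 := bmeas_sqr bu.
have bd k := C1on_bmeas_pderiv k uC; have bd2 k := bmeas_sqr (bd k).
have mc := @measurable_cube R n (rV_tail c) h.
have mC := @measurable_cube R n.+1 c h.
have fc := lam_cube_fin (rV_tail c) h0'.
have fC := lam_cube_fin c h0'.
pose J : set (measurableTypeR R) := `[c 0 0, c 0 0 + h[%classic.
have mJ : measurable J by exact: measurable_itv.
have fJ : (leb J < +oo)%E by exact: leb_itv_co_fin.
have JP t : J t -> c 0 0 <= t < c 0 0 + h by rewrite /J /= in_itv.
pose v t := \int[lam R n]_(y in cube (rV_tail c) h) u (rc t y).
have [br E _] := cube_fubini h0' bu.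
have [br2 E2 _] := cube_fubini h0' bu2.
have bv : bmeas J v := bmeas_int1 mJ mc fJ fc br.
pose U t := \int[lam R n]_(y in cube (rV_tail c) h) (u (rc t y) ^+ 2).
have bU : bmeas J U := bmeas_int1 mJ mc fJ fc br2.
have {}E2 : \int[lam R n.+1]_(x in cube c h) (u x ^+ 2) = \int[leb]_(t in J) U t := E2.
pose B k t := \int[lam R n]_(y in cube (rV_tail c) h) (pderiv k u (rc t y) ^+ 2).
have bB k : bmeas J (B k).
  have [brk _ _] := cube_fubini h0' (bd2 k).
  exact: (bmeas_int1 mJ mc fJ fc brk).
have EB k : \int[lam R n.+1]_(x in cube c h) (pderiv k u x ^+ 2) = \int[leb]_(t in J) B k t.
  by have [_ -> _] := cube_fubini h0' (bd2 k).
set M := \int[lam R n.+1]_(x in cube c h) `|pderiv 0 u x|.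
have vM s t : J s -> J t -> `|v s - v t| <= M.
  move=> /JP Js /JP Jt.
  have bs := bmeas_slice1 mJ mc br (_ : J s); have bt := bmeas_slice1 mJ mc br (_ : J t).
  have {}bs := bs Js; have {}bt := bt Jt.
  have := bmeasB bs bt => bst.
  rewrite /v -Rint_B//; apply: (le_trans (Rint_abs mc fc bst)).
  have ba := bmeas_abs (bd 0).
  have [bra _ Ea] := cube_fubini h0' ba.
  rewrite /M Ea; apply: Rint_le => //; first exact: bmeas_abs.
    exact: (bmeas_int2 mJ mc fJ fc bra).
  by move=> y cy; apply: FTC_bound.
have V := Rint_variance h0 mJ (leb_itv_co _ h0') bv vM.
have MC : M ^+ 2 <= h ^+ n.+1 * \int[lam R n.+1]_(x in cube c h) (pderiv 0 u x ^+ 2).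
  have := Rint_CS mC fC (bmeas_abs (bd 0)); rewrite -/M.
  have -> : fine (lam R n.+1 (cube c h)) = h ^+ n.+1 by rewrite lam_cube.
  by under eq_Rintegral do rewrite real_normK ?num_real//.
(* The induction hypothesis on each slice, integrated over t. *)
have IHt : h ^+ n * \int[lam R n.+1]_(x in cube c h) (u x ^+ 2) <=
   \int[leb]_(t in J) (v t ^+ 2) +
   h ^+ 2 * h ^+ n * \sum_(k < n) \int[leb]_(t in J) B (lift 0 k) t.
  have bS : bmeas J (fun t => \sum_(k < n) B (lift 0 k) t) by apply: bmeas_sum => k; exact: bB.
  rewrite E2 -Rint_sum; [|by []|by []|by move=> k; exact: bB].
  rewrite -(Rint_Z mJ fJ _ bU) -(Rint_Z mJ fJ _ bS).
  rewrite -(Rint_D mJ fJ (bmeas_sqr bv) (bmeasZ _ bS)).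
  apply: (Rint_le mJ fJ (bmeasZ _ bU) (bmeasD (bmeas_sqr bv) (bmeasZ _ bS))).
  move=> t /JP /andP[ct tc].
  have ctc : c 0 0 <= t <= c 0 0 + h by rewrite ct ltW.
  have := IH _ _ (C1on_rc ctc uC).
  have ES : \sum_(k < n) \int[lam R n]_(y in cube (rV_tail c) h) (pderiv k (u \o @rc R n t) y ^+ 2) =
      \sum_(k < n) B (lift 0 k) t.
    by apply: eq_bigr => k _; exact: Rint_pderiv_slice.
  move=> H; have {}H := H : (h ^+ n * U t <= v t ^+ 2 + h ^+ 2 * h ^+ n *
      \sum_(k < n) \int[lam R n]_(y in cube (rV_tail c) h) (pderiv k (u \o @rc R n t) y ^+ 2)).
  by rewrite ES in H.
rewrite big_ord_recl (eq_bigr (fun k => \int[leb]_(t in J) B (lift 0 k) t)); last by move=> k _; rewrite EB.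
rewrite exprS -mulrA.
apply: (le_trans (ler_wpM2l h0' IHt)).
rewrite mulrDr.
apply: (le_trans (lerD V (lexx _))).
rewrite -E -!addrA lerD2l.
apply: (@le_trans _ _ (h ^+ 2 * (h ^+ n.+1 * \int[lam R n.+1]_(x in cube c h) (pderiv 0 u x ^+ 2)) + h * (h ^+ 2 * h ^+ n *
    \sum_(k < n) \int[leb]_(t in J) B (lift 0 k) t))).
  by rewrite lerD2r ler_wpM2l// exprn_ge0.
set S := \sum_(k < n) _; set Q := \int[lam R n.+1]_(x in cube c h) (pderiv 0 u x ^+ 2).
change (h ^+ 2 * (h ^+ n.+1 * Q) + h * (h ^+ 2 * h ^+ n * S) <= h ^+ 2 * (h * h ^+ n) * (Q + S)).
by rewrite (exprS h n) le_eqVlt; apply/orP; left; apply/eqP; ring.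
Qed.

End CubeInequalities.

Section C1Closure.
Variable R : realType.
Implicit Types n : nat.

Lemma C1on_sub n (O Q : set 'rV[R]_n) u : Q `<=` O -> C1on O u -> C1on Q u.
Proof. by move=> QO uC x /QO; exact: uC. Qed.

Lemma smooth_C1on n (O : set 'rV[R]_n) u : smooth_open O u -> C1on O u.
Proof.
move=> uO x Ox; split; first exact: smooth_open_continuous uO Ox.
move=> k; split; first exact: smooth_open_derivable uO Ox.
exact: smooth_open_continuous (smooth_open_pderiv k uO) Ox.
Qed.

Lemma C1on_cst n (O : set 'rV[R]_n) (a : R) : C1on O (fun=> a).
Proof.
move=> x Ox; split; first exact: cst_continuous.
move=> k; split; first exact: derivable_cst.
have -> : pderiv k (fun=> a : R) = (fun=> 0 : R) :> ('rV[R]_n -> R).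
  by apply/funext => y; exact: derive_cst.
exact: cst_continuous.
Qed.

Lemma is_derive_coord n (i k : 'I_n) (x : 'rV[R]_n) :
  is_derive x (delta_mx 0 k : 'rV[R]_n) ((fun y : 'rV[R]_n => y 0 i) : _ -> R^o) ((i == k)%:R).
Proof.
have E : (fun h : R => h^-1 *: (((fun y : 'rV[R]_n => y 0 i) \o shift x) (h *: delta_mx 0 k)
   - x 0 i) : R^o) = (fun h : R => h^-1 * (h * (i == k)%:R)).
  by apply/funext => h /=; rewrite !mxE eqxx /= addrK.
have C : (fun h : R => h^-1 * (h * (i == k)%:R)) @ 0^' --> ((i == k)%:R : R).
  apply: cvg_near_cst; near=> h.
  by rewrite mulrA mulVf ?mul1r//; near: h; exact: nbhs_dnbhs_neq.
split; rewrite /derivable /derive E; last exact: cvg_lim.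
by apply/cvg_ex; eexists; exact: C.
Unshelve. all: by end_near. Qed.

Lemma C1on_coord n (O : set 'rV[R]_n) i : C1on O (fun x : 'rV[R]_n => x 0 i).
Proof.
move=> x Ox; split; first exact: coord_continuous.
move=> k; have D y := is_derive_coord i k y; split; first exact: (@ex_derive _ _ _ _ _ _ _ (D x)).
have -> : pderiv k (fun x : 'rV[R]_n => x 0 i) = (fun=> (i == k)%:R : R).
  by apply/funext => y; exact: (@derive_val _ _ _ _ _ _ _ (D y)).
exact: cst_continuous.
Qed.

Lemma near_open n (O : set 'rV[R]_n) x : open O -> O x -> \forall y \near x, O y.
Proof. by move=> oO Ox; apply: open_nbhs_nbhs. Qed.

Lemma C1onM n (O : set 'rV[R]_n) f g : open O -> C1on O f -> C1on O g ->
  C1on O (fun x => f x * g x) /\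
  forall k x, O x -> pderiv k (fun x => f x * g x) x = f x * pderiv k g x + g x * pderiv k f x.
Proof.
move=> oO fC gC.
have E k x : O x -> pderiv k (fun x => f x * g x) x = f x * pderiv k g x + g x * pderiv k f x.
  move=> Ox; have [_ /(_ k)[df _]] := fC x Ox; have [_ /(_ k)[dg _]] := gC x Ox.
  exact: (deriveM df dg).
split; last exact: E.
move=> x Ox; have [cf Df] := fC x Ox; have [cg Dg] := gC x Ox; split.
  exact: (continuousM cf cg).
move=> k; have [df cdf] := Df k; have [dg cdg] := Dg k; split; first exact: (derivableM df dg).
rewrite /prop_for /continuous_at E//.
have : \forall y \near x, f y * pderiv k g y + g y * pderiv k f y = pderiv k (fun x => f x * g x) y.
  by apply: filterS (near_open oO Ox) => y Oy; rewrite E.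
move=> N; apply: (cvg_trans (@near_eq_cvg _ _ (nbhs x) _ _ _ N)).
exact: (cvgD (cvgM cf cdg) (cvgM cg cdf)).
Qed.

Lemma C1onD n (O : set 'rV[R]_n) a f g : open O -> C1on O f -> C1on O g ->
  C1on O (fun x => f x + a * g x) /\
  forall k x, O x -> pderiv k (fun x => f x + a * g x) x = pderiv k f x + a * pderiv k g x.
Proof.
move=> oO fC gC.
have E k x : O x -> pderiv k (fun x => f x + a * g x) x = pderiv k f x + a * pderiv k g x.
  move=> Ox; have [_ /(_ k)[df _]] := fC x Ox; have [_ /(_ k)[dg _]] := gC x Ox.
  have := @deriveD _ _ R^o (f : _ -> R^o) (a *: (g : _ -> R^o)) x (delta_mx 0 k) df (derivableZ (k:=a) dg).
  by rewrite (deriveZ a dg).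
split; last exact: E.
move=> x Ox; have [cf Df] := fC x Ox; have [cg Dg] := gC x Ox; split.
  apply: (continuousD cf); apply: continuousM cg; exact: cst_continuous.
move=> k; have [df cdf] := Df k; have [dg cdg] := Dg k; split.
  exact: (@derivableD _ _ R^o (f : _ -> R^o) (a *: (g : _ -> R^o)) x (delta_mx 0 k) df (derivableZ (k:=a) dg)).
rewrite /prop_for /continuous_at E//.
have : \forall y \near x, pderiv k f y + a * pderiv k g y = pderiv k (fun x => f x + a * g x) y.
  by apply: filterS (near_open oO Ox) => y Oy; rewrite E.
move=> N; apply: (cvg_trans (@near_eq_cvg _ _ (nbhs x) _ _ _ N)).
exact: (cvgD cdf (cvgM (@cvg_cst _ _ _ (nbhs x) _) cdg)).
Qed.

End C1Closure.

Section Ultra.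
Variable R : realType.

(** Compactness of a segment gives a cluster point, and a cluster point of an ultrafilter is a
    limit, since each set or its complement belongs to it. *)
Lemma ultra_bounded_cvg (T : Type) (U : set_system T) (s : T -> R) (M : R) :
  UltraFilter U -> (forall m, `|s m| <= M) -> exists l : R, s @ U --> l.
Proof.
move=> UU sM.
have cK := @segment_compact R (- M) M.
have FK : (s @ U) `[- M, M]%classic.
  by rewrite /=; apply: filterS (@filterT _ U _) => m _ /=; rewrite in_itv/= -ler_norml.
have [l [_ lc]] := cK (s @ U) _ FK; exists l => B Bl.
have [//|H] := in_ultra_setVsetC (s @^-1` B) UU.
by have [x [/= xB Bx]] := lc (~` B) B H Bl.
Qed.

End Ultra.

(** * Subdivisions and Rellich's lemma on a cube *)

Section CubeCompactness.
Variable R : realType.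
Implicit Types (n : nat) (h : R).

Definition subcube_corner n (c : 'rV[R]_n) h N (a : {ffun 'I_n -> 'I_N}) : 'rV[R]_n :=
  \row_i (c 0 i + (a i)%:R * h).

Lemma subcube_sub n (c : 'rV[R]_n) h N (a : {ffun 'I_n -> 'I_N}) : 0 <= h ->
  ccube (subcube_corner c h a) h `<=` ccube c (N%:R * h).
Proof.
move=> h0 x cx i; have := cx i; rewrite mxE => /andP[h1 h2].
rewrite (le_trans _ h1) ?lerDl ?mulr_ge0//=.
apply: (le_trans h2); rewrite -addrA lerD2l -[X in _ + X]mul1r -mulrDl ler_wpM2r//.
by rewrite natr1 ler_nat.
Qed.

Lemma subcube_cover n (c : 'rV[R]_n) h N : 0 < h ->
  cube c (N%:R * h) = \big[setU/set0]_(a <- enum {ffun 'I_n -> 'I_N}) cube (subcube_corner c h a) h.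
Proof.
move=> h0; rewrite -bigcup_seq; apply/seteqP; split => x.
  move=> cx.
  have aP i : exists k : 'I_N, c 0 i + k%:R * h <= x 0 i < c 0 i + k%:R * h + h.
    have /andP[x1 x2] := cx i.
    pose y := (x 0 i - c 0 i) / h.
    have y0 : 0 <= y by rewrite divr_ge0 ?subr_ge0// ltW.
    have yN : y < N%:R by rewrite ltr_pdivrMr// ltrBlDl.
    have /andP[ty yt] := truncn_itv y0.
    move: (Num.truncn y) ty yt => t ty yt.
    have tN : (t < N)%N by rewrite -(ltr_nat R); exact: le_lt_trans ty yN.
    exists (Ordinal tN) => /=; move: ty yt.
    rewrite /y ler_pdivlMr// ltr_pdivrMr// -(natr1 t) mulrDl mul1r => H1 H2.
    by apply/andP; split; lra.
  exists [ffun i => xchoose (aP i)]; first by rewrite /= mem_enum.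
  by move=> i; rewrite mxE ffunE; exact: (xchooseP (aP i)).
move=> [a _ ax] i; have := ax i; rewrite mxE => /andP[h1 h2].
rewrite (le_trans _ h1) ?lerDl ?mulr_ge0 ?(ltW h0)//=.
apply: (lt_le_trans h2); rewrite -addrA lerD2l -[X in _ + X]mul1r -mulrDl ler_wpM2r ?(ltW h0)//.
by rewrite natr1 ler_nat.
Qed.

Lemma subcube_trivIset n (c : 'rV[R]_n) h N : 0 < h ->
  trivIset setT (fun a : {ffun 'I_n -> 'I_N} => cube (subcube_corner c h a) h).
Proof.
move=> h0 a b _ _ [x [ax bx]]; apply/ffunP => i; apply: val_inj.
have H (a' b' : {ffun 'I_n -> 'I_N}) : cube (subcube_corner c h a') h x ->
    cube (subcube_corner c h b') h x -> (a' i <= b' i)%N.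
  move=> /(_ i) + /(_ i); rewrite !mxE => /andP[a1 _] /andP[_ b2].
  have := le_lt_trans a1 b2; rewrite -addrA ltrD2l -[X in _ + X]mul1r -mulrDl ltr_pM2r//.
  by rewrite natr1 ltr_nat ltnS.
by apply/eqP; rewrite eqn_leq !H.
Qed.

Lemma Rint_subcubes n (c : 'rV[R]_n) h N (f : BrV R n -> R) : 0 < h ->
  bmeas (cube c (N%:R * h)) f -> (forall x, 0 <= f x) ->
  \int[lam R n]_(x in cube c (N%:R * h)) f x =
  \sum_(a : {ffun 'I_n -> 'I_N}) \int[lam R n]_(x in cube (subcube_corner c h a) h) f x.
Proof.
move=> h0 bf f0.
have Nh0 : 0 <= N%:R * h by rewrite mulr_ge0// ltW.
have mC := @measurable_cube R n c (N%:R * h).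
have fC := lam_cube_fin c Nh0.
apply: EFin_inj; rewrite -Rint_EFin// subcube_cover// ge0_integral_bigsetU//=.
- rewrite big_enum/= -sumEFin; apply: eq_bigr => a _; apply: Rint_EFin => //.
  + exact: measurable_cube.
  + by apply: lam_cube_fin; exact: ltW.
  + have sub : cube (subcube_corner c h a) h `<=` cube c (N%:R * h).
      rewrite subcube_cover// -bigcup_seq => x xa; exists a => //=; exact: mem_enum.
    split; first by apply: measurable_funS bf.1.
    by case: bf => _ [M HM]; exists M => x /sub; exact: HM.
- by move=> a; exact: measurable_cube.
- exact: enum_uniq.
- by move=> a b _ _ ab; exact: (@subcube_trivIset _ c h N h0 a b I I ab).
- rewrite -subcube_cover//; apply/measurable_EFinP; exact: bf.1.
- by move=> x _; rewrite lee_fin.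
Qed.

Lemma exists_small (a e : R) : 0 <= a -> 0 < e ->
  exists2 d, 0 < d & a * d ^+ 2 <= e.
Proof.
move=> a0 e0; have a1 : 0 < a + 1 by rewrite ltr_wpDl.
(* Being at most 1, d satisfies d^2 <= d; the summand 1 covers a = 0. *)
exists (Num.min 1 (e / (a + 1))).
  by rewrite lt_min ltr01 divr_gt0.
set d := Num.min _ _.
have d1 : d <= 1 by rewrite ge_min lexx.
have d0 : 0 <= d by rewrite le_min ler01 divr_ge0// ltW.
have de : d <= e / (a + 1) by rewrite ge_min lexx orbT.
apply: (@le_trans _ _ ((a + 1) * d)).
  by rewrite ler_pM// ?exprn_ge0// ?lerDl// expr2 ler_piMr.
by rewrite mulrC -ler_pdivlMr.
Qed.

Lemma Rint_sqrB_le d (T : measurableType d) (mu : {measure set T -> \bar R}) (D : set T)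
    (f g : T -> R) : measurable D -> (mu D < +oo)%E -> bmeas D f -> bmeas D g ->
  \int[mu]_(x in D) ((f x - g x) ^+ 2) <=
  2 * (\int[mu]_(x in D) (f x ^+ 2) + \int[mu]_(x in D) (g x ^+ 2)).
Proof.
move=> mD fD bf bg; have bf2 := bmeas_sqr bf; have bg2 := bmeas_sqr bg.
rewrite -Rint_D// -Rint_Z//; last exact: bmeasD.
apply: Rint_le => //; first by apply: bmeas_sqr; exact: bmeasB.
  by apply: bmeasZ; exact: bmeasD.
by move=> x _; rewrite -subr_ge0 (_ : _ - _ = (f x + g x) ^+ 2) ?sqr_ge0//; ring.
Qed.

(** Summed over the cells of side h, the gradient part of Poincare's inequality is at most n * 4C *
    h^2 for every pair m, m'. So h is fixed first, to make this e / 2; the part with the averages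
    then involves a fixed finite number of convergent quantities. *)
Lemma rellich_cube n (c : 'rV[R]_n) (L : R) (O : set 'rV[R]_n)
    (v : nat -> 'rV[R]_n -> R) (C : R) (U : set_system nat) (e : R) :
  0 < L -> open O -> ccube c L `<=` O -> (forall m, C1on O (v m)) ->
  (forall m, \int[lam R n]_(x in cube c L) (v m x ^+ 2) <= C) ->
  (forall m k, \int[lam R n]_(x in cube c L) (pderiv k (v m) x ^+ 2) <= C) ->
  UltraFilter U -> 0 < e ->
  exists2 A, U A & forall m m', A m -> A m' ->
    \int[lam R n]_(x in cube c L) ((v m x - v m' x) ^+ 2) <= e.
Proof.
move=> L0 oO cO vC vB dB UU e0.
have C0 : 0 <= C by apply: le_trans (vB 0%N); apply: Rintegral_ge0 => x _; exact: sqr_ge0.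
have nC0 : 0 <= n%:R * (4 * C) by rewrite !mulr_ge0.
have e20 : 0 < e / 2 by rewrite divr_gt0.
have [h1 h10 h1e] := exists_small nC0 e20.
(* Rounding up makes the cells fill the cube exactly, with side at most h1. *)
pose N := (Num.truncn (L / h1)).+1.
pose h := L / N%:R.
have N0 : 0 < N%:R :> R by rewrite ltr0n.
have h0 : 0 < h by rewrite divr_gt0.
have NhL : N%:R * h = L by rewrite /h mulrCA divff ?mulr1 ?gt_eqF.
have hh1 : h <= h1.
  rewrite /h ler_pdivrMr// mulrC -ler_pdivrMr// ltW//; exact: truncnS_gt.
have he : n%:R * (4 * C) * h ^+ 2 <= e / 2.
  by apply: le_trans h1e; rewrite ler_wpM2l// ler_pXn2r// nnegrE ltW.
pose Q (a : {ffun 'I_n -> 'I_N}) := cube (subcube_corner c h a) h.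
have mQ a : measurable (Q a) by exact: measurable_cube.
have fQ a : (lam R n (Q a) < +oo)%E by apply: lam_cube_fin; exact: ltW.
have mC := @measurable_cube R n c L.
have fC := lam_cube_fin c (ltW L0).
have cQO (a : {ffun 'I_n -> 'I_N}) : ccube (subcube_corner c h a) h `<=` O.
  by move=> x /(subcube_sub (ltW h0)); rewrite NhL; exact: cO.
have QC a : Q a `<=` cube c L.
  by rewrite -NhL subcube_cover// -bigcup_seq => x xa; exists a => //=; exact: mem_enum.
have bv m : bmeas (cube c L) (v m) by apply: C1on_bmeas; exact: C1on_sub cO (vC m).
have bdv m k : bmeas (cube c L) (pderiv k (v m)).
  by apply: C1on_bmeas_pderiv; exact: C1on_sub cO (vC m).
have bvQ a m : bmeas (Q a) (v m) by apply: C1on_bmeas; apply: C1on_sub (vC m); exact: cQO.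
pose s a m := \int[lam R n]_(x in Q a) v m x.
have sB a m : `|s a m| <= Num.sqrt (h ^+ n * C).
  rewrite -sqrtr_sqr ler_sqrt; last by rewrite mulr_ge0 ?exprn_ge0// ltW.
  have := Rint_CS (mQ a) (fQ a) (bvQ a m).
  have -> : fine (lam R n (Q a)) = h ^+ n by rewrite lam_cube// ltW.
  move=> /le_trans; apply; rewrite ler_wpM2l ?exprn_ge0 ?(ltW h0)//.
  apply: le_trans (vB m); apply: subset_Rint_ge0 => //; first exact: bmeas_sqr.
  by move=> x _; exact: sqr_ge0.
have sl a : exists l : R, s a @ U --> l := ultra_bounded_cvg UU (sB a).
pose l a := sval (cid (sl a)).
have hl a : s a @ U --> l a by exact: (svalP (cid (sl a))).
(* Integrals within dl of their limit differ by at most 2 dl, so each cell contributes at most h^-n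
   (2 dl)^2. *)
pose K : R := #|{ffun 'I_n -> 'I_N}|%:R * (h ^- n * 4).
have K0 : 0 <= K by rewrite !mulr_ge0// invr_ge0 exprn_ge0 ?ltW.
have [dl dl0 dle] := exists_small K0 e20.
exists [set m | forall a, `|l a - s a m| <= dl].
  apply: (@filter_forall _ _ (fun a m => `|l a - s a m| <= dl) U) => a.
  by have /cvgrPdist_le := hl a; apply.
move=> m m' Am Am'.
have bd := bmeasB (bv m) (bv m').
have dC : C1on O (fun x => v m x + (-1) * v m' x) by exact: (C1onD (-1) oO (vC m) (vC m')).1.
have dE k x : O x -> pderiv k (fun x => v m x + (-1) * v m' x) x = pderiv k (v m) x + (-1) * pderiv k (v m') x.
  exact: (C1onD (-1) oO (vC m) (vC m')).2.
have bd2 := bmeas_sqr bd.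
rewrite -NhL Rint_subcubes//; last 2 first.
- by rewrite NhL.
- by move=> x; exact: sqr_ge0.
have step a : \int[lam R n]_(x in Q a) ((v m x - v m' x) ^+ 2) <=
   h ^- n * (4 * dl ^+ 2) +
   h ^+ 2 * \sum_(k < n) \int[lam R n]_(x in Q a) ((pderiv k (v m) x - pderiv k (v m') x) ^+ 2).
  have := poincare_cube h0 (C1on_sub (cQO a) dC).
  rewrite -/(Q a).
  have -> : \int[lam R n]_(x in Q a) ((v m x + -1 * v m' x) ^+ 2) = \int[lam R n]_(x in Q a) ((v m x - v m' x) ^+ 2).
    by apply: eq_Rintegral => x _; rewrite mulN1r.
  have -> : \int[lam R n]_(x in Q a) (v m x + -1 * v m' x) = s a m - s a m'.
    by rewrite /s -(Rint_B (mQ a) (fQ a) (bvQ a m) (bvQ a m')); apply: eq_Rintegral => x _; rewrite mulN1r.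
  have -> : \sum_(k < n) \int[lam R n]_(x in Q a) (pderiv k (fun x => v m x + -1 * v m' x) x ^+ 2) =
    \sum_(k < n) \int[lam R n]_(x in Q a) ((pderiv k (v m) x - pderiv k (v m') x) ^+ 2).
    apply: eq_bigr => k _; apply: eq_Rintegral => x /set_mem xQ.
    by rewrite dE ?mulN1r//; apply: (cQO a); exact: cube_ccube.
  set I1 := \int[_]_(x in _) _; set S := \sum_(k < n) _ => H.
  have ss : (s a m - s a m') ^+ 2 <= 4 * dl ^+ 2.
    have : `|s a m - s a m'| <= 2 * dl.
      have -> : s a m - s a m' = (l a - s a m') - (l a - s a m) by ring.
      apply: (le_trans (ler_normB _ _)); rewrite mulr_natl mulr2n.
      by apply: lerD; [exact: Am'|exact: Am].
    move=> sdl; rewrite -[leLHS]real_normK ?num_real//.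
    rewrite (_ : 4 * dl ^+ 2 = (2 * dl) ^+ 2); last by ring.
    by rewrite ler_pXn2r// nnegrE ?mulr_ge0// ltW.
  have hn0 : 0 < h ^+ n by rewrite exprn_gt0.
  rewrite -(ler_pM2l hn0) (le_trans H)// mulrDr mulrA divff ?gt_eqF// mul1r.
  by apply: lerD => //; rewrite mulrA [h ^+ n * _]mulrC.
(* The cells are reassembled into the whole cube, where the derivatives are bounded; hence no factor
   counting cells. *)
have sumQ k : \sum_(a : {ffun 'I_n -> 'I_N}) \int[lam R n]_(x in Q a) ((pderiv k (v m) x - pderiv k (v m') x) ^+ 2)
   <= 4 * C.
  rewrite -Rint_subcubes//; last 2 first.
  - by rewrite NhL; apply: bmeas_sqr; exact: bmeasB.
  - by move=> x; exact: sqr_ge0.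
  rewrite NhL; apply: le_trans (Rint_sqrB_le mC fC (bdv m k) (bdv m' k)) _.
  rewrite (_ : 4 * C = 2 * (C + C)); last by ring.
  by rewrite ler_pM2l// lerD.
apply: (le_trans (ler_sum _ (fun a _ => step a))).
rewrite big_split/= sumr_const -mulr_sumr exchange_big/= [e]splitr lerD//.
  apply: le_trans dle; rewrite /K -[leLHS]mulr_natl.
  by rewrite (@eq_card _ _ {ffun 'I_n -> 'I_N})// !mulrA.
apply: le_trans he; rewrite mulrC ler_wpM2r ?sqr_ge0//.
apply: (le_trans (ler_sum _ (fun k _ => sumQ k))).
by rewrite sumr_const card_ord -[leLHS]mulr_natl.
Qed.

End CubeCompactness.

(** * Closability of partial derivatives on a cube *)

Section Closability.
Variable R : realType.
Implicit Types (n : nat).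

Lemma smooth_C1on_pderiv n (O : set 'rV[R]_n) v : smooth_open O v -> forall k, C1on O (pderiv k v).
Proof. by move=> vO k; apply: smooth_C1on; exact: smooth_open_pderiv. Qed.

(** Pointwise this is (t f + g)^2 >= 0 divided by t. The parameter t balances a small factor against
    one that is merely bounded. *)
Lemma young_Rint d (T : measurableType d) (mu : {measure set T -> \bar R}) (D : set T)
    (f g : T -> R) (t : R) : measurable D -> (mu D < +oo)%E -> bmeas D f -> bmeas D g -> 0 < t ->
  - (2 * \int[mu]_(x in D) (f x * g x)) <=
  t * \int[mu]_(x in D) (f x ^+ 2) + t^-1 * \int[mu]_(x in D) (g x ^+ 2).
Proof.
move=> mD fD bf bg t0; have bf2 := bmeas_sqr bf; have bg2 := bmeas_sqr bg.
have bfg := bmeasM bf bg.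
rewrite -mulNr -!(Rint_Z mD fD)// -Rint_D//; try exact: bmeasZ.
apply: Rint_le => //; [exact: bmeasZ|by apply: bmeasD; exact: bmeasZ|].
move=> x _; rewrite -(ler_pM2l t0) mulrDr !mulrA divff ?gt_eqF// mul1r -subr_ge0.
by rewrite (_ : _ - _ = (t * f x + g x) ^+ 2) ?sqr_ge0//; ring.
Qed.

(* The weight [w] vanishes on the two faces [x_k = c_k] and [x_k = c_k + L], so that
   integrating by parts in the direction [k] produces no boundary term. *)
Lemma closable_cube n (c : 'rV[R]_n) (L : R) (O : set 'rV[R]_n)
    (v : nat -> 'rV[R]_n -> R) (k : 'I_n) (D : set (BrV R n)) :
  0 < L -> open O -> ccube c L `<=` O -> (forall m, smooth_open O (v m)) ->
  (forall e : R, 0 < e -> exists N, forall m l, (N <= m)%N -> (N <= l)%N ->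
     \int[lam R n]_(x in cube c L) ((pderiv k (v m) x - pderiv k (v l) x) ^+ 2) <= e) ->
  (forall e : R, 0 < e -> exists N, forall m, (N <= m)%N ->
     \int[lam R n]_(x in cube c L) (v m x ^+ 2) <= e) ->
  measurable D -> D `<=` cube c L ->
  (forall x, D x -> c 0 k + L / 4 <= x 0 k <= c 0 k + 3 * L / 4) ->
  forall e : R, 0 < e -> exists N, forall m, (N <= m)%N ->
    \int[lam R n]_(x in D) (pderiv k (v m) x ^+ 2) <= e.
Proof.
move=> L0 oO cO vO H1 H2 mD DQ Dk e e0.
have mC := @measurable_cube R n c L.
have fC := lam_cube_fin c (ltW L0).
pose Q := cube c L.
have L20 : 0 < L ^+ 2 by rewrite exprn_gt0.
(* Product of the distances to the two faces: at most L^2 on the cube and at least (L / 4)^2 on [D].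
   It is spelled with -1 to fit [C1onD]. *)
pose w (x : 'rV[R]_n) := (x 0 k + (-1) * c 0 k) * ((c 0 k + L) + (-1) * x 0 k).
have wC : C1on O w.
  have X1 : C1on O (fun x : 'rV[R]_n => x 0 k + (-1) * c 0 k).
    exact: (C1onD (-1) oO (@C1on_coord _ _ O k) (@C1on_cst _ _ O _)).1.
  have X2 : C1on O (fun x : 'rV[R]_n => (c 0 k + L) + (-1) * x 0 k).
    exact: (C1onD (-1) oO (@C1on_cst _ _ O _) (@C1on_coord _ _ O k)).1.
  exact: (C1onM oO X1 X2).1.
have w0 x : Q x -> 0 <= w x <= L ^+ 2.
  move=> /(_ k) /andP[x1 x2]; rewrite /w; apply/andP; split; first by apply: mulr_ge0; lra.
  by rewrite expr2 ler_pM//; lra.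
have wD x : D x -> L ^+ 2 / 16 <= w x.
  move=> /Dk /andP[x1 x2]; rewrite (_ : L ^+ 2 / 16 = (L / 4) * (L / 4)); last by field.
  by rewrite /w ler_pM//; lra.
have vC m := smooth_C1on (vO m).
have dvC m := smooth_C1on_pderiv (vO m) k.
have GC l := (C1onM oO wC (dvC l)).1.
pose G l x := w x * pderiv k (v l) x.
pose F m l x := v m x * G l x.
have FC m l : C1on O (F m l) := (C1onM oO (vC m) (GC l)).1.
have FE m l x : O x -> pderiv k (F m l) x = v m x * pderiv k (G l) x + G l x * pderiv k (v m) x.
  exact: (C1onM oO (vC m) (GC l)).2.
have QO x : Q x -> O x by move=> /cube_ccube; exact: cO.
have bw : bmeas Q w by apply: C1on_bmeas; exact: C1on_sub cO wC.
have bv m : bmeas Q (v m) by apply: C1on_bmeas; exact: C1on_sub cO (vC m).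
have bdv m : bmeas Q (pderiv k (v m)) by apply: C1on_bmeas; exact: C1on_sub cO (dvC m).
have bdG l : bmeas Q (pderiv k (G l)).
  by apply: C1on_bmeas_pderiv; exact: C1on_sub cO (GC l).
pose cross m l := \int[lam R n]_(x in Q) (w x * (pderiv k (v m) x * pderiv k (v l) x)).
(* Integration by parts leaves v m undifferentiated, and v m tends to 0 in L^2. *)
have crossE m l : cross m l = - \int[lam R n]_(x in Q) (v m x * pderiv k (G l) x).
  have F0 := Rint_pderiv0 (ltW L0) (C1on_sub cO (FC m l)) (k := k).
  have : \int[lam R n]_(x in Q) (v m x * pderiv k (G l) x) + cross m l = 0.
    rewrite -Rint_D//; last 2 first.
    - exact: bmeasM.
    - by apply: bmeasM => //; exact: bmeasM.
    rewrite -F0; last first.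
      by move=> x cx xk; rewrite /F /G /w; case: xk => ->; ring.
    by apply: eq_Rintegral => x /set_mem /QO Ox; rewrite FE// /G; ring.
  by move/eqP; rewrite addrC addr_eq0 => /eqP.
have bD m : bmeas Q (fun x => w x * pderiv k (v m) x ^+ 2).
  by apply: bmeasM => //; exact: bmeas_sqr.
(* With a, b the two derivatives, a^2 <= (a - b)^2 + 2 a b: a Cauchy term and the integrand of
   [cross]. *)
have key m l : L ^+ 2 / 16 * \int[lam R n]_(x in D) (pderiv k (v m) x ^+ 2) <=
   L ^+ 2 * \int[lam R n]_(x in Q) ((pderiv k (v m) x - pderiv k (v l) x) ^+ 2) + 2 * cross m l.
  have fD : (lam R n D < +oo)%E by apply: le_lt_trans fC; apply: le_measure; rewrite ?inE.
  have bDD : bmeas D (fun x => pderiv k (v m) x ^+ 2).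
    apply: bmeas_sqr; split; first exact: measurable_funS (bdv m).1.
    by case: (bdv m) => _ [M HM]; exists M => x /DQ; exact: HM.
  have bwD : bmeas D (fun x => w x * pderiv k (v m) x ^+ 2).
    split; first exact: measurable_funS (bD m).1.
    by case: (bD m) => _ [M HM]; exists M => x /DQ; exact: HM.
  apply: (@le_trans _ _ (\int[lam R n]_(x in D) (w x * pderiv k (v m) x ^+ 2))).
    rewrite -(Rint_Z mD fD _ bDD); apply: Rint_le => //; first exact: bmeasZ.
    by move=> x Dx; rewrite ler_wpM2r ?sqr_ge0// wD.
  apply: (@le_trans _ _ (\int[lam R n]_(x in Q) (w x * pderiv k (v m) x ^+ 2))).
    apply: subset_Rint_ge0 => //.
    by move=> x /w0 /andP[wx _]; rewrite mulr_ge0// sqr_ge0.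
  have bB := bmeasB (bdv m) (bdv l); have bB2 := bmeas_sqr bB.
  have bX : bmeas Q (fun x => w x * (pderiv k (v m) x * pderiv k (v l) x)).
    by apply: bmeasM => //; exact: bmeasM.
  rewrite /cross -(Rint_Z mC fC _ bB2) -(Rint_Z mC fC _ bX) -Rint_D//; try exact: bmeasZ.
  apply: Rint_le => //; first by apply: bmeasD; exact: bmeasZ.
  move=> x /w0 /andP[wx wL].
  set a := pderiv k (v m) x; set b := pderiv k (v l) x.
  apply: (@le_trans _ _ (w x * (a - b) ^+ 2 + 2 * (w x * (a * b)))).
    rewrite -subr_ge0 (_ : _ - _ = w x * b ^+ 2); last by ring.
    by rewrite mulr_ge0 ?sqr_ge0.
  by rewrite lerD2r ler_wpM2r ?sqr_ge0.
have cr m l t : 0 < t -> 2 * cross m l <=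
   t * \int[lam R n]_(x in Q) (v m x ^+ 2) + t^-1 * \int[lam R n]_(x in Q) (pderiv k (G l) x ^+ 2).
  by move=> t0; rewrite crossE mulrN; exact: young_Rint.
(* One third for the Cauchy term and one for each term of Young's inequality. *)
pose e' := L ^+ 2 / 16 * e / 3.
have e'0 : 0 < e' by rewrite !mulr_gt0 ?invr_gt0.
(* N1 is frozen as the second index of [cross], so that [B] is a constant while m grows; t is then
   chosen to make t^-1 B at most e'. *)
have [N1 HN1] := H1 (e' / L ^+ 2) (divr_gt0 e'0 L20).
pose B := \int[lam R n]_(x in Q) (pderiv k (G N1) x ^+ 2).
have B0 : 0 <= B by apply: Rintegral_ge0 => x _; exact: sqr_ge0.
pose t := (B + 1) / e'.
have t0 : 0 < t by rewrite divr_gt0// ltr_wpDl.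
have [N2 HN2] := H2 (e' / t) (divr_gt0 e'0 t0).
exists (maxn N1 N2) => m; rewrite geq_max => /andP[m1 m2].
have L16 : 0 < L ^+ 2 / 16 by rewrite divr_gt0.
rewrite -(ler_pM2l L16).
apply: (le_trans (key m N1)).
have -> : L ^+ 2 / 16 * e = e' + (e' + e') by rewrite /e'; field.
apply: lerD.
  by rewrite mulrC -ler_pdivlMr//; exact: HN1.
apply: (le_trans (cr m N1 t t0)); apply: lerD.
  by rewrite mulrC -ler_pdivlMr//; exact: HN2.
rewrite -/B /t invf_div mulrAC ler_pdivrMr ?ltr_wpDl//.
by rewrite ler_wpM2l ?(ltW e'0)// lerDl.
Qed.

End Closability.

(** * Charts of the interior *)

Section ChartExpr.
Variable R : realType.
Variables (T1 T2 : topologicalType) (n1 n2 : nat).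
Variables (A1 : @atlas R T1 n1) (A2 : @atlas R T2 n2) (r : T1 -> T2 -> Prop).

(** [chart_expr] chooses among possible images; the last hypothesis says that there is only one. *)
Lemma chart_exprE (i : idx A1) (j : idx A2) p q :
  r p q -> dom i p -> dom j q ->
  (forall p' q', r p' q' -> dom i p' -> dom j q' -> cmap i p' = cmap i p -> cmap j q' = cmap j q) ->
  chart_expr r i j (cmap i p) = cmap j q.
Proof.
move=> rpq ip jq uniq; rewrite /chart_expr; case: xgetP => [y _|/(_ (cmap j q))[]].
  by move=> [p' [q' [rpq' ip' jq' E <-]]]; exact: uniq rpq' ip' jq' E.
by exists p, q.
Qed.

End ChartExpr.

Lemma smooth_on_sub (R : realType) n (A A' : set 'rV[R]_n) f :
  A' `<=` A -> smooth_on A f -> smooth_on A' f.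
Proof.
move=> AA fA x /AA /fA[V [g [oV Vx gV gf]]]; exists V, g; split => //.
by move=> y [/AA Ay Vy]; apply: gf.
Qed.

Lemma rV_continuous_at (R : realType) (T : topologicalType) m (f : T -> 'rV[R]_m) x :
  (forall l, {for x, continuous (fun z => f z 0 l)}) -> {for x, continuous f}.
Proof.
move=> cf; rewrite /prop_for /continuous_at; apply/(@cvgrPdist_le _ _ _ (nbhs x)) => e e0.
have : \forall z \near x, forall l, `|f x 0 l - f z 0 l| <= e.
  apply: (@filter_forall _ _ (fun l z => `|f x 0 l - f z 0 l| <= e) (nbhs x)) => l.
  by have /(@cvgrPdist_le _ _ _ (nbhs x)) := cf l; apply.
apply: filterS => z H; apply: rVnorm_le; first exact: ltW.
by move=> l; rewrite !mxE.
Qed.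

Section Manifold.
Variable R : realType.
Variables (T : topologicalType) (n : nat) (A : @atlas R T n.+1).
Hypothesis mfd : is_manifold (half_space R n) A.

Let phi (i j : idx A) := chart_expr (fun p q : T => p = q) i j.

Lemma chart_transE (i j : idx A) p : dom i p -> dom j p -> phi i j (cmap i p) = cmap j p.
Proof.
move=> ip jp; apply: chart_exprE => // p' _ <- ip' _ E.
by congr (cmap j _); apply: (mf_inj mfd (i := i)) => //; rewrite inE.
Qed.

Lemma chart_transD (i j : idx A) p : dom i p -> dom j p ->
  chart_dom (fun p q : T => p = q) i j (cmap i p).
Proof. by move=> ip jp; exists p, p. Qed.

Lemma cmap_half (i : idx A) p : dom i p -> 0 <= cmap i p 0 ord0.
Proof.
move=> ip; have [V oV E] := mf_open_map mfd (mf_open mfd i) (@subset_refl _ _).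
by have [] : (V `&` half_space R n) (cmap i p) by rewrite -E; exists p.
Qed.

(** Fermat's criterion on the line through x in direction k. *)
Lemma pderiv_min m (f : 'rV[R]_m -> R) (O : set 'rV[R]_m) x k : open O -> O x ->
  (forall y, O y -> derivable (f : _ -> R^o) y (delta_mx 0 k)) ->
  (forall y, O y -> f x <= f y) -> pderiv k f x = 0.
Proof.
move=> oO Ox df fx; pose e : 'rV[R]_m := delta_mx 0 k.
have : nbhs (0 : R) [set t | O (x + t *: e)].
  have c0 : {for (0 : R), continuous (fun t : R => x + t *: e)}.
    by apply: continuousD; [exact: cst_continuous|exact: scalel_continuous].
  by apply: c0; rewrite /= scale0r addr0; exact: near_open.
move=> /nbhs_ballP[d /= d0 dO].
have Od t : t \in `](- d), d[ -> O (x + t *: e).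
  rewrite in_itv/= => td; apply: dO; rewrite -ball_normE/= sub0r normrN.
  by rewrite ltr_norml.
pose g (t : R) := f (x + t *: e).
have dg t : t \in `](- d), d[ -> derivable (g : R -> R^o) t 1.
  by move=> /Od Ot; rewrite (@derivable_line _ _ R^o f x e t); exact: df.
have dd : - d <= d by rewrite -subr_ge0 opprK addr_ge0// ltW.
have z0 : 0 \in `](- d), d[ by rewrite in_itv/= oppr_lt0 d0.
have := @derive1_at_min _ g (- d) d 0 dd dg z0.
move=> /(_ _) [|_ <-].
  by move=> t /Od Ot; rewrite /g scale0r addr0; exact: fx.
by rewrite (@derive_line _ _ R^o f x e 0) scale0r addr0.
Qed.

(** [boundary] asks for one chart; invariance is proved here. If p were off the hyperplane in chart
    i, the transition to j would be smooth on a full neighbourhood of x, and its first component,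
    nonnegative and 0 at x, would have zero gradient there. That contradicts the invertibility of
    the Jacobian. *)
Lemma boundary_chart (i : idx A) p : boundary A p -> dom i p -> cmap i p 0 ord0 = 0.
Proof.
move=> [j [jp j0]] ip; apply/eqP/negPn/negP => x0.
have {}x0 : 0 < cmap i p 0 ord0 by rewrite lt_neqAle eq_sym x0 cmap_half.
set x := cmap i p in x0.
pose V := dom i `&` dom j.
have oV : open V by apply: openI; exact: (mf_open mfd).
have [P oP OV] := mf_open_map mfd oV (@subIsetl _ _ _).
pose O' := P `&` [set y : 'rV[R]_n.+1 | 0 < y 0 ord0].
have oO' : open O'.
  apply: openI => //.
  apply: (@open_comp _ _ (fun y : 'rV[R]_n.+1 => y 0 ord0) [set t | 0 < t]); last exact: open_gt.
  by move=> y _; exact: coord_continuous.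
have O'V y : O' y -> exists2 q, V q & cmap i q = y.
  move=> [Oy y0]; have : (P `&` half_space R n) y by split => //; exact: ltW.
  by rewrite -OV => -[q Vq E]; exists q.
have O'x : O' x.
  split => //; have : (cmap i @` V) x by exists p.
  by rewrite OV => -[].
have O'D y : O' y -> chart_dom (fun p q : T => p = q) i j y.
  by move=> /O'V[q [iq jq] <-]; exact: chart_transD.
have phiO l : smooth_open O' (fun z => phi i j z 0 l).
  apply: smooth_on_open => //; apply: smooth_on_sub (mf_smooth mfd l) => //.
set y := phi i j x.
have yE : y = cmap j p by rewrite /y /x chart_transE.
have phi0 k : pderiv k (fun z => phi i j z 0 ord0) x = 0.
  apply: (pderiv_min oO' O'x).
    by move=> z O'z; exact: smooth_open_derivable (phiO ord0) O'z.
  move=> z /O'V[q [iq jq] <-]; rewrite -/y yE j0 chart_transE//.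
  exact: cmap_half.
(* The point y lies on the boundary of the half-space, so the inverse transition is replaced by a
   smooth extension; agreement on the image of the transition suffices for the chain rule. *)
have psi l : exists2 G : 'rV[R]_n.+1 -> R,
    differentiable (G : _ -> R^o) y & \forall z \near x, G (phi i j z) = z 0 l.
  have [|W [G [oW Wy GW Gf]]] := mf_smooth mfd (i := j) (j := i) l (x := y).
    by rewrite yE; exact: chart_transD.
  exists G; first exact: smooth_open_differentiable oW GW Wy.
  have cphi : {for x, continuous (phi i j)}.
    by apply: rV_continuous_at => k; exact: smooth_open_continuous (phiO k) O'x.
  have : \forall z \near x, O' z /\ W (phi i j z).
    apply: filterI; first exact: near_open.
    by apply: cphi; exact: near_open.
  apply: filterS => z [/O'V[q [iq jq] <-]]; rewrite chart_transE// => Wq.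
  rewrite Gf; last by split => //; exact: chart_transD.
  by rewrite -/(phi j i) chart_transE.
pose G l := projT1 (cid2 (psi l)).
have dG l : differentiable (G l : _ -> R^o) y by rewrite /G; case: cid2.
have GE l : \forall z \near x, G l (phi i j z) = z 0 l by rewrite /G; case: cid2.
pose J := jac (phi i j) x; pose K : 'M[R]_n.+1 := \matrix_(m, l) pderiv m (G l) y.
have JK : J *m K = 1%:M.
  apply/matrixP => k l; rewrite !mxE.
  have [_ <-] : derivable ((G l \o phi i j) : _ -> R^o) x (delta_mx 0 k) /\
      pderiv k (G l \o phi i j) x = \sum_m J k m * K m l.
    have := @pderiv_comp _ _ _ (phi i j) (G l) x k (fun m => smooth_open_derivable (i := k) (phiO m) O'x) (dG l).
    by move=> [? ->]; split => //; apply: eq_bigr => m _; rewrite !mxE.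
  rewrite /pderiv (near_eq_derive _ (g := (fun z : 'rV[R]_n.+1 => z 0 l) : _ -> R^o)).
    by rewrite (@derive_val _ _ _ _ _ _ _ (is_derive_coord l k x)) eq_sym.
  exact: GE.
(* The first column of [J] is zero, against K J = 1 at the entry (0, 0). *)
have := congr1 (fun M : 'M[R]_n.+1 => M ord0 ord0) (mulmx1C JK).
rewrite !mxE big1 ?eqxx => [/eqP|k _]; first by rewrite eq_sym oner_eq0.
by rewrite [J k _]mxE phi0 mulr0.
Qed.

End Manifold.

(** * Positive definite matrices *)

Section PosDef.
Variable R : realType.
Variable n : nat.
Implicit Types (M : 'M[R]_n) (v w : 'rV[R]_n).

Definition posdef M := forall v, v != 0 -> 0 < (v *m M *m v^T) 0 0.

Definition qf M v : R := (v *m M *m v^T) 0 0.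
Definition bf M v w : R := (v *m M *m w^T) 0 0.

Lemma bfE M v w : bf M v w = \sum_k \sum_l M k l * v 0 k * w 0 l.
Proof.
rewrite /bf mxE exchange_big/=; apply: eq_bigr => l _.
by rewrite !mxE mulr_suml; apply: eq_bigr => k _; rewrite [M k l * _]mulrC.
Qed.

Lemma bfC M v w : M^T = M -> bf M v w = bf M w v.
Proof.
move=> sM; rewrite /bf; transitivity ((v *m M *m w^T)^T 0 0); first by rewrite [RHS]mxE.
by rewrite !trmx_mul trmxK sM mulmxA.
Qed.

Lemma lincomb11 (a b : R) (A B : 'M[R]_1) : (a *: A - b *: B) 0 0 = a * A 0 0 - b * B 0 0.
Proof. by rewrite !mxE. Qed.

Lemma bf_combl M v w u (a b : R) : bf M (a *: v - b *: w) u = a * bf M v u - b * bf M w u.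
Proof. by rewrite /bf mulmxBl mulmxBl -!scalemxAl lincomb11. Qed.

Lemma bf_combr M v w u (a b : R) : bf M u (a *: v - b *: w) = a * bf M u v - b * bf M u w.
Proof. rewrite /bf; have -> : (a *: v - b *: w)^T = a *: v^T - b *: w^T by apply/matrixP => i j; rewrite !mxE.
by rewrite mulmxBr -!scalemxAr lincomb11. Qed.

Lemma posdef_ge0 M v : posdef M -> 0 <= qf M v.
Proof.
move=> pM; have [->|v0] := eqVneq v 0; last exact/ltW/pM.
by rewrite /qf mul0mx mul0mx mxE.
Qed.

(** Positivity on the vector qf(w) v - bf(v, w) w, divided by qf(w). *)
Lemma bf_CS M v w : M^T = M -> posdef M -> bf M v w ^+ 2 <= qf M v * qf M w.
Proof.
move=> sM pM; have [->|w0] := eqVneq w 0.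
  by rewrite /bf /qf trmx0 !mulmx0 [const_mx 0 0 0]mxE expr0n/= mulr0.
have c0 : 0 < qf M w := pM _ w0.
have := posdef_ge0 (qf M w *: v - bf M v w *: w) pM.
rewrite -[qf M (_ - _)]/(bf M _ _) bf_combl !bf_combr [bf M w v]bfC// -!/(qf M _).
rewrite (_ : _ - _ = qf M w * (qf M w * qf M v - bf M v w ^+ 2)); last by rewrite -![bf M ?[x] ?x]/(qf M _); ring.
by rewrite pmulr_rge0// subr_ge0 mulrC.
Qed.

Lemma posdef_unit M : posdef M -> M \in unitmx.
Proof.
move=> pM; rewrite -row_free_unit -kermx_eq0; apply/eqP/row_matrixP => i.
rewrite row0; apply/eqP/negPn/negP => ri; have := pM _ ri.
by rewrite -row_mul mulmx_ker row0 mul0mx mxE ltxx.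
Qed.

Lemma bf_le M (m : R) : (forall k l, `|M k l| <= m) ->
  forall v, qf M v <= (n%:R * m) * \sum_k v 0 k ^+ 2.
Proof.
move=> Mm v; set S := \sum_k _.
rewrite -[qf M v]/(bf M v v) bfE.
apply: (@le_trans _ _ (\sum_k \sum_l m * ((v 0 k ^+ 2 + v 0 l ^+ 2) / 2))).
  apply: ler_sum => k _; apply: ler_sum => l _.
  apply: le_trans (ler_norm _) _; rewrite -mulrA normrM ler_pM//.
  rewrite normrM ler_pdivlMr// -[v 0 k ^+ 2]real_normK ?num_real// -[v 0 l ^+ 2]real_normK ?num_real//.
  rewrite -subr_ge0 (_ : _ - _ = (`|v 0 k| - `|v 0 l|) ^+ 2) ?sqr_ge0//; ring.
rewrite le_eqVlt; apply/orP; left; apply/eqP.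
under eq_bigr do rewrite -mulr_sumr -mulr_suml big_split/= sumr_const card_ord.
rewrite -mulr_sumr -mulr_suml big_split/= sumr_const card_ord !sumrMnl -/S.
by rewrite -[S *+ n]mulr_natl; field.
Qed.

(** An upper bound on M gives a lower bound on its inverse without eigenvalues: S, the sum of the
    v_k^2, is the M-product of v M^-1 and v, so S^2 <= qf(M^-1, v) qf(M, v) by Cauchy-Schwarz, and
    qf(M, v) <= n m S. *)
Lemma posdef_inv_ge M (m : R) v : M^T = M -> posdef M -> (forall k l, `|M k l| <= m) ->
  \sum_k v 0 k ^+ 2 <= (n%:R * m) * qf (invmx M) v.
Proof.
move=> sM pM Mm; have uM := posdef_unit pM.
set S := \sum_k _.
have S0 : 0 <= S by apply: sumr_ge0 => k _; exact: sqr_ge0.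
have SE : S = bf M (v *m invmx M) v.
  rewrite /bf mulmxKV//.
  by rewrite mxE; apply: eq_bigr => k _; rewrite mxE.
have aE : qf M (v *m invmx M) = qf (invmx M) v.
  rewrite /qf mulmxKV// trmx_mul mulmxA.
  transitivity ((v *m (invmx M)^T *m v^T)^T 0 0); first by rewrite [RHS]mxE.
  by rewrite !trmx_mul !trmxK mulmxA.
have CS := bf_CS (v *m invmx M) v sM pM.
rewrite -SE aE in CS.
have vM : qf M v <= (n%:R * m) * S := bf_le Mm v.
have q0 : 0 <= qf (invmx M) v by rewrite -aE; exact: posdef_ge0.
have [S00|Sn0] := eqVneq S 0.
  have [->|v0] := eqVneq v 0; first by rewrite /S00 /qf !mul0mx mxE mulr0 S00.
  have := pM _ v0; rewrite -/(qf M v) => /lt_le_trans /(_ vM); rewrite S00 mulr0 ltxx //.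
have Sp : 0 < S by rewrite lt_neqAle eq_sym Sn0.
rewrite -(ler_pM2l Sp) -expr2 (le_trans CS)//.
by rewrite mulrC [leRHS]mulrA [S * _]mulrC ler_wpM2r.
Qed.

End PosDef.

Section MatrixContinuity.
Variable R : realType.

Lemma cvg_det (T : Type) (F : set_system T) n (M : T -> 'M[R]_n) (N : 'M[R]_n) : Filter F ->
  (forall k l, M x k l @[x --> F] --> N k l) -> \det (M x) @[x --> F] --> \det N.
Proof.
move=> FF cM; rewrite /determinant; apply: cvg_sumr => s _.
by apply: cvgM; [exact: cvg_cst|apply: cvg_prodr => i _; exact: cM].
Qed.

(** Cramer's rule: the entries of the inverse are cofactors divided by the determinant. *)
Lemma cvg_invmx (T : Type) (F : set_system T) n (M : T -> 'M[R]_n) (N : 'M[R]_n) : Filter F ->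
  (forall k l, M x k l @[x --> F] --> N k l) -> N \in unitmx ->
  (\forall x \near F, M x \in unitmx) ->
  forall k l, (invmx (M x)) k l @[x --> F] --> (invmx N) k l.
Proof.
move=> FF cM uN uM k l.
have E : \forall x \near F, (\det (M x))^-1 * (\adj (M x)) k l = (invmx (M x)) k l.
  by apply: filterS uM => x ux; rewrite /invmx ux !mxE.
rewrite {2}/invmx uN [X in _ --> X]mxE.
apply: (cvg_trans (near_eq_cvg E)); apply: cvgM.
  apply: cvgV; last exact: cvg_det.
  by rewrite -unitfE -unitmxE.
rewrite mxE; under eq_fun do rewrite mxE.
rewrite /cofactor; apply: cvgM; first exact: cvg_cst.
apply: cvg_det => i j; rewrite !mxE; under eq_fun do rewrite !mxE.
exact: cM.
Qed.

(** The segment from the identity to M consists of positive definite, hence invertible, matrices, so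
    the determinant cannot change sign along it. *)
Lemma posdef_det_gt0 n (M : 'M[R]_n) : posdef M -> 0 < \det M.
Proof.
move=> pM.
pose P (t : R) : 'M[R]_n := (1 - t)%:M + t *: M.
have P1 : P 1 = M by rewrite /P subrr scale1r -scalemx1 scale0r add0r.
have P0 : P 0 = 1%:M by rewrite /P subr0 scale0r addr0.
have pd t : 0 <= t <= 1 -> posdef (P t).
  move=> /andP[t0 t1] v v0.
  have E : (v *m P t *m v^T) 0 0 = (1 - t) * (\sum_k v 0 k ^+ 2) + t * qf M v.
    rewrite /P mulmxDr mulmxDl mul_mx_scalar -scalemxAr -!scalemxAl [LHS]mxE mxE [X in _ + X]mxE.
    by congr (_ * _ + _); rewrite mxE; apply: eq_bigr => k _; rewrite mxE.
  rewrite E; have q0 := pM _ v0; rewrite -/(qf M v) in q0.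
  have s0 : 0 < \sum_k v 0 k ^+ 2.
    rewrite lt_neqAle sumr_ge0 ?andbT; last by move=> k _; exact: sqr_ge0.
    apply/eqP => /esym s0; move/eqP: v0; apply; apply/rowP => k; rewrite mxE.
    apply/eqP; rewrite -sqrf_eq0; apply/eqP.
    by have /psumr_eq0P := s0; apply => // i _; exact: sqr_ge0.
  have [->|tn] := eqVneq t 0; first by rewrite subr0 mul1r mul0r addr0.
  by rewrite ltr_wpDl ?mulr_ge0 ?subr_ge0 ?(ltW s0)// mulr_gt0// lt_neqAle eq_sym tn.
rewrite ltNge; apply/negP => d0.
have cf : {within `[0, 1], continuous (fun t => \det (P t))}.
  apply: continuous_subspaceT => t.
  apply: (@cvg_det _ (nbhs t)) => k l; rewrite !mxE; under eq_fun do rewrite !mxE.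
  apply: cvgD; last by apply: cvgM; [exact: cvg_id|exact: cvg_cst].
  by apply: cvgMn; apply: cvgB; [exact: cvg_cst|exact: cvg_id].
have [|t t01 dt] := IVT (@ler01 R) cf (v := 0).
  by rewrite P0 P1 det1 ge_min d0 orbT le_max ler01.
have := posdef_unit (pd t t01).
by rewrite unitmxE dt unitr0.
Qed.

End MatrixContinuity.

(** * Inverse charts and the norm of the gradient on the interior *)

Section InteriorAtlas.
Variable R : realType.
Variables (T : ptopologicalType) (n : nat) (A : @atlas R T n.+1).
Hypothesis mfd : is_manifold (half_space R n) A.
Notation Ai := (interior_atlas A).

(** Near p one chart has positive first coordinate, and by [boundary_chart] a boundary point would
    have coordinate 0 in that same chart. *)
Lemma interior_open : open (~` boundary A).
Proof.
apply: nbhs_open => p pA; have [i ip] := mf_cover mfd p.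
have x0 : 0 < cmap i p 0 ord0.
  rewrite lt_neqAle cmap_half// andbT eq_sym; apply/eqP => x0.
  by apply: pA; exists i.
have : \forall q \near p, dom i q /\ 0 < cmap i q 0 ord0.
  apply: filterI; first by apply: open_nbhs_nbhs; split => //; exact: mf_open mfd i.
  have c : {for p, continuous (fun q => cmap i q 0 ord0)}.
    exact: (@continuous_comp _ _ _ (cmap i) (fun y : 'rV[R]_n.+1 => y 0 ord0) p
      (mf_continuous mfd ip) (@coord_continuous _ _ _ _ _ _)).
  by apply: (c [set t | 0 < t]); apply: open_nbhs_nbhs; split => //; exact: open_gt.
apply: filterS => q [iq q0] /(boundary_chart mfd) /(_ iq) q00.
by rewrite q00 ltxx in q0.
Qed.

Lemma dom_open (i : idx Ai) : open (dom i).
Proof. by apply: openI; [exact: (mf_open mfd i)|exact: interior_open]. Qed.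

Lemma cmap_open (i : idx Ai) (V : set T) : open V -> V `<=` dom i -> open (cmap i @` V).
Proof.
move=> oV Vi.
have Vi' : V `<=` dom (i : idx A) by move=> p /Vi[].
have [P oP E] := mf_open_map mfd oV Vi'.
have -> : cmap i @` V = P `&` [set y : 'rV[R]_n.+1 | 0 < y 0 ord0].
  apply/seteqP; split => y; last first.
    move=> [Py y0]; have : (P `&` half_space R n) y by split => //; exact: ltW.
    by rewrite -E.
  move=> yV; have : (cmap (i : idx A) @` V) y by [].
  rewrite E => -[Py _]; split => //=.
  case: yV => p Vp <-; have [ip pA] := Vi _ Vp.
  rewrite lt_neqAle [X in _ && X](cmap_half mfd ip) andbT eq_sym; apply/eqP => x0.
  by apply: pA; exists i.
apply: openI => //.
apply: (@open_comp _ _ (fun y : 'rV[R]_n.+1 => y 0 ord0) [set t | 0 < t]); last exact: open_gt.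
by move=> y _; exact: coord_continuous.
Qed.

Lemma chart_image_open (i : idx Ai) : open (chart_image i).
Proof. exact: cmap_open (dom_open i) _. Qed.

Definition icmap (i : idx Ai) (x : 'rV[R]_n.+1) : T :=
  xget point [set p | dom i p /\ cmap i p = x].

Lemma cmap_injI (i : idx Ai) p q : dom i p -> dom i q -> cmap i p = cmap i q -> p = q.
Proof. by move=> [ip _] [iq _]; apply: (mf_inj mfd (i := i)); rewrite inE. Qed.

Lemma icmapK (i : idx Ai) p : dom i p -> icmap i (cmap i p) = p.
Proof.
move=> ip; rewrite /icmap; case: xgetP => [q _ [iq E]|/(_ p)[]//].
exact: cmap_injI E.
Qed.

Lemma cmapK (i : idx Ai) x : chart_image i x -> dom i (icmap i x) /\ cmap i (icmap i x) = x.
Proof. by move=> [p ip <-]; rewrite icmapK. Qed.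

Lemma cmap_continuous (i : idx Ai) p : dom i p -> {for p, continuous (cmap i)}.
Proof. by move=> [ip _]; exact: (mf_continuous mfd ip). Qed.

Lemma icmap_continuous (i : idx Ai) x : chart_image i x -> {for x, continuous (icmap i)}.
Proof.
move=> ix; have [ip E] := cmapK ix; move=> B; rewrite nbhsE => -[V [oV Vp] VB].
have oW : open (cmap i @` (V `&` dom i)).
  by apply: cmap_open; [exact: openI oV (dom_open i)|exact: subIsetr].
have : nbhs x (cmap i @` (V `&` dom i)).
  apply: open_nbhs_nbhs; split => //; exists (icmap i x) => //; split => //.
by apply: filterS => y [q [Vq iq] <-] /=; rewrite icmapK//; exact: VB.
Qed.

(** Spelled exactly as the coordinate expression inside [nabla_norm]. *)
Definition rep (u : T -> R) (i : idx Ai) (x : 'rV[R]_n.+1) : R :=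
  @chart_expr R T R n.+1 1 Ai (line_atlas R) (graph_on setT u) i tt x 0 0.

Definition smoothM (u : T -> R) := @smooth_rel R T R n.+1 1 Ai (line_atlas R) (graph_on setT u).

Lemma repE u (i : idx Ai) p : dom i p -> rep u i (cmap i p) = u p.
Proof.
move=> ip; rewrite /rep (@chart_exprE _ _ _ _ _ Ai (line_atlas R) (graph_on setT u) i tt p (u p))//=.
  by rewrite mxE eqxx.
move=> p' q' [_ ->] ip' _ E; congr (_%:M); congr u; exact: cmap_injI E.
Qed.

Lemma rep_icmap u (i : idx Ai) x : chart_image i x -> rep u i x = u (icmap i x).
Proof. by move=> [p ip <-]; rewrite repE// icmapK. Qed.

Lemma rep_smooth u (i : idx Ai) : smoothM u -> smooth_open (chart_image i) (rep u i).
Proof.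
move=> uM; apply: smooth_on_open; first exact: chart_image_open.
apply: smooth_on_sub (uM i tt 0) => x [p ip <-].
by exists p, (u p).
Qed.

Lemma smoothM_continuous u p : smoothM u -> (~` boundary A) p -> {for p, continuous u}.
Proof.
move=> uM pA; have [i0 ip0] := mf_cover mfd p; pose i : idx Ai := i0.
have ip : dom i p by split.
have : \forall q \near p, rep u i (cmap i q) = u q.
  have : \forall q \near p, dom i q by apply: open_nbhs_nbhs; split => //; exact: dom_open.
  by apply: filterS => q iq; rewrite repE.
move=> E; rewrite /prop_for /continuous_at -(repE u ip).
apply: (cvg_trans (@near_eq_cvg _ _ (nbhs p) _ _ _ E)).
apply: continuous_comp; first exact: cmap_continuous.
by apply: (smooth_open_continuous (rep_smooth uM)); exists p.
Qed.

Definition grad u (i : idx Ai) x : 'rV[R]_n.+1 := \row_k pderiv k (rep u i) x.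

Variable g : field2 Ai.
Hypothesis gm : is_metric g.

Lemma posdef_metric (i : idx Ai) x : chart_image i x -> posdef (g i x).
Proof. by move=> ix v v0; exact: (mt_pos gm ix v0). Qed.

Definition gradsq u (i : idx Ai) x := qf (invmx (g i x)) (grad u i x).

(** With J the Jacobian of the transition, the gradients satisfy grad_i = grad_j J^T and the inverse
    metrics g_i^-1 = J^-T g_j^-1 J^-1, so J cancels. This settles the choice of chart in
    [nabla_norm]. *)
Lemma gradsq_chart u (i j : idx Ai) p : smoothM u -> dom i p -> dom j p ->
  gradsq u i (cmap i p) = gradsq u j (cmap j p).
Proof.
move=> uM ip jp.
pose phi := @chart_expr R T T n.+1 n.+1 Ai Ai (fun p q => p = q) i j.
have phiE q : dom i q -> dom j q -> phi (cmap i q) = cmap j q.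
  move=> iq jq; apply: chart_exprE => // p' _ <- ip' _ E; congr (cmap j _).
  exact: cmap_injI E.
set x := cmap i p; set y := cmap j p.
have ix : chart_image i x by exists p.
have jy : chart_image j y by exists p.
have oV : open (cmap i @` (dom i `&` dom j)).
  by apply: cmap_open; [apply: openI; exact: dom_open|exact: subIsetl].
have Vx : (cmap i @` (dom i `&` dom j)) x by exists p.
have phiS l : smooth_open (cmap i @` (dom i `&` dom j)) (fun z => phi z 0 l).
  (* Smoothness is known for the transitions of [A], whose domains also contain boundary points;
     those of the interior atlas agree with them locally. *)
  pose phiA := @chart_expr R T T n.+1 n.+1 A A (fun p q => p = q) i j.
  have S : smooth_open (cmap i @` (dom i `&` dom j)) (fun z => phiA z 0 l).
    apply: smooth_on_open => //; apply: smooth_on_sub (mf_smooth mfd (i := i) (j := j) l).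
    by move=> z [q [[iq _] [jq _]] <-]; exists q, q.
  apply: smooth_open_near => z Vz; exists (fun z => phiA z 0 l).
    by apply: smooth_open_sub S => _ ->.
  apply: filterS (near_open oV Vz) => _ [q [iq jq] <-].
  by rewrite phiE// [phiA _](chart_transE mfd)//; [case: iq|case: jq].
have dr : differentiable (rep u j : _ -> R^o) (phi x).
  rewrite phiE//; apply: smooth_open_differentiable (@chart_image_open j) (rep_smooth uM) jy.
have gE : grad u i x = grad u j y *m (jac phi x)^T.
  apply/rowP => k; rewrite !mxE.
  have [_ C] := @pderiv_comp _ _ _ phi (rep u j) x k
     (fun m => smooth_open_derivable (i := k) (phiS m) Vx) dr.
  transitivity (pderiv k (rep u j \o phi) x).
    apply: near_eq_derive; apply: filterS (near_open oV Vx) => _ [q [iq jq] <-] /=.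
    by rewrite phiE// !repE.
  by rewrite C phiE//; apply: eq_bigr => l _; rewrite !mxE mulrC.
have tE : g i x = jac phi x *m g j y *m (jac phi x)^T.
  rewrite -[y](phiE p)//; apply: (mt_tensor gm (i := i) (j := j)).
  by exists p, p.
have ui := posdef_unit (posdef_metric ix); have uj := posdef_unit (posdef_metric jy).
have uJ : jac phi x \in unitmx.
  by move: ui; rewrite tE !unitmx_mul => /andP[/andP[]].
have uJT : (jac phi x)^T \in unitmx by rewrite unitmx_tr.
have iE : invmx (g i x) = invmx (jac phi x)^T *m invmx (g j y) *m invmx (jac phi x).
  apply: (@row_free_inj _ _ _ _ (g i x)); first by rewrite row_free_unit.
  by rewrite mulVmx// tE !mulmxA mulmxKV// mulmxKV// mulVmx.
rewrite /gradsq /qf gE iE trmx_mul trmxK !mulmxA mulmxK//.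
by rewrite -[_ *m invmx (jac phi x) *m _]mulmxA mulVmx// mulmx1.
Qed.

Lemma gradsq_ge0 u (i : idx Ai) p : dom i p -> 0 <= gradsq u i (cmap i p).
Proof.
move=> ip; have ix : chart_image i (cmap i p) by exists p.
have pd := posdef_metric ix; have sg := mt_sym gm ix.
rewrite /gradsq.
have -> : qf (invmx (g i (cmap i p))) (grad u i (cmap i p)) =
    qf (g i (cmap i p)) (grad u i (cmap i p) *m invmx (g i (cmap i p))).
  rewrite /qf mulmxKV ?posdef_unit// trmx_mul trmx_inv sg mulmxA //.
exact: posdef_ge0.
Qed.

Lemma nabla_norm0 u p : (~` boundary A) p -> nabla_norm g 0 u p = `|u p|.
Proof.
move=> pA; have [i0 ip0] := mf_cover mfd p; pose i : idx Ai := i0.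
have ip : dom i p by split.
have E (j : idx Ai) : dom j p ->
    tensor_norm (g j) 0 (fun (x : 'rV[R]_n.+1) _ => rep u j x) (cmap j p) = `|u p|.
  move=> jp; rewrite /tensor_norm.
  rewrite (big_pred1 [tuple]); last by move=> t; apply/esym/eqP; exact: tuple0.
  rewrite (big_pred1 [tuple]); last by move=> t; apply/esym/eqP; exact: tuple0.
  by rewrite big_ord0 mul1r repE// -expr2 sqrtr_sqr.
rewrite /nabla_norm; case: xgetP => [z _ [j jp ->]|/(_ `|u p|)[]]; first exact: E.
by exists i => //; rewrite -(E i ip).
Qed.

Lemma sum_tuple1 (F : 1.-tuple 'I_n.+1 -> R) : \sum_t F t = \sum_k F [tuple k].
Proof.
rewrite (reindex (fun k : 'I_n.+1 => [tuple k])) //=.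
exists (fun t => thead t) => [k _|t _] /=; first by rewrite theadE.
by apply: val_inj; case: t => -[|a [|]] //= _; rewrite /thead (tnth_nth a).
Qed.

Lemma nabla_norm1 u (i : idx Ai) p : smoothM u -> dom i p ->
  nabla_norm g 1 u p = Num.sqrt (gradsq u i (cmap i p)).
Proof.
move=> uM ip.
have E (j : idx Ai) : dom j p ->
    tensor_norm (g j) 1 (nabla (g j) (fun (x : 'rV[R]_n.+1) _ => rep u j x)) (cmap j p) =
    Num.sqrt (gradsq u j (cmap j p)).
  move=> jp; rewrite /tensor_norm; congr Num.sqrt.
  rewrite sum_tuple1 -[gradsq _ _ _]/(bf _ _ _) bfE; apply: eq_bigr => k _.
  rewrite sum_tuple1; apply: eq_bigr => l _.
  (* A function has no tensor indices, so the Christoffel sum is empty. *)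
  by rewrite big_ord1 /= !big_ord0 !subr0 !mxE.
rewrite /nabla_norm; case: xgetP => [z _ [j jp ->]|/(_ (Num.sqrt (gradsq u i (cmap i p))))[]].
  by rewrite [LHS]E// (gradsq_chart uM jp ip).
by exists i => //; rewrite -(E i ip).
Qed.

Lemma metric_continuous (i : idx Ai) x k l : chart_image i x ->
  {for x, continuous (fun z => g i z k l)}.
Proof.
move=> ix; apply: smooth_open_continuous _ ix.
by apply: smooth_on_open; [exact: chart_image_open|exact: mt_smooth gm i k l].
Qed.

Lemma invmetric_continuous (i : idx Ai) x k l : chart_image i x ->
  {for x, continuous (fun z => invmx (g i z) k l)}.
Proof.
move=> ix; apply: (@cvg_invmx _ _ (nbhs x) _ (g i) (g i x)).
- by move=> k' l'; exact: metric_continuous.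
- exact/posdef_unit/posdef_metric.
- have : \forall z \near x, g i z \in unitmx.
    have N := near_open (@chart_image_open i) ix.
    by apply: filterS N => z /posdef_metric /posdef_unit.
  by [].
Qed.

Lemma detmetric_continuous (i : idx Ai) x : chart_image i x ->
  {for x, continuous (fun z => \det (g i z))}.
Proof.
by move=> ix; apply: (@cvg_det _ _ (nbhs x)) => k l; exact: metric_continuous.
Qed.

Lemma gradsq_continuous u (i : idx Ai) x : smoothM u -> chart_image i x ->
  {for x, continuous (gradsq u i)}.
Proof.
move=> uM ix; rewrite /gradsq.
have -> : (fun z => qf (invmx (g i z)) (grad u i z)) =
   (fun z => \sum_k \sum_l invmx (g i z) k l * pderiv k (rep u i) z * pderiv l (rep u i) z).
  apply/funext => z; rewrite -[qf _ _]/(bf _ _ _) bfE.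
  by apply: eq_bigr => k _; apply: eq_bigr => l _; rewrite !mxE.
apply: (@cvg_sumr _ _ (nbhs x)) => k _; apply: (@cvg_sumr _ _ (nbhs x)) => l _.
have dc m : {for x, continuous (pderiv m (rep u i))}.
  exact: smooth_open_continuous (smooth_open_pderiv m (rep_smooth uM)) ix.
apply: cvgM; last exact: dc.
by apply: cvgM; [exact: invmetric_continuous|exact: dc].
Qed.

End InteriorAtlas.

(** * Volume and energy in charts *)

Lemma Bor_continuous_map (S T : ptopologicalType) (D : set S) (f : S -> T) :
  measurable (D : set (Bor S)) -> (forall x, D x -> {for x, continuous f}) ->
  measurable_fun (D : set (Bor S)) (f : Bor S -> Bor T).
Proof.
move=> mD cf; apply: (measurability (@open T : set (set (Bor T)))) => //.
move=> _ [V oV <-].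
rewrite (_ : _ `&` _ = (D : set (Bor S)) `&` (interior (f @^-1` V) : set (Bor S))).
  by apply: measurableI => //; apply: Bor_open; exact: open_interior.
apply/seteqP; split => x [Dx fx]; split => //.
  by apply: (cf _ Dx); apply: open_nbhs_nbhs; split.
exact: interior_subset fx.
Qed.

Lemma posdef_inv_ge0 (R : realType) n (M : 'M[R]_n) v :
  M^T = M -> posdef M -> 0 <= qf (invmx M) v.
Proof.
move=> sM pM; have -> : qf (invmx M) v = qf M (v *m invmx M).
  by rewrite /qf mulmxKV ?posdef_unit// trmx_mul trmx_inv sM mulmxA.
exact: posdef_ge0.
Qed.

Section ChartMeasure.
Variable R : realType.
Variables (T : ptopologicalType) (n : nat) (A : @atlas R T n.+1).
Hypothesis mfd : is_manifold (half_space R n) A.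
Notation Ai := (interior_atlas A).
Variable g : field2 Ai.
Hypothesis gm : is_metric g.
Variable mu : {measure set (Bor T) -> \bar R}.
Hypothesis vol : forall (i : idx Ai) (S : set (Bor T)), measurable S -> S `<=` dom i ->
  mu S = rVintegral (fun x => (Num.sqrt (\det (g i x)) * \1_(cmap i @` S) x)%:E).

(** On a compact set the entries of g and g^-1, the determinant and its inverse are bounded by
    continuity; [Lam] is 1 plus the sum of the resulting constants, so it serves for all four
    estimates. *)
Lemma chart_bounds (i : idx Ai) (K : set 'rV[R]_n.+1) : compact K -> K `<=` chart_image i ->
  exists2 Lam : R, 0 < Lam & forall x, K x ->
    [/\ Num.sqrt (\det (g i x)) <= Lam, 1 <= Lam * Num.sqrt (\det (g i x)),
        forall v : 'rV[R]_n.+1, \sum_k v 0 k ^+ 2 <= Lam * qf (invmx (g i x)) v &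
        forall v : 'rV[R]_n.+1, qf (invmx (g i x)) v <= Lam * \sum_k v 0 k ^+ 2].
Proof.
move=> cK Ki.
have Hb (h : 'rV[R]_n.+1 -> R) : (forall x, chart_image i x -> {for x, continuous h}) ->
    exists M : R, forall x, K x -> `|h x| <= M.
  by move=> ch; apply: compact_bound cK _ => x /Ki; exact: ch.
(* The sum of the absolute values of the entries is one continuous function dominating them all. *)
have Hm (h : 'rV[R]_n.+1 -> 'M[R]_n.+1) :
    (forall x k l, chart_image i x -> {for x, continuous (fun z => h z k l)}) ->
    exists M : R, forall x k l, K x -> `|h x k l| <= M.
  move=> ch; have [|M HM] := Hb (fun x => \sum_k \sum_l `|h x k l|).
    move=> x ix; apply: (@cvg_sumr _ _ (nbhs x)) => k _; apply: (@cvg_sumr _ _ (nbhs x)) => l _.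
    by apply: cvg_norm; exact: ch.
  exists M => x k l /HM; apply: le_trans; apply: le_trans _ (ler_norm _).
  rewrite (bigD1 k)//= (bigD1 l)//= -addrA lerDl addr_ge0 ?sumr_ge0// => m _.
  by rewrite sumr_ge0.
have [M1 HM1] : exists M : R, forall x k l, K x -> `|g i x k l| <= M.
  by apply: Hm => x k l ix; exact: metric_continuous ix.
have [M2 HM2] : exists M : R, forall x k l, K x -> `|invmx (g i x) k l| <= M.
  by apply: Hm => x k l ix; exact: invmetric_continuous ix.
have dp x : chart_image i x -> 0 < \det (g i x) by move=> ix; exact/posdef_det_gt0/(posdef_metric gm).
have [M3 HM3] : exists M : R, forall x, K x -> `|\det (g i x)| <= M.
  by apply: Hb => x ix; exact: detmetric_continuous ix.
have [M4 HM4] : exists M : R, forall x, K x -> `|(\det (g i x))^-1| <= M.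
  apply: Hb => x ix.
  apply: (@cvgV _ _ (nbhs x) _ (fun z => \det (g i z))); first exact: lt0r_neq0 (dp x ix).
  by have := @detmetric_continuous _ _ _ _ mfd _ gm _ _ ix; apply.
pose N : R := n.+1%:R.
pose Lam := 1 + N * `|M1| + N * `|M2| + Num.sqrt `|M3| + Num.sqrt `|M4|.
have a1 : 0 <= N * `|M1| by rewrite mulr_ge0.
have a2 : 0 <= N * `|M2| by rewrite mulr_ge0.
have a3 := sqrtr_ge0 `|M3|; have a4 := sqrtr_ge0 `|M4|.
exists Lam; first by rewrite /Lam; lra.
move=> x Kx; have ix := Ki _ Kx; have d0 := dp _ ix.
have sd0 : 0 < Num.sqrt (\det (g i x)) by rewrite sqrtr_gt0.
split.
- apply: (@le_trans _ _ (Num.sqrt `|M3|)); last by rewrite /Lam; lra.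
  rewrite ler_sqrt//; apply: le_trans (ler_norm _) (le_trans (HM3 _ Kx) (ler_norm _)).
- rewrite -ler_pdivrMr// div1r -(sqrtrV (ltW d0)).
  apply: (@le_trans _ _ (Num.sqrt `|M4|)); last by rewrite /Lam; lra.
  rewrite ler_sqrt//; apply: le_trans (ler_norm _) (le_trans (HM4 _ Kx) (ler_norm _)).
- move=> v.
  have q0 : 0 <= qf (invmx (g i x)) v.
    exact: (posdef_inv_ge0 v (mt_sym gm ix) (posdef_metric gm ix)).
  apply: le_trans (@posdef_inv_ge _ _ _ `|M1| v (mt_sym gm ix) (posdef_metric gm ix) _) _.
    by move=> k l; exact: le_trans (HM1 x k l Kx) (ler_norm _).
  by rewrite ler_wpM2r// /Lam; lra.
- move=> v; have S0 : 0 <= \sum_k v 0 k ^+ 2 by apply: sumr_ge0 => k _; exact: sqr_ge0.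
  apply: le_trans (@bf_le _ _ _ `|M2| _ v) _.
    by move=> k l; exact: le_trans (HM2 x k l Kx) (ler_norm _).
  by rewrite ler_wpM2r// /Lam; lra.
Qed.

Definition chart_part (i : idx Ai) (D : set (BrV R n.+1)) : set (Bor T) :=
  dom i `&` cmap i @^-1` D.

Lemma measurable_chart_part (i : idx Ai) D : measurable D -> measurable (chart_part i D).
Proof.
move=> mD; have mi : measurable (dom i : set (Bor T)) by apply: Bor_open; exact: dom_open mfd i.
have := @Bor_continuous_map T 'rV[R]_n.+1 (dom i) (cmap i) mi
  (fun p ip => cmap_continuous mfd ip).
by move=> /(_ mi D mD).
Qed.

Lemma measurable_volume_density (i : idx Ai) (S : set (BrV R n.+1)) :
  measurable S -> S `<=` chart_image i ->
  measurable_fun S (fun x : BrV R n.+1 => Num.sqrt (\det (g i x))).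
Proof.
move=> mS Si; apply: (@Bor_continuous_fun R 'rV[R]_n.+1) => // x /Si ix.
apply: continuous_comp; last exact: sqrt_continuous.
by have := @detmetric_continuous _ _ _ _ mfd _ gm _ _ ix; apply.
Qed.

Lemma chart_measure (i : idx Ai) (S : set (BrV R n.+1)) : measurable S -> S `<=` chart_image i ->
  mu (chart_part i S) = (\int[lam R n.+1]_(x in S) (Num.sqrt (\det (g i x)))%:E)%E.
Proof.
move=> mS Si.
rewrite (vol (i := i)); [|exact: measurable_chart_part|by move=> p []].
have -> : cmap i @` chart_part i S = S.
  apply/seteqP; split => x; first by move=> [p [_ Sp] <-].
  by move=> Sx; have [ip E] := cmapK mfd (Si _ Sx); exists (icmap i x) => //; split => //=; rewrite E.
have E : (fun x => (Num.sqrt (\det (g i x)) * \1_S x)%:E) =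
    (fun x : BrV R n.+1 => (Num.sqrt (\det (g i x)))%:E) \_ S.
  apply/funext => x; rewrite patchE indicE; case: ifP => _; first by rewrite mulr1.
  by rewrite mulr0.
rewrite E -lamE -?integral_mkcond//.
  have /measurable_EFinP ms := measurable_volume_density mS Si.
  exact: (measurable_restrictT _ mS).1 ms.
by move=> x; rewrite patchE; case: ifP => // _; rewrite lee_fin sqrtr_ge0.
Qed.

End ChartMeasure.

Section ChartIntegral.
Variable R : realType.
Variables (T : ptopologicalType) (n : nat) (A : @atlas R T n.+1).
Hypothesis mfd : is_manifold (half_space R n) A.
Notation Ai := (interior_atlas A).
Variable g : field2 Ai.
Hypothesis gm : is_metric g.
Variable mu : {measure set (Bor T) -> \bar R}.
Hypothesis vol : forall (i : idx Ai) (S : set (Bor T)), measurable S -> S `<=` dom i ->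
  mu S = rVintegral (fun x => (Num.sqrt (\det (g i x)) * \1_(cmap i @` S) x)%:E).

(* Points outside the chart are sent to x1, which lies outside Q. *)
Lemma chart_transport (i : idx Ai) (Q : set (BrV R n.+1)) (x1 : BrV R n.+1) :
  measurable Q -> ~ Q x1 ->
  exists nu : {measure set (BrV R n.+1) -> \bar R},
    (forall S, measurable S -> S `<=` Q -> nu S = mu (chart_part i S)) /\
    (forall D (F : BrV R n.+1 -> \bar R), measurable D -> D `<=` Q -> measurable_fun D F ->
      (forall x, D x -> (0 <= F x)%E) ->
      (\int[mu]_(p in chart_part i D) F (cmap i p) = \int[nu]_(x in D) F x)%E).
Proof.
move=> mQ Qx1.
pose P := chart_part i Q.
have mP : measurable P by exact: measurable_chart_part.
pose cm (p : Bor T) : BrV R n.+1 := if p \in P then cmap i p else x1.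
have cmE S : S `<=` Q -> cm @^-1` S = chart_part i S.
  move=> SQ; apply/seteqP; split => p; rewrite /preimage /cm /=.
    case: ifPn => [/set_mem [ip Qp] Sp|_ Sx1]; first by split.
    by case: Qx1; exact: SQ.
  by move=> [ip Sp]; rewrite ifT//; apply/mem_set; split => //; exact: SQ.
have mcm : measurable_fun setT cm.
  move=> _ S mS; rewrite setTI.
  have -> : cm @^-1` S = cm @^-1` (S `&` Q) `|` cm @^-1` (S `\` Q).
    by rewrite -preimage_setU setUIDK.
  apply: measurableU; first by rewrite cmE; [apply: (measurable_chart_part mfd); exact: measurableI|exact: subIsetr].
  (* What lies in S outside Q is hit only at x1, so its preimage is the complement of [P] or
     empty. *)
  have [Sx1|Sx1] := pselect (S x1).
    rewrite (_ : _ @^-1` _ = ~` P); first exact: measurableC.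
    apply/seteqP; split => p; rewrite /preimage /cm /=.
      by case: ifPn => [/set_mem [ip Qp] [_ /(_ Qp)]//|/negP nP _ /mem_set].
    by move=> Pp; rewrite ifF//; apply/negP => /set_mem.
  rewrite (_ : _ @^-1` _ = set0)//; apply/seteqP; split => p //; rewrite /preimage /cm /=.
  by case: ifPn => [/set_mem [ip Qp] [_ /(_ Qp)]//|_ []].
exists (measure_function_pushforward__canonical__measure_function_Measure mu mcm); split => [S mS SQ|D F mD DQ mF F0].
  by rewrite -cmE//.
rewrite (ge0_integral_pushforward mcm)//; last by move=> y /set_mem; exact: F0.
rewrite cmE//; apply: eq_integral => p /set_mem [ip Dp] /=.
by rewrite /cm ifT//; apply/mem_set; split => //; exact: DQ.
Qed.

Lemma rep_lin (u v : T -> R) (a : R) (i : idx Ai) x : chart_image i x ->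
  rep (fun p => a * u p + v p) i x = a * rep u i x + rep v i x.
Proof. by move=> ix; rewrite !(rep_icmap mfd). Qed.

Lemma smoothM_lin (u v : T -> R) (a : R) : smoothM A u -> smoothM A v ->
  smoothM A (fun p => a * u p + v p).
Proof.
move=> su sv i j l x [p [q [_ ip _ <-]]].
exists (chart_image (i : idx Ai)), (fun x => a * rep u i x + rep v i x); split.
- exact: chart_image_open.
- by exists p.
- by apply: smooth_openD; [exact: chart_image_open|exact: (rep_smooth mfd)|exact: (rep_smooth mfd)].
- move=> y [_ iy]; rewrite -rep_lin// /rep.
  by rewrite (ord1 l); case: j.
Qed.

(** Once transported to the cube, the volume has density sqrt(det g) between 1 / Lam and Lam, and
    comparing measures of sets is enough to compare integrals. *)
Lemma chart_compare (i : idx Ai) (c : 'rV[R]_n.+1) (L : R) : ccube c L `<=` chart_image i ->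
  exists Lam : R, [/\ 0 < Lam,
    forall x, cube c L x -> forall v : 'rV[R]_n.+1,
      \sum_k v 0 k ^+ 2 <= Lam * qf (invmx (g i x)) v /\
      qf (invmx (g i x)) v <= Lam * \sum_k v 0 k ^+ 2 &
    forall (D : set (BrV R n.+1)) (F : BrV R n.+1 -> \bar R), measurable D -> D `<=` cube c L ->
      measurable_fun D F -> (forall x, D x -> (0 <= F x)%E) ->
      ((\int[mu]_(p in chart_part i D) F (cmap i p) <= Lam%:E * \int[lam R n.+1]_(x in D) F x) /\
       (\int[lam R n.+1]_(x in D) F x <= Lam%:E * \int[mu]_(p in chart_part i D) F (cmap i p)))%E].
Proof.
move=> Ki; have [Lam L0 H] := chart_bounds mfd gm (@compact_ccube _ _ c L) Ki.
have Qi : cube c L `<=` chart_image i by move=> x /cube_ccube /Ki.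
exists Lam; split => // [x /cube_ccube /H [_ _ H1 H2] v|D F mD DQ mF F0]; first by split.
(* The far corner is missing from the half-open cube, so it can receive the rest of the manifold. *)
have x1Q : ~ cube c L (\row_k (c 0 k + L)).
  by move=> /(_ ord0); rewrite mxE ltxx andbF.
have [nu [nuE tr]] := chart_transport i (@measurable_cube _ _ c L) x1Q.
have mS S : measurable S -> S `<=` cube c L ->
    measurable_fun S (fun x : BrV R n.+1 => (Num.sqrt (\det (g i x)))%:E).
  move=> mS SQ; apply/measurable_EFinP.
  exact: (measurable_volume_density mfd gm mS (subset_trans SQ Qi)).
rewrite tr//; split; apply: le_measure_integral => //; try exact: ltW.
- move=> S mS' SD; have SQ := subset_trans SD DQ.
  rewrite nuE// (chart_measure mfd gm vol)//; last exact: subset_trans SQ Qi.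
  rewrite -integral_cst//; apply: ge0_le_integral => //.
  + exact: mS.
  + by move=> x /SQ /cube_ccube /H [Hx _ _ _]; rewrite lee_fin.
- move=> S mS' SD; have SQ := subset_trans SD DQ.
  rewrite nuE// (chart_measure mfd gm vol)//; last exact: subset_trans SQ Qi.
  rewrite -[leLHS]mul1e -integral_cst// -ge0_integralZl//.
  + apply: ge0_le_integral => //.
    * by apply: measurable_funeM; exact: mS.
    * by move=> x /SQ /cube_ccube /H [_ Hx _ _]; rewrite -EFinM lee_fin.
  + exact: mS.
  + by rewrite lee_fin ltW.
Qed.

End ChartIntegral.

Lemma bmeas_subset d (T : measurableType d) (R : realType) (D D' : set T) (f : T -> R) :
  measurable D' -> D `<=` D' -> bmeas D' f -> bmeas D f.
Proof.
move=> mD DD [mf [M fM]]; split; first exact: measurable_funS mD DD mf.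
by exists M => x /DD; exact: fM.
Qed.

(** * Rellich's lemma and closability near an interior point *)

Section LocalEstimates.
Variable R : realType.
Variables (T : ptopologicalType) (n : nat) (A : @atlas R T n.+1).
Hypothesis mfd : is_manifold (half_space R n) A.
Notation Ai := (interior_atlas A).
Notation IM := (~` boundary A).
Variable g : field2 Ai.
Hypothesis gm : is_metric g.

Definition gradN (u : T -> R) p := nabla_norm g 1 u p ^+ 2.

Lemma gradNE u (i : idx Ai) p : smoothM A u -> dom i p -> gradN u p = gradsq g u i (cmap i p).
Proof.
move=> su ip; rewrite /gradN (nabla_norm1 mfd gm su ip) sqr_sqrtr//.
exact: gradsq_ge0.
Qed.

Lemma interior_chart p : IM p -> exists i : idx Ai, dom i p.
Proof. by move=> pA; have [i0 ip0] := mf_cover mfd p; exists i0; split. Qed.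

Lemma gradN_continuous u p : smoothM A u -> IM p -> {for p, continuous (gradN u)}.
Proof.
move=> su /interior_chart[i ip].
have E : \forall q \near p, gradsq g u i (cmap i q) = gradN u q.
  have : \forall q \near p, dom i q by apply: open_nbhs_nbhs; split => //; exact: (dom_open mfd).
  by apply: filterS => q iq; rewrite -gradNE.
rewrite /prop_for /continuous_at (gradNE su ip).
apply: (cvg_trans (@near_eq_cvg _ _ (nbhs p) _ _ _ E)).
apply: continuous_comp; first exact: (cmap_continuous mfd).
by have := @gradsq_continuous _ _ _ _ mfd _ gm u i (cmap i p) su; apply; exists p.
Qed.

Lemma interior_measurable : measurable (IM : set (Bor T)).
Proof. by apply: Bor_open; exact: (interior_open mfd). Qed.

Lemma measurable_gradN u : smoothM A u -> measurable_fun (IM : set (Bor T)) (gradN u).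
Proof.
move=> su; apply: Bor_continuous_fun; first exact: interior_measurable.
by move=> p; exact: gradN_continuous.
Qed.

Lemma measurable_smoothM u : smoothM A u -> measurable_fun (IM : set (Bor T)) u.
Proof.
move=> su; apply: Bor_continuous_fun; first exact: interior_measurable.
by move=> p; exact: (smoothM_continuous mfd).
Qed.

(** The middle half in every direction, where the cutoff of [closable_cube] is bounded below for all
    k simultaneously. *)
Definition inner_cube (c : 'rV[R]_n.+1) (L : R) : set (BrV R n.+1) :=
  ccube (\row_k (c 0 k + L / 4)) (L / 2).

Lemma inner_cubeE c L x : inner_cube c L x <->
  forall k, c 0 k + L / 4 <= x 0 k <= c 0 k + 3 * L / 4.
Proof.
by split => H k; move: (H k); rewrite mxE => /andP[H1 H2]; apply/andP; split; lra.
Qed.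

Lemma inner_cube_sub c L : 0 < L -> inner_cube c L `<=` cube c L.
Proof.
by move=> L0 x /inner_cubeE H k; have /andP[H1 H2] := H k; apply/andP; split; lra.
Qed.

Lemma measurable_inner_cube c L : measurable (inner_cube c L).
Proof.
apply: Bor_closed; apply: compact_closed; last exact: compact_ccube.
exact: norm_hausdorff.
Qed.

Lemma local_cube p : IM p -> exists (i : idx Ai) c (L : R),
  [/\ 0 < L, ccube c L `<=` chart_image i & nbhs p (chart_part i (inner_cube c L))].
Proof.
move=> /interior_chart[i ip]; pose x := cmap i p.
have : nbhs x (chart_image i) by apply: near_open; [exact: chart_image_open|exists p].
(* Balls of the sup norm are cubes: this cube is centred at x, inside the ball of radius r, and its
   middle half contains the ball of radius r / 4. *)
move=> /nbhs_ballP[r /= r0 H]; exists i, (\row_k (x 0 k - r / 2)), r; split => //.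
  move=> y cy; apply: H; split => // a k; rewrite (ord1 a) /ball /= .
  have := cy k; rewrite mxE => /andP[c1 c2].
  by rewrite ltr_norml; apply/andP; split; lra.
have Nx : nbhs x (inner_cube (\row_k (x 0 k - r / 2)) r).
  apply/nbhs_ballP; exists (r / 4); first by rewrite /= divr_gt0.
  move=> y [_ /(_ 0) by_]; apply/inner_cubeE => k; have := by_ k; rewrite mxE /ball /=.
  by rewrite ltr_norml => /andP[c1 c2]; apply/andP; split; lra.
apply: filterI.
  by apply: open_nbhs_nbhs; split => //; exact: (dom_open mfd).
exact: (cmap_continuous mfd ip Nx).
Qed.

Variable mu : {measure set (Bor T) -> \bar R}.
Hypothesis vol : forall (i : idx Ai) (S : set (Bor T)), measurable S -> S `<=` dom i ->
  mu S = rVintegral (fun x => (Num.sqrt (\det (g i x)) * \1_(cmap i @` S) x)%:E).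

Lemma chart_energy (i : idx Ai) c L : ccube c L `<=` chart_image i -> 0 < L ->
  exists L1 L2 : R, [/\ 0 < L1, 0 < L2 & forall u D, smoothM A u -> measurable D ->
    D `<=` cube c L ->
  [/\ ((\int[lam R n.+1]_(x in D) (rep u i x ^+ 2))%R%:E <=
         L1%:E * \int[mu]_(p in chart_part i D) (u p ^+ 2)%:E)%E,
      (\int[mu]_(p in chart_part i D) (u p ^+ 2)%:E <=
        L1%:E * (\int[lam R n.+1]_(x in D) (rep u i x ^+ 2))%R%:E)%E,
      forall k, ((\int[lam R n.+1]_(x in D) (pderiv k (rep u i) x ^+ 2))%R%:E <=
         L2%:E * \int[mu]_(p in chart_part i D) (gradN u p)%:E)%E &
      (\int[mu]_(p in chart_part i D) (gradN u p)%:E <=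
        L2%:E * (\sum_k \int[lam R n.+1]_(x in D) (pderiv k (rep u i) x ^+ 2))%R%:E)%E]].
Proof.
move=> Ki L0; have [Lam [Lam0 Hq Hc]] := chart_compare mfd gm vol Ki.
(* For gradients one factor comes from the volume and one from the metric on covectors. *)
exists Lam, (Lam * Lam); split => //; first by rewrite mulr_gt0.
move=> u D su mD DQ.
have mQ : measurable (cube c L) := @measurable_cube _ _ _ _.
have fD : (lam R n.+1 D < +oo)%E.
  by apply: le_lt_trans (lam_cube_fin c (ltW L0)); apply: le_measure => //; rewrite inE.
have uC : C1on (ccube c L) (rep u i).
  by apply: C1on_sub Ki (smooth_C1on (rep_smooth mfd su)).
have bu : bmeas D (rep u i) by apply: (bmeas_subset mQ DQ); exact: C1on_bmeas.
have bd k : bmeas D (pderiv k (rep u i)) by apply: (bmeas_subset mQ DQ); exact: C1on_bmeas_pderiv.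
have mg : measurable_fun D (gradsq g u i).
  apply: (@Bor_continuous_fun R 'rV[R]_n.+1) => // x /DQ /cube_ccube /Ki ix.
  by have := @gradsq_continuous _ _ _ _ mfd _ gm u i x su; apply.
have uE : (\int[mu]_(p in chart_part i D) (u p ^+ 2)%:E =
    \int[mu]_(p in chart_part i D) (rep u i (cmap i p) ^+ 2)%:E)%E.
  by apply: eq_integral => p /set_mem [ip _]; rewrite (repE mfd).
have gE : (\int[mu]_(p in chart_part i D) (gradN u p)%:E =
    \int[mu]_(p in chart_part i D) (gradsq g u i (cmap i p))%:E)%E.
  by apply: eq_integral => p /set_mem [ip _]; rewrite (gradNE su ip).
have gp x : D x -> 0 <= gradsq g u i x.
  move=> /DQ /cube_ccube /Ki [p ip <-]; exact: gradsq_ge0.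
have mu2 : measurable_fun D (fun x => (rep u i x ^+ 2)%:E).
  by have /measurable_EFinP := (bmeas_sqr bu).1.
have md2 k : measurable_fun D (fun x => (pderiv k (rep u i) x ^+ 2)%:E).
  by have /measurable_EFinP := (bmeas_sqr (bd k)).1.
have /measurable_EFinP mge := mg.
have [C1 C2] := Hc D (fun x => (rep u i x ^+ 2)%:E) mD DQ mu2 (fun x _ => sqr_ge0 _).
have [D1 D2] := Hc D (EFin \o gradsq g u i) mD DQ mge gp.
have gradE x k : grad u i x 0 k = pderiv k (rep u i) x by rewrite mxE.
have bs : bmeas D (fun x => \sum_k pderiv k (rep u i) x ^+ 2).
  by apply: bmeas_sum => k; exact: bmeas_sqr.
split.
- by rewrite -(Rint_EFin mD fD (bmeas_sqr bu)) uE.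
- by rewrite -(Rint_EFin mD fD (bmeas_sqr bu)) uE.
- move=> k; rewrite -(Rint_EFin mD fD (bmeas_sqr (bd k))) gE EFinM -muleA.
  apply: (@le_trans _ _ (Lam%:E * \int[lam R n.+1]_(x in D) (gradsq g u i x)%:E)%E); last first.
    by apply: lee_wpmul2l D2; rewrite lee_fin ltW.
  rewrite -ge0_integralZl//; last by rewrite lee_fin ltW.
  apply: ge0_le_integral => //.
  + by move=> x _; rewrite lee_fin sqr_ge0.
  + exact: measurable_funeM.
  + move=> x Dx; rewrite -EFinM lee_fin.
    have [H _] := Hq x (DQ _ Dx) (grad u i x); apply: le_trans H.
    by rewrite (bigD1 k)//= gradE lerDl sumr_ge0// => l _; exact: sqr_ge0.
- rewrite gE; apply: le_trans D1 _; rewrite EFinM -muleA.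
  apply: lee_wpmul2l; first by rewrite lee_fin ltW.
  rewrite -(Rint_sum mD fD)//; last by move=> k; exact: bmeas_sqr.
  rewrite -(Rint_EFin mD fD bs).
  have /measurable_EFinP msum := bs.1.
  rewrite -ge0_integralZl//; first last.
  + by rewrite lee_fin ltW.
  + by move=> x _; rewrite lee_fin sumr_ge0// => k _; exact: sqr_ge0.
  apply: ge0_le_integral => //.
  + exact: measurable_funeM.
  + move=> x Dx; rewrite -EFinM lee_fin.
    have [_ H] := Hq x (DQ _ Dx) (grad u i x); apply: le_trans H _.
    by under eq_bigr do rewrite gradE.
Qed.

Notation fulL2 u := (\int[mu]_(p in IM : set (Bor T)) (u p ^+ 2)%:E)%E.
Notation fulE u := (\int[mu]_(p in IM : set (Bor T)) (gradN u p)%:E)%E.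

(** The hypotheses bound integrals over the whole interior and only the conclusion refers to [N], so
    the property passes to finite unions; likewise for [closable_on]. *)
Definition rellich_on (N : set (Bor T)) :=
  forall (u : nat -> T -> R) (C : R) (U : set_system nat) (e : R),
    (forall m, smoothM A (u m)) -> (forall m, (fulL2 (u m) <= C%:E)%E) ->
    (forall m, (fulE (u m) <= C%:E)%E) -> UltraFilter U -> 0 < e ->
    exists2 B, U B & forall m m', B m -> B m' ->
      (\int[mu]_(q in N) ((u m q - u m' q) ^+ 2)%:E <= e%:E)%E.

Definition closable_on (N : set (Bor T)) :=
  forall (u : nat -> T -> R), (forall m, smoothM A (u m)) ->
    (forall e : R, 0 < e -> exists K, forall m l, (K <= m)%N -> (K <= l)%N ->
      (fulE (fun q => u m q - u l q) <= e%:E)%E) ->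
    (forall e : R, 0 < e -> exists K, forall m, (K <= m)%N -> (fulL2 (u m) <= e%:E)%E) ->
    forall e : R, 0 < e -> exists K, forall m, (K <= m)%N ->
      (\int[mu]_(q in N) (gradN (u m) q)%:E <= e%:E)%E.

Lemma chart_part_interior (i : idx Ai) D : chart_part i D `<=` (IM : set (Bor T)).
Proof. by move=> p [[]]. Qed.

Lemma le_interior_integral (i : idx Ai) D (F : T -> R) : measurable D ->
  (forall p, IM p -> 0 <= F p) -> measurable_fun (IM : set (Bor T)) F ->
  (\int[mu]_(q in chart_part i D) (F q)%:E <= \int[mu]_(q in IM : set (Bor T)) (F q)%:E)%E.
Proof.
move=> mD F0 mF; apply: ge0_subset_integral => //.
- exact: (measurable_chart_part mfd i mD).
- exact: interior_measurable.
- exact/measurable_EFinP.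
- exact: chart_part_interior.
Qed.

Lemma smoothMB (u v : T -> R) : smoothM A u -> smoothM A v -> smoothM A (fun q => u q - v q).
Proof.
move=> su sv; have := @smoothM_lin _ _ _ _ mfd _ _ (-1) sv su.
by congr smoothM; apply/funext => q; rewrite mulN1r addrC.
Qed.

Lemma repB (u v : T -> R) (i : idx Ai) x : chart_image i x ->
  rep (fun q => u q - v q) i x = rep u i x - rep v i x.
Proof. by move=> ix; rewrite !(rep_icmap mfd). Qed.

Lemma pderiv_repB (u v : T -> R) (i : idx Ai) k x : smoothM A u -> smoothM A v ->
  chart_image i x ->
  pderiv k (rep (fun q => u q - v q) i) x = pderiv k (rep u i) x - pderiv k (rep v i) x.
Proof.
move=> su sv ix; transitivity (pderiv k (fun z => rep u i z - rep v i z) x).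
  apply: near_eq_derive; apply: filterS (near_open (@chart_image_open _ _ _ _ mfd i) ix) => z.
  exact: repB.
apply: deriveB.
  exact: (smooth_open_derivable (rep_smooth mfd su) ix).
exact: (smooth_open_derivable (rep_smooth mfd sv) ix).
Qed.

Lemma gradN_ge0 u p : 0 <= gradN u p.
Proof. exact: sqr_ge0. Qed.

Lemma local_rellich p : IM p -> exists N : set (Bor T), [/\ measurable N, nbhs (p : T) N, N `<=` IM & rellich_on N].
Proof.
move=> /local_cube[i [c [L [L0 Ki Np]]]].
have [L1 [L2 [L10 L20 H]]] := chart_energy Ki L0.
have mN := measurable_chart_part mfd i (measurable_inner_cube c L).
exists (chart_part i (inner_cube c L)); split => //; first exact: chart_part_interior.
move=> u C U e su uC gC UU e0.
have mQ : measurable (cube c L) := @measurable_cube _ _ _ _.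
have [||B UB HB] := @rellich_cube R n.+1 c L (chart_image i) (fun m => rep (u m) i)
  (Num.max (L1 * C) (L2 * C)) U (e / L1) L0 (@chart_image_open _ _ _ _ mfd i) Ki
  (fun m => smooth_C1on (rep_smooth mfd (su m))) _ _ UU (divr_gt0 e0 L10).
- move=> m; rewrite -lee_fin; have [H1 _ _ _] := H _ _ (su m) mQ (fun x h => h).
  apply: le_trans H1 _; apply: (@le_trans _ _ (L1 * C)%:E); last by rewrite lee_fin le_max lexx.
  rewrite EFinM lee_wpmul2l//; first by rewrite lee_fin ltW.
  apply: le_trans (uC m); apply: le_interior_integral => // [q _|]; first exact: sqr_ge0.
  exact: measurable_funM (measurable_smoothM (su m)) (measurable_smoothM (su m)).
- move=> m k; rewrite -lee_fin; have [_ _ H1 _] := H _ _ (su m) mQ (fun x h => h).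
  apply: le_trans (H1 k) _; apply: (@le_trans _ _ (L2 * C)%:E); last by rewrite lee_fin le_max lexx orbT.
  rewrite EFinM lee_wpmul2l//; first by rewrite lee_fin ltW.
  apply: le_trans (gC m); apply: le_interior_integral => // [q _|]; first exact: gradN_ge0.
  exact: measurable_gradN.
exists B => // m m' Bm Bm'; have swm := smoothMB (su m) (su m').
have [_ H2 _ _] := H _ _ swm (measurable_inner_cube c L) (@inner_cube_sub _ _ L0).
apply: le_trans H2 _; rewrite -[e](divfK (lt0r_neq0 L10)) mulrC EFinM.
apply: lee_wpmul2l; first by rewrite lee_fin ltW.
rewrite lee_fin; apply: le_trans (HB m m' Bm Bm').
have E x : cube c L x -> rep (fun q => u m q - u m' q) i x = rep (u m) i x - rep (u m') i x.
  by move=> /cube_ccube /Ki; exact: repB.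
rewrite (@eq_Rintegral _ _ _ _ (cube c L) (fun x => rep (fun q => u m q - u m' q) i x ^+ 2));
  last by move=> x /set_mem /E ->.
apply: subset_Rint_ge0 => //.
- exact: measurable_inner_cube.
- exact: lam_cube_fin (ltW L0).
- exact: inner_cube_sub.
- by apply/bmeas_sqr/C1on_bmeas/(C1on_sub Ki)/smooth_C1on/(rep_smooth mfd).
- by move=> x _; exact: sqr_ge0.
Qed.

Lemma local_closable p : IM p -> exists N : set (Bor T), [/\ measurable N, nbhs (p : T) N, N `<=` IM & closable_on N].
Proof.
move=> /local_cube[i [c [L [L0 Ki Np]]]].
have [L1 [L2 [L10 L20 H]]] := chart_energy Ki L0.
have mN := measurable_chart_part mfd i (measurable_inner_cube c L).
exists (chart_part i (inner_cube c L)); split => //; first exact: chart_part_interior.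
move=> u su gC uC e e0.
have mQ : measurable (cube c L) := @measurable_cube _ _ _ _.
have hg k : forall e : R, 0 < e -> exists N, forall m l, (N <= m)%N -> (N <= l)%N ->
     \int[lam R n.+1]_(x in cube c L)
       ((pderiv k (rep (u m) i) x - pderiv k (rep (u l) i) x) ^+ 2) <= e.
  move=> d d0; have [K HK] := gC _ (divr_gt0 d0 L20); exists K => m l Km Kl.
  have swm := smoothMB (su m) (su l).
  rewrite (@eq_Rintegral _ _ _ _ (cube c L)
     (fun x => pderiv k (rep (fun q => u m q - u l q) i) x ^+ 2)); last first.
    by move=> x /set_mem /cube_ccube /Ki ix; rewrite pderiv_repB.
  rewrite -lee_fin; have [_ _ H1 _] := H _ _ swm mQ (fun x h => h).
  apply: le_trans (H1 k) _; rewrite -[d](divfK (lt0r_neq0 L20)) mulrC EFinM.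
  apply: lee_wpmul2l; first by rewrite lee_fin ltW.
  apply: le_trans (HK m l Km Kl); apply: le_interior_integral => // [q _|]; first exact: gradN_ge0.
  exact: measurable_gradN.
have hu : forall e : R, 0 < e -> exists N, forall m, (N <= m)%N ->
     \int[lam R n.+1]_(x in cube c L) (rep (u m) i x ^+ 2) <= e.
  move=> d d0; have [K HK] := uC _ (divr_gt0 d0 L10); exists K => m Km.
  rewrite -lee_fin; have [H1 _ _ _] := H _ _ (su m) mQ (fun x h => h).
  apply: le_trans H1 _; rewrite -[d](divfK (lt0r_neq0 L10)) mulrC EFinM.
  apply: lee_wpmul2l; first by rewrite lee_fin ltW.
  apply: le_trans (HK m Km); apply: le_interior_integral => // [q _|]; first exact: sqr_ge0.
  exact: measurable_funM (measurable_smoothM (su m)) (measurable_smoothM (su m)).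
(* Shared among the n + 1 directions, after removing the chart constant. *)
pose d := e / L2 / n.+1%:R.
have d0 : 0 < d by rewrite !divr_gt0.
have hk k : exists K, forall m, (K <= m)%N ->
    \int[lam R n.+1]_(x in inner_cube c L) (pderiv k (rep (u m) i) x ^+ 2) <= d.
  apply: (closable_cube L0 (@chart_image_open _ _ _ _ mfd i) Ki (fun m => rep_smooth mfd (su m))
    (hg k) hu (measurable_inner_cube c L) (inner_cube_sub L0) _ d0).
  by move=> x /inner_cubeE.
have [K HK] := choice hk.
exists (\max_k K k)%N => m Km.
have [_ _ _ H4] := H _ _ (su m) (measurable_inner_cube c L) (inner_cube_sub L0).
apply: le_trans H4 _; rewrite -[e](divfK (lt0r_neq0 L20)) mulrC EFinM.
apply: lee_wpmul2l; first by rewrite lee_fin ltW.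
rewrite lee_fin; apply: (@le_trans _ _ (\sum_(k < n.+1) d)).
  apply: ler_sum => k _; apply: HK; apply: leq_trans Km.
  exact: (@leq_bigmax _ (fun k => K k)).
by rewrite sumr_const card_ord -[leLHS]mulr_natr divfK.
Qed.

End LocalEstimates.

(** * Square-integrable functions *)

Section L2.
Context d (T : measurableType d) (R : realType) (mu : {measure set T -> \bar R}).
Implicit Types f h : T -> R.

Definition sqint f : \bar R := (\int[mu]_x (f x ^+ 2)%:E)%E.

Lemma measurable_sqr_EFin f : measurable_fun setT f ->
  measurable_fun setT (fun x => (f x ^+ 2)%:E).
Proof.
move=> mf; have /measurable_EFinP : measurable_fun setT (fun x => f x ^+ 2).
  exact: (measurable_funM mf mf).
by [].
Qed.

Lemma le_sqint f h : measurable_fun setT f -> measurable_fun setT h ->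
  (forall x, `|f x| <= `|h x|) -> (sqint f <= sqint h)%E.
Proof.
move=> mf mh fh; apply: ge0_le_integral => //.
- by move=> x _; rewrite lee_fin sqr_ge0.
- exact: measurable_sqr_EFin.
- exact: measurable_sqr_EFin.
- by move=> x _; rewrite lee_fin -[f x ^+ 2]ger0_norm ?sqr_ge0// -[h x ^+ 2]ger0_norm ?sqr_ge0// !normrX lerXn2r// nnegrE.
Qed.

Lemma sqint_ae f h : measurable_fun setT f -> measurable_fun setT h ->
  {ae mu, forall x, f x = h x} -> sqint f = sqint h.
Proof.
move=> mf mh fh; apply: ge0_ae_eq_integral => //.
- exact: measurable_sqr_EFin.
- exact: measurable_sqr_EFin.
- by move=> x _; rewrite lee_fin sqr_ge0.
- by move=> x _; rewrite lee_fin sqr_ge0.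
- by apply: filterS fh => x /= -> _.
Qed.

Lemma sqintD f h : measurable_fun setT f -> measurable_fun setT h ->
  (sqint (fun x => (f x + h x)%R) <= 2%:E * sqint f + 2%:E * sqint h)%E.
Proof.
move=> mf mh; rewrite -!ge0_integralZl//; try exact: measurable_sqr_EFin;
  try by move=> x _; rewrite lee_fin sqr_ge0.
rewrite -ge0_integralD//.
- apply: ge0_le_integral => //.
  + by move=> x _; rewrite lee_fin sqr_ge0.
  + by apply: measurable_sqr_EFin; exact: measurable_funD.
  + by apply: emeasurable_funD; apply: measurable_funeM; exact: measurable_sqr_EFin.
  + move=> x _; rewrite -!EFinM -EFinD lee_fin.
    have : 0 <= (f x - h x) ^+ 2 by exact: sqr_ge0.
    nra.
- by move=> x _; rewrite -EFinM lee_fin mulr_ge0// sqr_ge0.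
- by apply: measurable_funeM; exact: measurable_sqr_EFin.
- by move=> x _; rewrite -EFinM lee_fin mulr_ge0// sqr_ge0.
- by apply: measurable_funeM; exact: measurable_sqr_EFin.
Qed.

Lemma sqint0_ae f : measurable_fun setT f -> sqint f = 0%E -> {ae mu, forall x, f x = 0}.
Proof.
move=> mf f0.
have := (@ae_eq_integral_abs _ _ _ mu setT measurableT _ (measurable_sqr_EFin mf)).1.
have -> : (\int[mu]_x `|(f x ^+ 2)%:E| = sqint f)%E.
  by apply: eq_integral => x _; rewrite gee0_abs// lee_fin sqr_ge0.
move=> /(_ f0); apply: filterS => x /(_ I) /= [] /eqP.
by rewrite sqrf_eq0 => /eqP.
Qed.

(** Bridge to the norm of the theorem; the other estimates are written with [sqint]. *)
Lemma Lnorm2_le f (c : R) : 0 <= c -> (sqint f <= (c ^+ 2)%:E)%E ->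
  ('N[mu]_2[(fun x => (f x)%:E)] <= c%:E)%E.
Proof.
move=> c0 fc; rewrite unlock /Lnorm.
have -> : (\int[mu]_x `|(f x)%:E| `^ 2 = sqint f)%E.
  by apply: eq_integral => x _; rewrite abse_EFin poweR_EFin powR_mulrn// real_normK// num_real.
have s0 : (0 <= sqint f)%E by apply: integral_ge0 => x _; rewrite lee_fin sqr_ge0.
have -> : c%:E = ((c ^+ 2)%:E `^ 2^-1)%E.
  by rewrite poweR_EFin powR12_sqrt ?sqr_ge0// sqrtr_sqr ger0_norm.
by apply: gt0_ler_poweR => //; rewrite in_itv/= leey andbT ?s0// lee_fin sqr_ge0.
Qed.

Lemma limn_einf_le (u : nat -> \bar R) (c : \bar R) :
  (\forall k \near \oo, (u k <= c)%E) -> (limn_einf u <= c)%E.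
Proof.
move=> uc; rewrite limn_einf_lim; apply: lime_le; first exact: is_cvg_einfs.
apply: filterS uc => k; apply: le_trans; apply: ereal_inf_lbound.
by exists k => /=.
Qed.

(* A sequence whose increments decay like 8 ^- k in squared norm converges
   almost everywhere, since the sum of 4 ^ k times the squared increments is
   integrable. *)
Lemma fast_cauchy_ae (f : nat -> T -> R) : (forall k, measurable_fun setT (f k)) ->
  (forall k, (sqint (fun x => (f k.+1 x - f k x)%R) <= (8 ^- k)%:E)%E) ->
  exists S : set T, [/\ measurable S, {ae mu, forall x, S x} &
    forall x, S x -> cvgn (fun k => f k x)].
Proof.
move=> mf fk.
have mi k : measurable_fun setT (fun x => f k.+1 x - f k x) by exact: measurable_funB.
pose w k x := (4 ^+ k * (f k.+1 x - f k x) ^+ 2)%:E.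
have wE k : w k = (fun x => ((4 ^+ k)%:E * ((f k.+1 x - f k x) ^+ 2)%:E)%E).
  by apply/funext => x; rewrite -EFinM.
have mw k : measurable_fun setT (w k).
  by rewrite wE; apply: measurable_funeM; exact: measurable_sqr_EFin.
have w0 k x : (0 <= w k x)%E by rewrite lee_fin mulr_ge0// ?sqr_ge0// exprn_ge0.
pose H x := (\sum_(k <oo) w k x)%E.
have mH : measurable_fun setT H by apply: ge0_emeasurable_sum.
have H0 x : (0 <= H x)%E by apply: nneseries_ge0.
have iH : (\int[mu]_x H x <= 2%:E)%E.
  (* The terms are at most 4^k 8^-k = 2^-k, with sum 2. *)
  rewrite /H integral_nneseries//.
  apply: le_trans (@epsilon_trick0 R 2 xpredT _) => //.
  apply: lee_nneseries => [k _ _|k _]; first exact: integral_ge0.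
  rewrite wE ge0_integralZl//;
    [|exact: measurable_sqr_EFin|by move=> x _; rewrite lee_fin sqr_ge0].
  apply: (@le_trans _ _ ((4 ^+ k)%:E * (8 ^- k)%:E)%E).
    by apply: lee_wpmul2l (fk k); rewrite lee_fin exprn_ge0.
  rewrite -EFinM lee_fin natrX exprS invfM mulrA divff// mul1r.
  by rewrite -exprVn -exprMn -exprVn (_ : 4 / 8 = 2^-1)//; field.
exists [set x | H x < +oo]%E; split.
- by rewrite -[X in measurable X]setTI; apply: measurable_lte.
- have : mu.-integrable setT H.
    apply/integrableP; split => //.
    under eq_integral do rewrite gee0_abs//.
    by apply: le_lt_trans iH _; rewrite ltry.
  move=> iH2; have := integrable_ae measurableT iH2; apply: filterS => x /(_ I).
  by rewrite ge0_fin_numE.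
- move=> x /= Hx; have bH : ((fine (H x))%:E = H x)%E by rewrite fineK// ge0_fin_numE.
  set b := fine (H x) in bH.
  have b0 : 0 <= b by rewrite -lee_fin bH.
  pose a k := f k.+1 x - f k x.
  (* A single term 4^k a_k^2 of the series is at most its sum b, so the increments decay
     geometrically. *)
  have ab k : `|a k| <= Num.sqrt b * 2^-1 ^+ k.
    have : (w k x <= b%:E)%E.
      rewrite bH; apply: le_trans (nneseries_lim_ge k.+1 (fun n _ _ => w0 n x)).
      by rewrite big_nat_recr//= leeDr// sume_ge0.
    rewrite lee_fin => wb; rewrite -(@ler_pXn2r _ 2)// ?nnegrE ?mulr_ge0 ?sqrtr_ge0 ?exprn_ge0//.
    rewrite real_normK ?num_real// exprMn sqr_sqrtr// -exprM mulnC exprM exprVn.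
    by rewrite -[X in _ * (X) ^+ k]invrK invrK exprVn ler_pdivlMr ?exprn_gt0// mulrC -natrX.
  have ca : cvgn (series a).
    apply: normed_cvg; apply: (@series_le_cvg _ _ (geometric (Num.sqrt b) 2^-1)) => //.
    - by move=> k /=.
    - by move=> k; rewrite /= mulr_ge0 ?sqrtr_ge0 ?exprn_ge0.
    - by apply: is_cvg_geometric_series; rewrite ger0_norm// invf_lt1// ltr1n.
  have -> : (fun k => f k x) = (fun k => series a k + f 0%N x).
    by apply/funext => k; rewrite /series /= telescope_sumr// subrK.
  by apply: is_cvgD => //; exact: is_cvg_cst.
Qed.

Definition L2cauchy (f : nat -> T -> R) := forall e : R, 0 < e ->
  exists N, forall m l, (N <= m)%N -> (N <= l)%N ->
    (sqint (fun x => (f m x - f l x)%R) <= e%:E)%E.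

Definition L2cvg (f : nat -> T -> R) h := forall e : R, 0 < e ->
  exists N, forall m, (N <= m)%N -> (sqint (fun x => (f m x - h x)%R) <= e%:E)%E.

(** Riesz-Fischer: a subsequence with increments at most 8^-k converges almost everywhere, and
    Fatou's lemma carries the Cauchy estimate over to its limit. *)
Lemma L2_complete (f : nat -> T -> R) : (forall k, measurable_fun setT (f k)) ->
  L2cauchy f -> exists2 h : T -> R, measurable_fun setT h & L2cvg f h.
Proof.
move=> mf cf.
have [N HN] : exists N : nat -> nat, forall k m l, (N k <= m)%N -> (N k <= l)%N ->
    (sqint (fun x => (f m x - f l x)%R) <= (8 ^- k)%:E)%E.
  have H k : exists N, forall m l, (N <= m)%N -> (N <= l)%N ->
      (sqint (fun x => (f m x - f l x)%R) <= (8 ^- k)%:E)%E.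
    by apply: cf; rewrite invr_gt0 exprn_gt0.
  by have [N HN] := choice H; exists N.
(* The maximum makes [s] monotone and at least [N k]; the summand k makes s k >= k, which the use of
   Fatou's lemma relies on. *)
pose s k := (k + \max_(i < k.+1) N i)%N.
have sN k : (N k <= s k)%N.
  apply: leq_trans (leq_addl _ _); exact: (@leq_bigmax _ (fun i : 'I_k.+1 => N i) ord_max).
have sS k : (s k <= s k.+1)%N.
  apply: leq_add => //; rewrite [leqRHS]big_ord_recr /= leq_max; apply/orP; left.
  by apply/bigmax_leqP => i _; exact: (@leq_bigmax _ (fun i : 'I_k.+1 => N i) i).
have [|S [mS aS cS]] := @fast_cauchy_ae (fun k => f (s k)) (fun k => mf (s k)).
  by move=> k; apply: HN => //; exact: leq_trans (sN k) (sS k).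
(* Cut off to the convergence set, the sequence converges everywhere and the limit is measurable. *)
pose r (u : T -> R) x := u x * \1_S x.
have rS u x : S x -> r u x = u x by move=> Sx; rewrite /r indicE mem_set// mulr1.
have mr (u : T -> R) : measurable_fun setT u -> measurable_fun setT (r u).
  by move=> mu_; apply: measurable_funM => //; exact: measurable_indic.
have cr x : cvgn (fun k => r (f (s k)) x).
  have [Sx|nSx] := pselect (S x).
    by under eq_fun do rewrite rS//; exact: cS.
  have -> : (fun k => r (f (s k)) x) = (fun=> 0).
    by apply/funext => k; rewrite /r indicE memNset// mulr0.
  exact: is_cvg_cst.
pose h x : R := limn (fun k => r (f (s k)) x).
have rh x : r (f (s k)) x @[k --> \oo] --> h x by exact: cr.
have mh : measurable_fun setT h.
  by apply: (measurable_fun_cvg (fun k => mr _ (mf (s k)))) => x _; exact: rh.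
exists h => // e e0; have [N0 HN0] := cf e e0; exists N0 => m Nm.
have mB (u v : T -> R) : measurable_fun setT u -> measurable_fun setT v ->
    measurable_fun setT (fun x => u x - v x) by exact: measurable_funB.
rewrite (@sqint_ae _ (fun x => r (f m) x - h x)); [|exact: mB|by apply: mB => //; exact: mr|]; last first.
  by apply: filterS aS => x Sx; rewrite rS.
pose F k x := ((r (f m) x - r (f (s k)) x) ^+ 2)%:E.
have -> : sqint (fun x => r (f m) x - h x) = (\int[mu]_x limn_einf (fun k => F k x))%E.
  apply: eq_integral => x _; apply/esym; apply: (cvg_limn_einf_sup _).1.
  apply: cvg_EFin; first exact: nearW.
  have c : (r (f m) x - r (f (s k)) x) @[k --> \oo] --> r (f m) x - h x.
    by apply: cvgB; [exact: cvg_cst|exact: rh].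
  exact: (cvgM c c).
apply: le_trans (@fatou _ _ _ mu setT measurableT F _ _) _.
- by move=> k; apply: measurable_sqr_EFin; apply: mB; exact: mr.
- by move=> k x _; rewrite lee_fin sqr_ge0.
- apply: limn_einf_le; exists N0 => // k /= Nk.
  apply: le_trans (HN0 m (s k) Nm _); last exact: leq_trans Nk (leq_addr _ _).
  apply: le_sqint; [by apply: mB; exact: mr|exact: mB|].
  move=> x; rewrite /r indicE; case: (x \in S); first by rewrite !mulr1.
  by rewrite !mulr0 subr0 normr0.
Qed.

(** The class of h in the quotient; its chosen representative agrees with h only almost
    everywhere. *)
Lemma Lspace2_rep h : measurable_fun setT h -> (sqint h < +oo)%E ->
  exists z : LspaceType2 mu, {ae mu, forall x, z x = h x}.
Proof.
move=> mh hfin.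
pose mh_mixin := isMeasurableFun.Build _ _ _ _ (h : T -> measurableTypeR R) mh.
pose hm : {mfun T >-> measurableTypeR R} := HB.pack (h : T -> measurableTypeR R) mh_mixin.
pose q : {mfun_ mu, T >-> measurableTypeR R} := (\pi hm)%qT.
have qh : {ae mu, forall x, q x = h x}.
  have : (repr q == hm %[mod {mfun_ mu, T >-> measurableTypeR R}])%qT by rewrite reprK.
  rewrite eqmodE => /asboolP; apply: filterS => x /(_ I).
  by [].
have fq : finite_norm mu 2 q.
  have mq : measurable_fun setT (q : T -> R) by exact: (@measurable_funPT _ _ _ _ (repr q)).
  have qE : sqint (q : T -> R) = sqint h by exact: sqint_ae.
  have h0 : (0 <= sqint h)%E by apply: integral_ge0 => x _; rewrite lee_fin sqr_ge0.
  pose c := Num.sqrt (fine (sqint h)).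
  apply: (@le_lt_trans _ _ c%:E); last exact: ltry.
  apply: Lnorm2_le; first exact: sqrtr_ge0.
  by rewrite qE sqr_sqrtr ?fine_ge0// fineK// ge0_fin_numE.
pose fq_mixin := isFinLebesgue.Build _ _ _ mu _ (lee1n 2) q fq.
pose z : LspaceType2 mu := HB.pack q fq_mixin.
by exists z.
Qed.

Lemma measurable_Lspace2 (z : LspaceType2 mu) : measurable_fun setT (z : T -> R).
Proof. exact: (@measurable_funPT _ _ _ _ (repr (z : {mfun_ mu, T >-> measurableTypeR R}))). Qed.

End L2.

(** For each k the ultrafilter contains a set on which Q holds at level 1 / (k + 1); s k is picked
    in the intersection of the first k + 1 of them, beyond the previous value, which is possible
    since U contains all tails. *)
Lemma ultra_subseq (R : realType) (U : set_system nat) (Q : R -> nat -> nat -> Prop) :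
  UltraFilter U -> (forall N, U [set k | (N <= k)%N]) ->
  (forall e e' m l, e <= e' -> Q e m l -> Q e' m l) ->
  (forall e, 0 < e -> exists2 B, U B & forall m l, B m -> B l -> Q e m l) ->
  exists2 s : nat -> nat, {homo s : m l / (m < l)%N} &
    forall e, 0 < e -> exists N, forall m l, (N <= m)%N -> (N <= l)%N -> Q e (s m) (s l).
Proof.
move=> UU Ucof Qmono HQ.
have [B HB] : exists B : nat -> set nat, forall k, U (B k) /\
    forall m l, B k m -> B k l -> Q (k.+1%:R^-1) m l.
  have H k : exists B, U B /\ forall m l, B m -> B l -> Q (k.+1%:R^-1) m l.
    by have [|B UB HB] := HQ (k.+1%:R^-1); [rewrite invr_gt0|exists B].
  by have [B HB] := choice H; exists B.
pose C k := [set m | forall i, (i <= k)%N -> B i m].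
have UC k : U (C k).
  elim: k => [|k IH].
    by apply: filterS (HB 0%N).1 => m Bm i; rewrite leqn0 => /eqP ->.
  apply: filterS (filterI IH (HB k.+1).1) => m [Cm Bm] i.
  by rewrite leq_eqVlt ltnS => /predU1P[->//|]; exact: Cm.
have [pick Hp] : exists pick : nat * nat -> nat, forall kN, C kN.1 (pick kN) /\ (kN.2 <= pick kN)%N.
  have H (kN : nat * nat) : exists m, C kN.1 m /\ (kN.2 <= m)%N.
    have [m [Cm Nm]] := filter_ex (filterI (UC kN.1) (Ucof kN.2)).
    by exists m.
  by have [pick Hp] := choice H; exists pick.
pose fix s (k : nat) : nat := if k is k'.+1 then pick (k, (s k').+1) else pick (0%N, 0%N).
have sC k : C k (s k) by case: k => [|k] /=; [exact: (Hp (0%N, 0%N)).1|exact: (Hp (k.+1, (s k).+1)).1].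
exists s.
  apply: homo_ltn => [m l p|k]; first exact: ltn_trans.
  exact: (Hp (k.+1, (s k).+1)).2.
move=> e e0; pose N := Num.truncn e^-1.
have Ne : N.+1%:R^-1 <= e.
  by rewrite invf_ple ?posrE// ltW// truncnS_gt.
exists N => m l Nm Nl; apply: Qmono Ne _; apply: (HB N).2; exact: sC.
Qed.

(** Compactness as an induction principle. If no P-set covered K, the sets containing some K \ S
    with P S would form a proper filter; a cluster point of it in K has a P-neighbourhood N, whose
    complement is in the filter. *)
Lemma compact_local (T : topologicalType) (K : set T) (P : set T -> Prop) :
  compact K -> P set0 -> (forall A B, P A -> P B -> P (A `|` B)) ->
  (forall p, K p -> exists2 N, nbhs p N & P N) ->
  exists2 S, K `<=` S & P S.
Proof.
move=> cK P0 PU PN; apply: contrapT => nS.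
pose F : set_system T := [set A | exists2 S, P S & K `\` S `<=` A].
have FF : Filter F.
  split.
  - by exists set0.
  - move=> A B [S PS SA] [S' PS' SB]; exists (S `|` S'); first exact: PU.
    move=> x [Kx nSx]; split; [apply: SA|apply: SB]; split => // Sx; apply: nSx; [left|right]; exact: Sx.
  - by move=> A B AB [S PS SA]; exists S => //; exact: subset_trans SA AB.
have PF : ProperFilter F.
  split => // -[S PS SE]; apply: nS; exists S => // x Kx.
  by apply: contrapT => nSx; exact: (SE x).
have FK : F K by exists set0 => // x [].
have [p [Kp clp]] := cK F PF FK.
have [N pN PpN] := PN p Kp.
have FN : F (~` N) by exists N => // x [].
by have [x [/= nNx Nx]] := clp _ _ FN pN.
Qed.

Section IntegralUnion.
Context d (T : measurableType d) (R : realType) (mu : {measure set T -> \bar R}).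

Lemma le_integral_setU (A B : set T) (F : T -> \bar R) : measurable A -> measurable B ->
  measurable_fun (A `|` B) F -> (forall x, (A `|` B) x -> (0 <= F x)%E) ->
  (\int[mu]_(x in A `|` B) F x <= \int[mu]_(x in A) F x + \int[mu]_(x in B) F x)%E.
Proof.
move=> mA mB mF F0.
have mD : measurable (B `\` A) by exact: measurableD.
have E : A `|` B = A `|` (B `\` A).
  apply/seteqP; split => x; last by move=> [|[]]; [left|right].
  by move=> [Ax|Bx]; [left|have [Ax|nAx] := pselect (A x); [left|right]].
rewrite {1}E ge0_integral_setU//; last 3 first.
- by rewrite -E.
- by rewrite -E.
- by apply/disj_setPS => x [Ax [_ nAx]].
apply: leeD => //; apply: ge0_subset_integral => //.
- by apply: measurable_funS mF; [exact: measurableU|right].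
- by move=> x Bx; apply: F0; right.
Qed.

End IntegralUnion.

(** * From points to compact subsets of the interior *)

Section LocalToCompact.
Variable R : realType.
Variables (T : ptopologicalType) (n : nat) (A : @atlas R T n.+1).
Hypothesis mfd : is_manifold (half_space R n) A.
Notation Ai := (interior_atlas A).
Notation IM := (~` boundary A).
Variable g : field2 Ai.
Hypothesis gm : is_metric g.
Variable mu : {measure set (Bor T) -> \bar R}.
Hypothesis vol : forall (i : idx Ai) (S : set (Bor T)), measurable S -> S `<=` dom i ->
  mu S = rVintegral (fun x => (Num.sqrt (\det (g i x)) * \1_(cmap i @` S) x)%:E).

(** Through the continuous inverse chart, agreement near p becomes agreement of the coordinate
    expressions near its image. *)
Lemma gradN_near u v p : smoothM A u -> smoothM A v -> IM p ->
  (\forall q \near p, u q = v q) -> gradN g u p = gradN g v p.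
Proof.
move=> su sv pI uv; have [i ip] := interior_chart mfd pI.
have ix : chart_image i (cmap i p) by exists p.
rewrite (gradNE mfd gm su ip) (gradNE mfd gm sv ip) /gradsq; congr qf.
apply/rowP => k; rewrite !mxE; apply: near_eq_derive.
have H1 : \forall x \near cmap i p, u (icmap i x) = v (icmap i x).
  have c : icmap i z @[z --> cmap i p] --> icmap i (cmap i p) by exact: (icmap_continuous mfd ix).
  by apply: (c [set q | u q = v q]); rewrite (icmapK mfd ip).
have H2 := near_open (@chart_image_open _ _ _ _ mfd i) ix.
by apply: filterS2 H1 H2 => x E ix'; rewrite !(rep_icmap mfd).
Qed.

Lemma le_setU_sqr (S S' : set (Bor T)) (w : T -> R) (a b : \bar R) : measurable S -> measurable S' ->
  S `<=` IM -> S' `<=` IM -> measurable_fun (IM : set (Bor T)) w -> (forall p, IM p -> 0 <= w p) ->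
  (\int[mu]_(q in S) (w q)%:E <= a)%E -> (\int[mu]_(q in S') (w q)%:E <= b)%E ->
  (\int[mu]_(q in S `|` S') (w q)%:E <= a + b)%E.
Proof.
move=> mS mS' SI SI' mw w0 wa wb; apply: le_trans (leeD wa wb); apply: le_integral_setU => //.
- apply/measurable_EFinP; apply: measurable_funS mw; first exact: interior_measurable.
  by rewrite subUset.
- by move=> x [/SI|/SI'] Ix; rewrite lee_fin w0.
Qed.

Lemma compact_rellich (K : set T) : compact K -> K `<=` IM ->
  exists S : set (Bor T), [/\ measurable S, K `<=` S, S `<=` IM & rellich_on g mu S].
Proof.
move=> cK KI.
pose P (S : set (Bor T)) := [/\ measurable S, S `<=` IM & rellich_on g mu S].
have [||p Kp|S KS [mS SI HS]] := @compact_local T K P cK; last by exists S.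
- split => // u C U e _ _ _ UU e0; exists setT; first exact: filterT.
  by move=> m m' _ _; rewrite integral_set0 lee_fin ltW.
- move=> S S' [mS SI HS] [mS' SI' HS']; split; [exact: measurableU|by rewrite subUset|].
  move=> u C U e su uC gC UU e0; have e20 : 0 < e / 2 by rewrite divr_gt0.
  have [B UB HB] := HS u C U _ su uC gC UU e20.
  have [B' UB' HB'] := HS' u C U _ su uC gC UU e20.
  exists (B `&` B'); first exact: filterI.
  move=> m m' [Bm Bm'] [Bl Bl']; rewrite [e]splitr EFinD.
  apply: le_setU_sqr => //; [|by move=> p _; exact: sqr_ge0|exact: HB|exact: HB'].
  have mB := measurable_smoothM mfd (smoothMB mfd (su m) (su m')).
  exact: (measurable_funM mB mB).
- have [N [mN pN NI HN]] := local_rellich mfd gm vol (KI _ Kp).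
  by exists N => //; split.
Qed.

Lemma compact_closable (K : set T) : compact K -> K `<=` IM ->
  exists S : set (Bor T), [/\ measurable S, K `<=` S, S `<=` IM & closable_on g mu S].
Proof.
move=> cK KI.
pose P (S : set (Bor T)) := [/\ measurable S, S `<=` IM & closable_on g mu S].
have [||p Kp|S KS [mS SI HS]] := @compact_local T K P cK; last by exists S.
- split => // u su gC uC e e0; exists 0%N => m _.
  by rewrite integral_set0 lee_fin ltW.
- move=> S S' [mS SI HS] [mS' SI' HS']; split; [exact: measurableU|by rewrite subUset|].
  move=> u su gC uC e e0; have e20 : 0 < e / 2 by rewrite divr_gt0.
  have [N HN] := HS u su gC uC _ e20; have [N' HN'] := HS' u su gC uC _ e20.
  exists (maxn N N') => m; rewrite geq_max => /andP[Nm Nm']; rewrite [e]splitr EFinD.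
  apply: le_setU_sqr => //; [exact: (measurable_gradN mfd gm)|by move=> p _; exact: gradN_ge0|
    exact: HN|exact: HN'].
- have [N [mN pN NI HN]] := local_closable mfd gm vol (KI _ Kp).
  by exists N => //; split.
Qed.

End LocalToCompact.

(** * Horn manifolds *)

Lemma weight_exponent_ge1 (R : realType) (gamma : R) : 1 < gamma -> 1 <= 2 * gamma.
Proof. by move=> g1; lra. Qed.

(** The exponents of [chi] at orders 0 and 1 in the Sobolev norm: u^2 carries chi^(2 gamma), and the
    gradient carries no weight. *)
Lemma weight_exponent0 (R : realType) (gamma n : R) :
  2 * (gamma - n * gamma / 2 - gamma * 0%:R) + n * gamma = 2 * gamma.
Proof. by field. Qed.

Lemma weight_exponent1 (R : realType) (gamma n : R) :
  2 * (gamma - n * gamma / 2 - gamma * 1%:R) + n * gamma = 0.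
Proof. by field. Qed.

Section Horn.
Variables (R : realType) (gamma : R) (b f : nat).
Hypothesis gamma_gt1 : 1 < gamma.
Variable X : horn_manifold gamma b f.
Variable mu : {measure set (borel X) -> \bar R}.
Hypothesis mu_vol : is_volume mu.
Variable chi : X -> R.
Hypothesis chi_weight : is_weight chi.

Let T : ptopologicalType := hM X.
Let A : @atlas R T (b + f).+1 := hA X.
Let mfd : is_manifold (half_space R (b + f)) A := hA_manifold X.
Let g : field2 (interior_atlas A) := @hg _ _ _ _ X.
Let gm : is_metric g := hg_metric X.
Notation IM := (~` boundary A).

Let nu : {measure set (Bor T) -> \bar R} := mu.

Let vol (i : idx (interior_atlas A)) (S : set (Bor T)) : measurable S -> S `<=` dom i ->
  nu S = rVintegral (fun x => (Num.sqrt (\det (g i x)) * \1_(cmap i @` S) x)%:E).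
Proof. exact: mu_vol.2. Qed.

Lemma boundary_null : nu (boundary A : set (Bor T)) = 0%E.
Proof. exact: mu_vol.1. Qed.

Lemma measurable_boundary : measurable (boundary A : set (Bor T)).
Proof. by rewrite -[boundary A]setCK; apply: measurableC; exact: interior_measurable. Qed.

Lemma integral_interior (F : T -> \bar R) : measurable_fun setT (F : Bor T -> \bar R) ->
  (forall x, (0 <= F x)%E) ->
  (\int[nu]_(x in IM : set (Bor T)) F x = \int[nu]_x F x)%E.
Proof.
move=> mF F0.
by rewrite (ge0_negligible_integral measurable_boundary _ mF (fun x _ => F0 x) boundary_null)// setTD.
Qed.

Lemma chi_smooth : smoothM A chi.
Proof. exact: wt_smooth. Qed.

Lemma chi_ge1 p : IM p -> 1 <= chi p.
Proof.
move=> pI; have c0 := wt_pos chi_weight pI; have /andP[_ c1] := wt_inv_pos chi_weight pI.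
by rewrite -[chi p]invrK invf_ge1// invr_gt0.
Qed.

Definition dens (u : T -> R) (p : T) : R := chi p `^ (2 * gamma) * u p ^+ 2 + gradN g u p.

Lemma chi_pow_ge p : IM p -> chi p <= chi p `^ (2 * gamma).
Proof.
move=> pI; have c1 := chi_ge1 pI; rewrite -[leLHS]powRr1; last exact: le_trans c1.
exact: ler_powR (weight_exponent_ge1 gamma_gt1).
Qed.

Lemma measurable_chi_pow : measurable_fun (IM : set (Bor T)) (fun p => chi p `^ (2 * gamma)).
Proof.
apply: (measurableT_comp (measurable_powR _)).
exact: measurable_smoothM mfd _ chi_smooth.
Qed.

Lemma measurable_sqrM u : smoothM A u -> measurable_fun (IM : set (Bor T)) (fun p => u p ^+ 2).
Proof. by move=> su; have mu_ := measurable_smoothM mfd su; exact: (measurable_funM mu_ mu_). Qed.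

Lemma measurable_dens u : smoothM A u -> measurable_fun (IM : set (Bor T)) (dens u).
Proof.
move=> su; apply: measurable_funD; last exact: (measurable_gradN mfd gm su).
by apply: measurable_funM; [exact: measurable_chi_pow|exact: measurable_sqrM].
Qed.

Lemma dens_ge0 u p : 0 <= dens u p.
Proof. by rewrite addr_ge0 ?gradN_ge0// mulr_ge0 ?powR_ge0 ?sqr_ge0. Qed.

Definition energy u : \bar R := (\int[nu]_(p in IM : set (Bor T)) (dens u p)%:E)%E.

Lemma sqr_le_dens u p : IM p -> u p ^+ 2 <= dens u p.
Proof.
move=> pI; rewrite /dens -[leLHS]mul1r; apply: ler_wpDr; first exact: gradN_ge0.
by rewrite ler_wpM2r ?sqr_ge0// (le_trans (chi_ge1 pI))// chi_pow_ge.
Qed.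

Lemma grad_le_dens u p : gradN g u p <= dens u p.
Proof. by rewrite /dens lerDr mulr_ge0 ?powR_ge0 ?sqr_ge0. Qed.

Lemma le_energy u (F : T -> R) : smoothM A u -> measurable_fun (IM : set (Bor T)) F ->
  (forall p, IM p -> 0 <= F p <= dens u p) ->
  (\int[nu]_(p in IM : set (Bor T)) (F p)%:E <= energy u)%E.
Proof.
move=> su mF FD; apply: ge0_le_integral => //.
- exact: interior_measurable.
- by move=> x /FD /andP[]; rewrite lee_fin.
- exact/measurable_EFinP.
- by apply/measurable_EFinP; exact: measurable_dens.
- by move=> x /FD /andP[]; rewrite lee_fin.
Qed.

Lemma sobolev_energy u : smoothM A u ->
  (sobolev_norm mu chi 1 2 (gamma - (b + f).+1%:R * gamma / 2) u = energy u `^ 2^-1)%E.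
Proof.
move=> su; rewrite /sobolev_norm /energy; congr (_ `^ _)%E.
apply: eq_integral => p /set_mem pI; congr _%:E.
rewrite big_ord_recl big_ord1 /=.
rewrite (nabla_norm0 mfd g u pI).
rewrite weight_exponent0 weight_exponent1.
have n0 : 0 <= nabla_norm g 1 u p.
  by have [i ip] := interior_chart mfd pI; rewrite (nabla_norm1 mfd gm su ip) sqrtr_ge0.
by rewrite powRr0 mul1r (powR_mulrn 2 (normr_ge0 _)) (powR_mulrn 2 n0) real_normK ?num_real.
Qed.

(** It contains the slice r = 0, that is the boundary, so its complement is a compact subset of the
    interior. *)
Definition collar_part (eps : R) : set T :=
  @hcollar _ _ _ _ X @` [set z : R * boundary A | 0 <= z.1 < eps].

(** The condition r < eps is open, and the collar map is open onto its image, itself an open set. *)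
Lemma collar_part_open eps : eps <= 1 -> open (collar_part eps).
Proof.
move=> e1; have oz : open [set z : R * boundary A | z.1 < eps].
  apply: (@open_comp _ _ fst [set t : R | t < eps]); last exact: open_lt.
  by move=> z _; exact: cvg_fst.
have [V oV E] := df_open_map (hcollar_diffeo X) oz.
rewrite (_ : collar_part eps = V `&` (@hcollar _ _ _ _ X @` [set z | 0 <= z.1 < 1])).
  by apply: openI => //; exact: hcollar_open.
rewrite -E; apply/seteqP; split => p [z].
  by move=> /= /andP[z0 ze] <-; exists z => //; split => //=; rewrite z0 (lt_le_trans ze).
by move=> [/= ze /andP[z0 _]] <-; exists z => //=; rewrite z0.
Qed.

Lemma compact_collarC eps : eps <= 1 -> compact (~` collar_part eps).
Proof.
move=> e1; have cX : compact [set: T] := @hM_compact _ _ _ _ X.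
have cl : closed (~` collar_part eps) by apply: open_closedC; exact: collar_part_open.
exact: (@subclosed_compact T _ _ cl cX).
Qed.

Lemma collarC_interior eps : 0 < eps -> ~` collar_part eps `<=` IM.
Proof.
move=> e0 p np pA; apply: np.
exists (0, exist _ p (mem_set pA) : boundary A); first by rewrite /= lexx.
by rewrite hcollar0.
Qed.

Lemma tail_le_dens eps u p : 0 < eps -> eps <= 10^-1 -> IM p -> collar_part eps p ->
  u p ^+ 2 <= eps * dens u p.
Proof.
move=> e0 e1 pI [[r q] /= /andP[r0 re] E].
have rp : 0 < r.
  rewrite lt_neqAle r0 andbT eq_sym; apply/eqP => rE; apply: pI.
  by rewrite -E rE hcollar0; exact: set_mem (valP q).
have cE : chi p = r^-1.
  by rewrite -E (wt_in chi_weight)// rp (lt_le_trans re).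
have c1 : 1 <= eps * chi p `^ (2 * gamma).
  apply: le_trans (_ : 1 <= eps * chi p) _; first by rewrite cE ler_pdivlMr// mul1r ltW.
  by rewrite ler_wpM2l ?chi_pow_ge// ltW.
rewrite /dens mulrDr mulrA; apply: ler_wpDr; first by rewrite mulr_ge0 ?gradN_ge0// ltW.
by rewrite -[leLHS]mul1r ler_wpM2r ?sqr_ge0.
Qed.

End Horn.

(** * Estimates for test functions *)

Section SobolevSpace.
Variables (R : realType) (gamma : R) (b f : nat).
Hypothesis gamma_gt1 : 1 < gamma.
Variable X : horn_manifold gamma b f.
Variable mu : {measure set (borel X) -> \bar R}.
Hypothesis mu_vol : is_volume mu.
Variable chi : X -> R.
Hypothesis chi_weight : is_weight chi.
Variables (W : completeNormedModType R) (j : (X -> R) -> W).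
Hypothesis W_sobolev : is_sobolev_space mu chi 1 2 (gamma - (b + f).+1%:R * gamma / 2) j.

Let T : ptopologicalType := hM X.
Let A : @atlas R T (b + f).+1 := hA X.
Let mfd : is_manifold (half_space R (b + f)) A := hA_manifold X.
Let g : field2 (interior_atlas A) := @hg _ _ _ _ X.
Let gm : is_metric g := hg_metric X.
Notation IM := (~` boundary A).
Let nu : {measure set (Bor T) -> \bar R} := mu.
Notation test := (@test_function R gamma b f X).

Let vol (i : idx (interior_atlas A)) (S : set (Bor T)) : measurable S -> S `<=` dom i ->
  nu S = rVintegral (fun x => (Num.sqrt (\det (g i x)) * \1_(cmap i @` S) x)%:E).
Proof. exact: mu_vol.2. Qed.

Lemma test_smooth u : test u -> smoothM A u. Proof. by case. Qed.

Lemma test_lin (a : R) u v : test u -> test v -> test (fun x => a * u x + v x).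
Proof.
move=> [su [K [cK KI uK]]] [sv [L [cL LI vL]]]; split.
  exact: (@smoothM_lin R T (b + f) A mfd u v a su sv).
exists (K `|` L); split; first exact: compactU.
  by rewrite subUset.
by move=> p /not_orP[nK nL]; rewrite uK// vL// mulr0 addr0.
Qed.

Lemma measurable_test u : test u -> measurable_fun setT (u : Bor T -> R).
Proof.
move=> tu; have [su [K [cK KI uK]]] := tu.
rewrite -(setvU (boundary A)); apply/measurable_funU.
- exact: interior_measurable.
- exact: measurable_boundary.
split; first exact: measurable_smoothM.
have m0 : measurable_fun (boundary A : set (Bor T)) (cst 0 : Bor T -> R) by exact: measurable_cst.
by apply: eq_measurable_fun m0 => x /set_mem xA; rewrite uK// => /KI; exact.
Qed.

Lemma sqint_interior u : test u ->
  (\int[nu]_(p in IM : set (Bor T)) (u p ^+ 2)%:E = sqint nu u)%E.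
Proof.
move=> tu; apply: integral_interior => //; last by move=> x; rewrite lee_fin sqr_ge0.
exact: (measurable_sqr_EFin (measurable_test tu)).
Qed.

(** Finiteness of the energy comes from its square root being the real number |j u|. *)
Lemma energy_norm u : test u -> energy mu chi u = (`|j u| ^+ 2)%:E.
Proof.
move=> tu; have := sb_norm W_sobolev tu; rewrite sobolev_energy//; last exact: test_smooth.
have : (0 <= energy mu chi u)%E by apply: integral_ge0 => x _; rewrite lee_fin dens_ge0.
case: (energy mu chi u) => [r| |]//.
- rewrite lee_fin => r0; rewrite poweR_EFin powR12_sqrt// => -[->].
  by rewrite sqr_sqrtr.
- by move=> _; rewrite poweRyr ?invr_eq0 ?pnatr_eq0.
Qed.

Lemma sqint_le_norm u : test u -> (sqint nu u <= (`|j u| ^+ 2)%:E)%E.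
Proof.
move=> tu; rewrite -sqint_interior// -energy_norm//; apply: le_energy => //.
- exact: test_smooth.
- exact: (measurable_sqrM (test_smooth tu)).
- by move=> p pI; rewrite sqr_ge0/=; exact: sqr_le_dens.
Qed.

Lemma grad_le_norm u : test u ->
  (\int[nu]_(p in IM : set (Bor T)) (gradN g u p)%:E <= (`|j u| ^+ 2)%:E)%E.
Proof.
move=> tu; rewrite -energy_norm//; apply: le_energy => //.
- exact: test_smooth.
- exact: (measurable_gradN mfd gm (test_smooth tu)).
- by move=> p pI; rewrite gradN_ge0/=; exact: grad_le_dens.
Qed.

Lemma testB u v : test u -> test v ->
  test (fun x => u x - v x) /\ j (fun x => u x - v x) = j u - j v.
Proof.
move=> tu tv; have E : (fun x => u x - v x) = (fun x => -1 * v x + u x).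
  by apply/funext => x; rewrite mulN1r addrC.
rewrite E; split; first exact: test_lin.
by rewrite (sb_linear W_sobolev)// scaleN1r addrC.
Qed.

Lemma sqintB_le_norm u v : test u -> test v ->
  (sqint nu (fun x => (u x - v x)%R) <= (`|j u - j v| ^+ 2)%:E)%E.
Proof. by move=> tu tv; have [t <-] := testB tu tv; exact: sqint_le_norm. Qed.

(** Density provides some test function u, and the zero function is u - u. *)
Lemma test0 : test (fun=> 0) /\ j (fun=> 0) = 0.
Proof.
have : closure (j @` test) 0 by rewrite (sb_dense W_sobolev).
move=> /(_ setT filterT)[_ [[u tu _] _]]; have [t E] := testB tu tu.
have z : (fun x => u x - u x) = (fun=> 0) by apply/funext => x; rewrite subrr.
by rewrite z in t E; split => //; rewrite E subrr.
Qed.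

Lemma test_approx w (e : R) : 0 < e -> exists2 u, test u & `|j u - w| < e.
Proof.
move=> e0; have : closure (j @` test) w by rewrite (sb_dense W_sobolev).
move=> /(_ (ball w e) (nbhsx_ballx _ _ e0))[_ [[u tu <-]]].
by rewrite -ball_normE /ball_ /= distrC => h; exists u.
Qed.

Lemma test_rellich (u : nat -> X -> R) (C : R) (U : set_system nat) :
  (forall m, test (u m)) -> (forall m, `|j (u m)| <= C) -> UltraFilter U ->
  forall e : R, 0 < e -> exists2 B, U B & forall m l, B m -> B l ->
    (sqint nu (fun x => (u m x - u l x)%R) <= e%:E)%E.
Proof.
move=> tu uC UU e e0.
(* The squared norm of j (u m) - j (u l) is at most 4 C^2 <= D / 2, so a horn of depth e / D carries
   at most e / 2; the summand 1 covers C = 0. *)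
pose D := 2 * (4 * C ^+ 2 + 1).
have D0 : 0 < D by rewrite /D; have := sqr_ge0 C; lra.
pose eps := Num.min 10^-1 (e / D).
have eps0 : 0 < eps by rewrite lt_min invr_gt0 ltr0n /= divr_gt0.
have eps1 : eps <= 10^-1 by rewrite ge_min lexx.
have eps2 : eps <= 1 by apply: le_trans eps1 _; rewrite invf_le1// ler1n.
have [S [mS KS SI HS]] := compact_rellich mfd gm vol (compact_collarC (X := X) eps2)
  (collarC_interior (X := X) eps0).
have C2 m : ((`|j (u m)| ^+ 2)%:E <= (C ^+ 2)%:E)%E.
  by rewrite lee_fin lerXn2r// nnegrE// (le_trans _ (uC m)).
have [|||B UB HB] := HS u (C ^+ 2) U (e / 2) (fun m => test_smooth (tu m)) _ _ UU _.
- by move=> m; rewrite sqint_interior//; apply: le_trans (C2 m); exact: sqint_le_norm.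
- by move=> m; apply: le_trans (C2 m); exact: grad_le_norm.
- by rewrite divr_gt0.
exists B => // m l Bm Bl; have [tv jv] := testB (tu m) (tu l).
set v := (fun x => u m x - u l x) in tv jv *.
have sv := test_smooth tv; have mv2 := measurable_sqrM sv.
pose V : set (Bor T) := IM `&` collar_part (X := X) eps.
have mI : measurable (IM : set (Bor T)) by exact: interior_measurable.
have mV : measurable V by apply: measurableI => //; apply: Bor_open; exact: collar_part_open.
have VI : V `<=` IM by exact: subIsetl.
have E : IM = S `|` V.
  apply/seteqP; split => [p pI|p [/SI|/VI]]//.
  by have [cp|/KS Sp] := pselect (collar_part (X := X) eps p); [right|left].
have tail : (\int[nu]_(q in V) (v q ^+ 2)%:E <= (e / 2)%:E)%E.
  have md : measurable_fun (IM : set (Bor T)) (fun q => (eps * dens chi v q)%:E).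
    apply/measurable_EFinP; apply: measurable_funM => //.
    exact: (measurable_dens chi_weight sv).
  apply: (@le_trans _ _ (\int[nu]_(q in V) (eps * dens chi v q)%:E)%E).
    apply: ge0_le_integral => //.
    - by move=> q _; rewrite lee_fin sqr_ge0.
    - by apply/measurable_EFinP; exact: measurable_funS mv2.
    - exact: measurable_funS md.
    - by move=> q [qI cq]; rewrite lee_fin; exact: tail_le_dens.
  apply: (@le_trans _ _ (\int[nu]_(q in IM : set (Bor T)) (eps * dens chi v q)%:E)%E).
    apply: ge0_subset_integral => // q _; rewrite lee_fin mulr_ge0 ?dens_ge0//; exact: ltW.
  under eq_integral do rewrite EFinM.
  rewrite ge0_integralZl//; first last.
  - by rewrite lee_fin ltW.
  - by move=> q _; rewrite lee_fin dens_ge0.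
  - by apply/measurable_EFinP; exact: (measurable_dens chi_weight sv).
  rewrite -/(energy mu chi v) energy_norm// -EFinM lee_fin jv.
  have n2 : `|j (u m) - j (u l)| ^+ 2 <= 4 * C ^+ 2.
    rewrite (_ : 4 * C ^+ 2 = (C + C) ^+ 2); last by rewrite -mulr2n exprMn_n mulr_natl.
    rewrite lerXn2r ?nnegrE//; first by rewrite addr_ge0// (le_trans _ (uC m)).
    by apply: le_trans (ler_normB _ _) _; exact: lerD.
  apply: (@le_trans _ _ (e / D * (D / 2))); last by rewrite mulrA divfK// lt0r_neq0.
  apply: ler_pM; [exact: ltW|exact: sqr_ge0|by rewrite ge_min lexx orbT|].
  by rewrite /D mulrAC divff ?pnatr_eq0// mul1r (le_trans n2)// lerDl.
rewrite -sqint_interior// E [e]splitr EFinD.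
by apply: (le_setU_sqr mfd mS mV SI VI mv2) => //; [move=> q _; exact: sqr_ge0|exact: HB].
Qed.

Lemma test_closable (t : nat -> X -> R) : (forall m, test (t m)) ->
  (forall e : R, 0 < e -> exists N, forall m l, (N <= m)%N -> (N <= l)%N ->
    `|j (t m) - j (t l)| <= e) ->
  (forall e : R, 0 < e -> exists N, forall m, (N <= m)%N -> (sqint nu (t m) <= e%:E)%E) ->
  forall e : R, 0 < e -> exists N, forall m, (N <= m)%N -> `|j (t m)| <= e.
Proof.
move=> tt tC t0 e e0.
have [k Hk] := tC (e / 2) (divr_gt0 e0 (ltr0n _ 2)).
have [_ [K [cK KI tK]]] := tt k.
have clK : closed K by apply: (compact_closed (mf_hausdorff mfd)).
have mK : measurable (K : set (Bor T)) by exact: Bor_closed.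
have mI : measurable (IM : set (Bor T)) by exact: interior_measurable.
pose V : set (Bor T) := IM `\` K.
have mV : measurable V by exact: measurableD.
have VI : V `<=` IM by exact: subDsetl.
have E : IM = K `|` V.
  apply/seteqP; split => [p pI|p [/KI|/VI]]//.
  by have [Kp|nKp] := pselect (K p); [left|right].
have [S [mS KS SI HS]] := compact_closable mfd gm vol cK KI.
have [M HM] : exists M : R, forall p, K p -> `|chi p| <= M.
  apply: compact_bound cK _ => p /KI pI.
  exact: (smoothM_continuous mfd (chi_smooth chi_weight) pI).
pose Mp := `|M| `^ (2 * gamma).
have chiM p : K p -> chi p `^ (2 * gamma) <= Mp.
  move=> Kp; have c1 := chi_ge1 chi_weight (KI _ Kp).
  have c0 : 0 <= chi p by apply: le_trans c1.
  apply: ge0_ler_powR; rewrite ?nnegrE//.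
    by rewrite (le_trans _ (weight_exponent_ge1 gamma_gt1)).
  by apply: le_trans (ler_norm _) (le_trans (HM _ Kp) (ler_norm _)).
have Mp0 : 0 <= Mp by exact: powR_ge0.
have Mp1 : 0 < Mp + 1 by rewrite ltr_wpDl.
(* One share (e / 2)^2 off the support and two on it, for the weighted mass and for the gradient;
   three shares stay below e^2. *)
pose d := e ^+ 2 / 4.
have d0 : 0 < d by rewrite divr_gt0 ?exprn_gt0.
have [||N1 HN1] := HS t (fun m => test_smooth (tt m)) _ _ d d0.
- move=> r r0; have sr0 : 0 < Num.sqrt r by rewrite sqrtr_gt0.
  have [N HN] := tC _ sr0.
  exists N => m l Nm Nl; have [tv jv] := testB (tt m) (tt l).
  apply: le_trans (grad_le_norm tv) _; rewrite jv lee_fin.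
  rewrite -[leRHS](sqr_sqrtr (ltW r0)) lerXn2r// ?nnegrE ?sqrtr_ge0//; exact: HN.
- move=> r r0; have [N HN] := t0 r r0; exists N => m Nm.
  by rewrite sqint_interior//; exact: HN.
have [N2 HN2] := t0 (d / (Mp + 1)) (divr_gt0 d0 Mp1).
exists (maxn k (maxn N1 N2)) => m; rewrite !geq_max => /and3P[km N1m N2m].
have sm := test_smooth (tt m).
have mde := measurable_dens chi_weight sm.
suff : (energy mu chi (t m) <= (d + d + d)%:E)%E.
  rewrite energy_norm// lee_fin => h.
  rewrite -(@ler_pXn2r _ 2)// ?nnegrE ?(ltW e0)//; apply: le_trans h _.
  rewrite -[leRHS](@divfK _ 4) ?pnatr_eq0// -/d mulr_natr !mulrS mulr0n addr0 !addrA.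
  by rewrite lerDl ltW.
rewrite /energy E.
have EV : (\int[nu]_(q in V) (dens chi (t m) q)%:E <= d%:E)%E.
  have [tv jv] := testB (tt m) (tt k).
  apply: (@le_trans _ _ (\int[nu]_(q in V) (dens chi (fun x => t m x - t k x) q)%:E)%E).
    rewrite le_eqVlt; apply/orP; left; apply/eqP; apply: eq_integral => q /set_mem [qI nKq].
    rewrite /dens tK// subr0; congr (_ + _)%:E.
    (* The gradient sees a neighbourhood of q, on which t k vanishes because K is closed. *)
    apply: (gradN_near mfd gm sm (test_smooth tv) qI).
    have : \forall z \near q, (~` K) z by apply: open_nbhs_nbhs; split => //; exact: closed_openC.
    by apply: filterS => z nKz; rewrite tK// subr0.
  apply: (@le_trans _ _ (energy mu chi (fun x => t m x - t k x))).
    apply: ge0_subset_integral => //.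
    - by apply/measurable_EFinP; exact: (measurable_dens chi_weight (test_smooth tv)).
    - by move=> q _; rewrite lee_fin dens_ge0.
  rewrite energy_norm// jv lee_fin /d (_ : e ^+ 2 / 4 = (e / 2) ^+ 2); last first.
    by rewrite exprMn exprVn -natrX.
  by rewrite lerXn2r// ?nnegrE// ?divr_ge0 ?(ltW e0)//; exact: Hk.
have EK : (\int[nu]_(q in (K : set (Bor T))) (dens chi (t m) q)%:E <= d%:E + d%:E)%E.
  have mu2 : measurable_fun (K : set (Bor T)) (fun q => (t m q ^+ 2)%:E).
    apply/measurable_EFinP; apply: measurable_funS (measurable_sqrM sm) => //.
  have mgr : measurable_fun (IM : set (Bor T)) (fun q => (gradN g (t m) q)%:E).
    by apply/measurable_EFinP; exact: (measurable_gradN mfd gm sm).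
  apply: (@le_trans _ _ (\int[nu]_(q in (K : set (Bor T)))
      (Mp%:E * (t m q ^+ 2)%:E + (gradN g (t m) q)%:E))%E).
    apply: ge0_le_integral => //.
    - by move=> q _; rewrite lee_fin dens_ge0.
    - by apply/measurable_EFinP; exact: measurable_funS mde.
    - by apply: emeasurable_funD; [exact: measurable_funeM|exact: measurable_funS mgr].
    - move=> q Kq; rewrite -EFinM -EFinD lee_fin lerD2r ler_wpM2r ?sqr_ge0//; exact: chiM.
  rewrite ge0_integralD//; first last.
  - exact: measurable_funS mgr.
  - by move=> q _; rewrite lee_fin gradN_ge0.
  - exact: measurable_funeM.
  - by move=> q _; rewrite -EFinM lee_fin mulr_ge0 ?sqr_ge0.
  apply: leeD.
    rewrite ge0_integralZl//; last by move=> q _; rewrite lee_fin sqr_ge0.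
    apply: (@le_trans _ _ (Mp%:E * (d / (Mp + 1))%:E)%E).
      apply: lee_wpmul2l; first by rewrite lee_fin.
      apply: le_trans (HN2 m N2m); apply: ge0_subset_integral => //.
      - exact: (measurable_sqr_EFin (measurable_test (tt m))).
      - by move=> q _; rewrite lee_fin sqr_ge0.
    rewrite -EFinM lee_fin mulrCA ler_piMr ?(ltW d0)// ler_pdivrMr// mul1r lerDl//.
  apply: le_trans (HN1 m N1m); apply: ge0_subset_integral => //.
  - exact: measurable_funS mgr.
  - by move=> q _; rewrite lee_fin gradN_ge0.
rewrite 2!EFinD; apply: (le_setU_sqr mfd mK mV KI VI mde) => // q _; exact: dens_ge0.
Qed.

End SobolevSpace.

Section L2Extra.
Context d (T : measurableType d) (R : realType) (mu : {measure set T -> \bar R}).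
Implicit Types f h : T -> R.

Lemma sqintC f h : sqint mu (fun x => f x - h x) = sqint mu (fun x => h x - f x).
Proof. by apply: eq_integral => x _; rewrite -sqrrN opprB. Qed.

Lemma sqintZ (a : R) f : measurable_fun setT f ->
  sqint mu (fun x => a * f x) = ((a ^+ 2)%:E * sqint mu f)%E.
Proof.
move=> mf; rewrite -ge0_integralZl//.
- by apply: eq_integral => x _; rewrite -EFinM exprMn.
- exact: measurable_sqr_EFin.
- by move=> x _; rewrite lee_fin sqr_ge0.
- by rewrite lee_fin sqr_ge0.
Qed.

Lemma sqintD_le f h (a c : R) : measurable_fun setT f -> measurable_fun setT h ->
  (sqint mu f <= a%:E)%E -> (sqint mu h <= c%:E)%E ->
  (sqint mu (fun x => (f x + h x)%R) <= (2 * a + 2 * c)%:E)%E.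
Proof.
move=> mf mh fa hc; apply: le_trans (sqintD mu mf mh) _.
by rewrite (EFinD (2 * a)) (EFinM 2 a) (EFinM 2 c); apply: leeD; apply: lee_wpmul2l => //; rewrite lee_fin.
Qed.

Lemma L2cvg_finite (u : nat -> T -> R) h : (forall m, measurable_fun setT (u m)) ->
  measurable_fun setT h -> L2cvg mu u h -> (forall m, (sqint mu (u m) < +oo)%E) ->
  (sqint mu h < +oo)%E.
Proof.
move=> mu_ mh uh ufin; have [N HN] := uh 1 ltr01.
have mB : measurable_fun setT (fun x => h x - u N x) by exact: measurable_funB.
have -> : h = (fun x => (h x - u N x) + u N x) by apply/funext => x; rewrite subrK.
apply: le_lt_trans (sqintD mu mB (mu_ N)) _; apply: lte_add_pinfty; apply: lte_mul_pinfty => //.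
by rewrite sqintC; apply: le_lt_trans (HN N _) _; rewrite ?ltry.
Qed.

(** The triangle inequality for squared norms, where the factor 2 replaces square roots of extended
    reals. *)
Lemma sqint_tri f h (k : T -> R) (a c : R) :
  measurable_fun setT f -> measurable_fun setT h -> measurable_fun setT k ->
  (sqint mu (fun x => (f x - h x)%R) <= a%:E)%E ->
  (sqint mu (fun x => (h x - k x)%R) <= c%:E)%E ->
  (sqint mu (fun x => (f x - k x)%R) <= (2 * a + 2 * c)%:E)%E.
Proof.
move=> mf mh mk fa hc.
have -> : (fun x => f x - k x) = (fun x => (f x - h x) + (h x - k x)).
  by apply/funext => x; rewrite addrA subrK.
by apply: sqintD_le => //; exact: measurable_funB.
Qed.

Lemma sqint_small f : measurable_fun setT f ->
  (forall e : R, 0 < e -> (sqint mu f <= e%:E)%E) -> {ae mu, forall x, f x = 0}.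
Proof.
move=> mf fe; apply: sqint0_ae => //; apply/eqP; rewrite eq_le; apply/andP; split.
  by apply/lee_addgt0Pr => e e0; rewrite add0e; exact: fe.
by apply: integral_ge0 => x _; rewrite lee_fin sqr_ge0.
Qed.

End L2Extra.

Lemma sqrD_le (R : realType) (x y : R) : (x + y) ^+ 2 <= 2 * x ^+ 2 + 2 * y ^+ 2.
Proof. by have := sqr_ge0 (x - y); nra. Qed.

Lemma sqr_dist_le (R : realType) (W : normedModType R) (u v w : W) (d : R) :
  `|v - w| <= d -> `|u - v| ^+ 2 <= 2 * `|u - w| ^+ 2 + 2 * d ^+ 2.
Proof.
move=> vd; have t : `|u - v| <= `|u - w| + d.
  have -> : u - v = (u - w) + (w - v) by rewrite addrA subrK.
  by apply: le_trans (ler_normD _ _) _; rewrite lerD2l distrC.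
have d0 : 0 <= d by apply: le_trans vd.
apply: (@le_trans _ _ ((`|u - w| + d) ^+ 2)); last exact: sqrD_le.
by rewrite lerXn2r ?nnegrE ?addr_ge0.
Qed.

Lemma ecvg0 (R : realType) (f : nat -> \bar R) : (forall m, (0 <= f m)%E) ->
  (forall e : R, 0 < e -> exists N, forall m, (N <= m)%N -> (f m <= e%:E)%E) ->
  f @ \oo --> 0%E.
Proof.
move=> f0 fe; apply/fine_cvgP; split.
  have [N HN] := fe 1 ltr01; exists N => // m /= Nm.
  by rewrite ge0_fin_numE// (le_lt_trans (HN m Nm))// ltry.
apply/cvgrPdist_le => e e0; have [N HN] := fe e e0; exists N => // m /= Nm.
rewrite sub0r normrN ger0_norm ?fine_ge0// -lee_fin fineK ?HN//.
by rewrite ge0_fin_numE// (le_lt_trans (HN m Nm))// ltry.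
Qed.

(** * Construction and properties of the embedding *)

Section Embedding.
Variables (R : realType) (gamma : R) (b f : nat).
Hypothesis gamma_gt1 : 1 < gamma.
Variable X : horn_manifold gamma b f.
Variable mu : {measure set (borel X) -> \bar R}.
Hypothesis mu_vol : is_volume mu.
Variable chi : X -> R.
Hypothesis chi_weight : is_weight chi.
Variables (W : completeNormedModType R) (j : (X -> R) -> W).
Hypothesis W_sobolev : is_sobolev_space mu chi 1 2 (gamma - (b + f).+1%:R * gamma / 2) j.
Notation test := (@test_function R gamma b f X).

Lemma approx_seq (w : nat -> W) : exists u : nat -> X -> R, (forall m, test (u m)) /\
  forall e : R, 0 < e -> exists N, forall m, (N <= m)%N -> `|j (u m) - w m| <= e.
Proof.
have H m : exists u, test u /\ `|j u - w m| < m.+1%:R^-1.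
  have [|u tu uw] := test_approx W_sobolev (w m) (e := m.+1%:R^-1).
    by rewrite invr_gt0.
  by exists u.
have [u Hu] := choice H; exists u; split => [m|e e0]; first exact: (Hu m).1.
exists (Num.truncn e^-1) => m Nm; apply: le_trans (ltW (Hu m).2) _.
rewrite invf_ple ?posrE// ltW// (lt_le_trans (truncnS_gt _))// ler_nat ltnS//.
Qed.

(** The constant 4 comes from two uses of (x + y)^2 <= 2 x^2 + 2 y^2, one in [W] and one in L^2. *)
Lemma embedding_exists (w : W) : exists z : LspaceType2 mu, forall u, test u ->
  (sqint mu (fun x => (u x - z x)%R) <= (4 * `|j u - w| ^+ 2)%:E)%E.
Proof.
have [u [tu uw]] := approx_seq (fun=> w).
have mu_ m : measurable_fun setT (u m : borel X -> R) by exact: measurable_test (tu m).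
have cu : L2cauchy mu u.
  move=> e e0; have se0 : 0 < Num.sqrt (e / 4) by rewrite sqrtr_gt0 divr_gt0.
  have [N HN] := uw _ se0; exists N => m l Nm Nl.
  apply: le_trans (sqintB_le_norm gamma_gt1 mu_vol chi_weight W_sobolev (tu m) (tu l)) _.
  rewrite lee_fin; apply: le_trans (sqr_dist_le _ (HN l Nl)) _.
  have s2 : Num.sqrt (e / 4) ^+ 2 = e / 4 by rewrite sqr_sqrtr// divr_ge0// ltW.
  have : `|j (u m) - w| ^+ 2 <= Num.sqrt (e / 4) ^+ 2.
    by rewrite lerXn2r// ?nnegrE ?sqrtr_ge0//; exact: HN.
  rewrite s2; lra.
have [h mh uh] := L2_complete mu_ cu.
have hfin := L2cvg_finite mu_ mh uh
  (fun m => le_lt_trans (sqint_le_norm gamma_gt1 mu_vol chi_weight W_sobolev (tu m)) (ltry _)).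
have [z zh] := Lspace2_rep mh hfin.
have mz := measurable_Lspace2 z.
exists z => v tv; have mv : measurable_fun setT (v : borel X -> R) by exact: measurable_test tv.
apply/lee_addgt0Pr => e e0; rewrite -EFinD.
(* The final error is 2 (2 e / 8) + 2 (e / 4) = e. *)
have se0 : 0 < Num.sqrt (e / 8) by rewrite sqrtr_gt0 divr_gt0.
have [N HN] := uw _ se0; have [M HM] := uh _ (divr_gt0 e0 (ltr0n _ 4)).
pose m := maxn N M.
have h1 : (sqint mu (fun x => (v x - u m x)%R) <= (2 * `|j v - w| ^+ 2 + 2 * (e / 8))%:E)%E.
  apply: le_trans (sqintB_le_norm gamma_gt1 mu_vol chi_weight W_sobolev tv (tu m)) _.
  rewrite lee_fin; apply: le_trans (sqr_dist_le _ (HN m (leq_maxl _ _))) _.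
  by rewrite sqr_sqrtr// divr_ge0// ltW.
have h2 : (sqint mu (fun x => (u m x - z x)%R) <= (e / 4)%:E)%E.
  rewrite (@sqint_ae _ (borel X) R mu _ (fun x : borel X => u m x - h x : R)); first exact: HM (leq_maxr _ _).
  - exact: measurable_funB.
  - exact: measurable_funB.
  - by apply: filterS zh => x ->.
apply: le_trans (sqint_tri mv (mu_ m) mz h1 h2) _; rewrite lee_fin; lra.
Qed.

(** This estimate holds all that is used of the construction: w = j u gives the extension property,
    u = 0 gives continuity, and density gives the rest. *)
Definition embeds (iota : W -> LspaceType2 mu) := forall w u, test u ->
  (sqint mu (fun x => (u x - iota w x)%R) <= (4 * `|j u - w| ^+ 2)%:E)%E.

Section Properties.
Variable iota : W -> LspaceType2 mu.
Hypothesis iotaP : embeds iota.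

Let miota w : measurable_fun setT (iota w : borel X -> R) := measurable_Lspace2 (iota w).
Let mtest u : test u -> measurable_fun setT (u : borel X -> R).
Proof. exact: measurable_test. Qed.

Lemma embeds_close w u (e : R) : test u -> `|j u - w| <= e ->
  (sqint mu (fun x => (u x - iota w x)%R) <= (4 * e ^+ 2)%:E)%E.
Proof.
move=> tu ue; apply: le_trans (iotaP w tu) _.
by rewrite lee_fin ler_wpM2l// lerXn2r ?nnegrE// (le_trans _ ue).
Qed.

Lemma embeds_linear (a : R) v w :
  {ae mu, forall x, iota (a *: v + w) x = a * iota v x + iota w x}.
Proof.
have mr : measurable_fun setT (fun x : borel X => a * iota v x + iota w x : R).
  by apply: measurable_funD => //; exact: measurable_funM.
suff : {ae mu, forall x, iota (a *: v + w) x - (a * iota v x + iota w x) = 0}.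
  by apply: filterS => x /eqP; rewrite subr_eq0 => /eqP.
apply: sqint_small => [|e e0]; first exact: measurable_funB.
(* Collects the coefficients of s^2: 2 * 4 (|a| + 1)^2 from the combination, and 2 * 2 * 4 a^2 and 2
   * 2 * 4 from v and w. *)
pose K := 8 * (`|a| + 1) ^+ 2 + 16 * a ^+ 2 + 16.
have K0 : 0 < K.
  have := sqr_ge0 a; have := sqr_ge0 (`|a| + 1); rewrite /K; lra.
have s0 : 0 < Num.sqrt (e / K) by rewrite sqrtr_gt0 divr_gt0.
set s := Num.sqrt (e / K) in s0.
have s2 : K * s ^+ 2 = e by rewrite sqr_sqrtr ?divr_ge0 ?(ltW e0) ?(ltW K0)// mulrC divfK// gt_eqF.
have [u tu us] := test_approx W_sobolev v s0.
have [u' tu' us'] := test_approx W_sobolev w s0.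
have tG := test_lin a tu tu'.
have h1 : (sqint mu (fun x => (iota (a *: v + w) x - (a * u x + u' x))%R) <=
    (4 * ((`|a| + 1) * s) ^+ 2)%:E)%E.
  rewrite sqintC; apply: embeds_close tG _; rewrite (sb_linear W_sobolev)//.
  rewrite opprD addrACA -scalerBr; apply: le_trans (ler_normD _ _) _.
  rewrite normrZ mulrDl mul1r; apply: lerD; last exact: ltW.
  by rewrite ler_wpM2l// ltW.
have h2 : (sqint mu (fun x => (a * (u x - iota v x))%R) <= (a ^+ 2 * (4 * s ^+ 2))%:E)%E.
  rewrite sqintZ; last exact: measurable_funB (mtest tu) (miota v).
  rewrite (EFinM (a ^+ 2)); apply: lee_wpmul2l; first by rewrite lee_fin sqr_ge0.
  exact: embeds_close tu (ltW us).
have h3 := embeds_close tu' (ltW us').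
have m2 : measurable_fun setT (fun x : borel X => a * (u x - iota v x) : R).
  by apply: measurable_funM => //; apply: measurable_funB => //; exact: mtest.
have m3 : measurable_fun setT (fun x : borel X => u' x - iota w x : R).
  by apply: measurable_funB => //; exact: mtest.
have h4 := sqintD_le m2 m3 h2 h3.
have E : (fun x : borel X => a * (u x - iota v x) + (u' x - iota w x)) =
    (fun x => (a * u x + u' x) - (a * iota v x + iota w x)).
  by apply/funext => x; ring.
rewrite E in h4.
apply: le_trans (sqint_tri (miota _) (mtest tG) mr h1 h4) _.
rewrite lee_fin -s2 /K exprMn le_eqVlt; apply/orP; left; apply/eqP; ring.
Qed.

Lemma embeds_extends u : test u -> {ae mu, forall x, iota (j u) x = u x}.
Proof.
move=> tu; suff : {ae mu, forall x : borel X, u x - iota (j u) x = 0}.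
  by apply: filterS => x /eqP; rewrite subr_eq0 => /eqP ->.
apply: sqint_small => [|e e0]; first by apply: measurable_funB => //; exact: mtest.
by apply: le_trans (iotaP (j u) tu) _; rewrite subrr normr0 expr0n mulr0 lee_fin ltW.
Qed.

Lemma embeds_continuous w : ('N[mu]_2[(fun x => (iota w x)%:E)] <= (2 * `|w|)%:E)%E.
Proof.
apply: Lnorm2_le; first by rewrite mulr_ge0.
have [t0 j0] := test0 W_sobolev; have := iotaP w t0.
rewrite j0 sub0r normrN sqintC; under eq_fun do rewrite subr0.
by rewrite exprMn -natrX.
Qed.

(** Differences of test functions approximating v and w tend to v - w in [W] and, the images being
    equal, to 0 in L^2; by [test_closable] they tend to 0 in [W]. *)
Lemma embeds_injective : injective iota.
Proof.
move=> v w vw.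
have [u [tu uv]] := approx_seq (fun=> v); have [u' [tu' uw]] := approx_seq (fun=> w).
pose t m x := u m x - u' m x.
have tt m : test (t m) by have [] := testB W_sobolev (tu m) (tu' m).
have jt m : j (t m) = j (u m) - j (u' m) by have [] := testB W_sobolev (tu m) (tu' m).
have jd m : j (t m) - (v - w) = (j (u m) - v) - (j (u' m) - w)
  by rewrite jt !opprB [w - v]addrC addrACA [- _ + w]addrC.
have tvw (e : R) : 0 < e -> exists N, forall m, (N <= m)%N -> `|j (t m) - (v - w)| <= e.
  move=> e0; have e2 := divr_gt0 e0 (ltr0n R 2).
  have [N HN] := uv _ e2; have [M HM] := uw _ e2.
  exists (maxn N M) => m; rewrite geq_max => /andP[Nm Mm].
  by rewrite jd [e]splitr (le_trans (ler_normB _ _))// lerD ?HN ?HM.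
have tC (e : R) : 0 < e -> exists N, forall m l, (N <= m)%N -> (N <= l)%N ->
    `|j (t m) - j (t l)| <= e.
  move=> e0; have [N HN] := tvw _ (divr_gt0 e0 (ltr0n R 2)).
  exists N => m l Nm Nl; rewrite -(subrKA (v - w)) [e]splitr.
  by rewrite (le_trans (ler_normD _ _))// lerD ?HN// distrC HN.
have t0 (e : R) : 0 < e -> exists N, forall m, (N <= m)%N -> (sqint mu (t m) <= e%:E)%E.
  move=> e0; have s0 : 0 < Num.sqrt (e / 16) by rewrite sqrtr_gt0 divr_gt0.
  have [N HN] := uv _ s0; have [M HM] := uw _ s0.
  exists (maxn N M) => m; rewrite geq_max => /andP[Nm Mm].
  have h1 := embeds_close (tu m) (HN m Nm).
  have h2 := embeds_close (tu' m) (HM m Mm).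
  rewrite sqintC -vw in h2.
  apply: le_trans (sqint_tri (mtest (tu m)) (miota v) (mtest (tu' m)) h1 h2) _.
  rewrite lee_fin sqr_sqrtr ?divr_ge0 ?(ltW e0)//; lra.
have tz := test_closable gamma_gt1 mu_vol chi_weight W_sobolev tt tC t0.
apply/eqP; rewrite -subr_eq0 -normr_le0; apply/ler_addgt0Pr => e e0; rewrite add0r.
have e2 := divr_gt0 e0 (ltr0n R 2).
have [N HN] := tvw _ e2; have [M HM] := tz _ e2.
pose m := maxn N M.
rewrite -(subrK (j (t m)) (v - w)) [e]splitr (le_trans (ler_normD _ _))// lerD//.
  by rewrite distrC HN// leq_maxl.
by rewrite HM// leq_maxr.
Qed.

Lemma embeds_compact (w_ : nat -> W) : (exists C : R, forall m, `|w_ m| <= C) ->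
  exists (s : nat -> nat) (v : LspaceType2 mu),
    {homo s : m1 m2 / (m1 < m2)%N} /\
    ('N[mu]_2[(fun x => (iota (w_ (s m)) x - v x)%:E)] @[m --> \oo] --> 0)%E.
Proof.
move=> [C wC]; have [u0 [tu0 uw0]] := approx_seq w_.
have [N0 HN0] := uw0 1 ltr01.
(* The shift makes every approximation within 1 of its target, so the bound C + 1 is uniform. *)
pose u m := u0 (N0 + m)%N.
have tu m : test (u m) by exact: tu0.
have uC m : `|j (u m)| <= C + 1.
  rewrite -(subrK (w_ (N0 + m)%N) (j (u m))) addrC; apply: le_trans (ler_normD _ _) _.
  by apply: lerD; [exact: wC|apply: HN0; exact: leq_addr].
(* Refining the filter of tails makes every set of U unbounded. *)
have [U [UU Uoo]] := @ultraFilterLemma nat (\oo : set_system nat) eventually_filter.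
have Ucof N : U [set k | (N <= k)%N] by apply: Uoo; exact: nbhs_infty_ge.
pose Q (e : R) m l := (sqint mu (fun x => (u m x - u l x)%R) <= e%:E)%E.
have [||s sH sC] := @ultra_subseq R U Q UU Ucof.
- by move=> e e' m l ee h; apply: le_trans h _; rewrite lee_fin.
- exact: (test_rellich gamma_gt1 mu_vol chi_weight W_sobolev tu uC UU).
have [h mh uh] := L2_complete (fun m => mtest (tu (s m))) sC.
have hfin := L2cvg_finite (fun m => mtest (tu (s m))) mh uh
  (fun m => le_lt_trans (sqint_le_norm gamma_gt1 mu_vol chi_weight W_sobolev (tu _)) (ltry _)).
have [v vh] := Lspace2_rep mh hfin.
exists (fun m => N0 + s m)%N, v; split; first by move=> m l ml; rewrite ltn_add2l; exact: sH.
apply: ecvg0 => [m|e e0]; first exact: Lnorm_ge0.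
have sm m : (m <= s m)%N.
  by elim: m => // m IH; apply: leq_ltn_trans IH (sH _ _ (ltnSn m)).
(* The squared errors are 4 (e / 4)^2 and e^2 / 4; twice their sum is e^2. *)
have e16 : 0 < e / 4 by rewrite divr_gt0.
have [N HN] := uw0 _ e16; have [M HM] := uh _ (divr_gt0 (exprn_gt0 2 e0) (ltr0n R 4)).
exists (maxn N M) => m; rewrite geq_max => /andP[Nm Mm].
apply: Lnorm2_le; first exact: ltW.
have h1 : (sqint mu (fun x => (iota (w_ (N0 + s m)%N) x - u (s m) x)%R) <= (4 * (e / 4) ^+ 2)%:E)%E.
  rewrite sqintC; apply: embeds_close (tu _) _; apply: HN.
  exact: leq_trans Nm (leq_trans (sm m) (leq_addl _ _)).
have h2 : (sqint mu (fun x => (u (s m) x - v x)%R) <= (e ^+ 2 / 4)%:E)%E.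
  rewrite (@sqint_ae _ (borel X) R mu _ (fun x : borel X => u (s m) x - h x : R)); first exact: HM.
  - by apply: measurable_funB; [exact: mtest|exact: measurable_Lspace2].
  - by apply: measurable_funB => //; exact: mtest.
  - by apply: filterS vh => x ->.
apply: le_trans (sqint_tri (miota _) (mtest (tu _)) (measurable_Lspace2 v) h1 h2) _.
by rewrite lee_fin le_eqVlt; apply/orP; left; apply/eqP; field.
Qed.

End Properties.

End Embedding.

Theorem proposition7p4 (R : realType) (gamma : R) (b f : nat) (gamma_gt1 : 1 < gamma)
    (X : horn_manifold gamma b f)
    (mu : {measure set (borel X) -> \bar R}) (mu_vol : is_volume mu)
    (chi : X -> R) (chi_weight : is_weight chi)
    (W : completeNormedModType R) (j : (X -> R) -> W)
    (W_sobolev : is_sobolev_space mu chi 1 2 (gamma - (b + f).+1%:R * gamma / 2) j) :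
  exists iota : W -> LspaceType2 mu, is_compact_L2_embedding j iota.
Proof.
have [iota iotaP] := choice (embedding_exists gamma_gt1 mu_vol chi_weight W_sobolev).
exists iota; split.
- exact: (embeds_linear W_sobolev iotaP).
- exact: embeds_extends iotaP.
- exact: (embeds_injective gamma_gt1 mu_vol chi_weight W_sobolev iotaP).
- by exists 2 => w; exact: (embeds_continuous W_sobolev iotaP).
- exact: (embeds_compact gamma_gt1 mu_vol chi_weight W_sobolev iotaP).
Qed.
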